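(* There is an absolute constant $c>0$ such that the following holds. Let $H$ be a Hamiltonian on $n$ qubits, $\beta>0$, $\rho=e^{-\beta H}/\mathrm{Tr}[e^{-\beta H}]$, let $A^a$ be a Hermitian jump operator and $\mathcal L_a$ the associated KMS-$\rho$-detailed-balanced Lindbladian (defined in the context). Then for every state $\sigma$, $$\|\mathcal L_a[\sigma]\|_1\le c\,\|A^a\|\,\sqrt{\mathsf{ADB}_a[\sigma]}.$$
   Context: $0<\kappa\le1/\beta$ is a Gaussian width. With $f(t)=e^{-\kappa^2t^2}\sqrt{\kappa\sqrt{2/\pi}}$, for an operator $A$ put $\hat A(\omega)=\frac1{\sqrt{2\pi}}\int_{-\infty}^\infty e^{iHt}Ae^{-iHt}e^{-i\omega t}f(t)\,dt$ and $\hat A(\omega,t)=e^{iHt}\hat A(\omega)e^{-iHt}$. With $\gamma(\omega)=\exp(-\beta\max(\omega+\beta\kappa^2/2,0))$, $$\mathcal L_a[X]=-i[C^a,X]+\int_{-\infty}^\infty\gamma(\omega)\Big(\hat A^a(\omega)X\hat A^a(\omega)^\dagger-\tfrac12\{\hat A^a(\omega)^\dagger\hat A^a(\omega),X\}\Big)d\omega,$$ $C^a=\iint\gamma(\omega)c(t)\,\hat A^a(\omega,t)^\dagger\hat A^a(\omega,t)\,dt\,d\omega$, $c(t)=\frac1{\beta\sinh(2\pi t/\beta)}$ (principal value at $t=0$). Approximate detailed balance error, with $g(t)=\frac1{\beta\cosh(2\pi t/\beta)}$: $$\mathsf{ADB}_a[\sigma]=\iint_{-\infty}^\infty\Big\|\hat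 A^a(\omega,t)\sqrt\sigma-\sqrt\sigma\,\rho^{-\frac12}\hat A^a(\omega,t)\rho^{\frac12}\Big\|_2^2\,\gamma(\omega)g(t)\,d\omega\,dt.$$ $\|\cdot\|$, $\|\cdot\|_1$, $\|\cdot\|_2$ are the operator, trace and Hilbert–Schmidt norms. *)

(* Defs.v *)
From HB Require Import structures.
From mathcomp Require Import all_boot all_order all_algebra.
From mathcomp Require Import complex.
From mathcomp Require Import all_classical all_reals all_analysis.

Set Implicit Arguments.
Unset Strict Implicit.
Unset Printing Implicit Defensive.
Import Order.TTheory GRing.Theory Num.Theory.
Import numFieldNormedType.Exports.

Local Open Scope classical_set_scope.
Local Open Scope ring_scope.
Local Open Scope sesquilinear_scope.
Local Open Scope complex_scope.

(* Continuous functional calculus of a Hermitian matrix: if H = P^-1 diag(x) P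
   with P unitary and x real, then fun_herm f H = P^-1 diag(f(x)) P. *)
Definition fun_herm {R : realType} {d : nat} (f : R -> R[i]) (H : 'M[R[i]]_d) :
    'M[R[i]]_d :=
  invmx (spectralmx H)
  *m diag_mx (map_mx (fun z => f (complex.Re z)) (spectral_diag H))
  *m spectralmx H.

Definition cis {R : realType} (x : R) : R[i] := cos x +i* sin x.

(* e^{iHt} *)
Definition evol {R : realType} {d : nat} (H : 'M[R[i]]_d) (t : R) : 'M[R[i]]_d :=
  fun_herm (fun x => cis (x * t)) H.

Definition sqrtmx {R : realType} {d : nat} (A : 'M[R[i]]_d) : 'M[R[i]]_d :=
  fun_herm (fun x => (Num.sqrt x)%:C) A.

Definition powmx {R : realType} {d : nat} (A : 'M[R[i]]_d) (p : R) : 'M[R[i]]_d :=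
  fun_herm (fun x => (x `^ p)%:C) A.

Definition gibbs {R : realType} {d : nat} (beta : R) (H : 'M[R[i]]_d) :
    'M[R[i]]_d :=
  let E := fun_herm (fun x => (expR (- beta * x))%:C) H in (\tr E)^-1 *: E.

Definition psdmx {R : realType} {d : nat} (A : 'M[R[i]]_d) : Prop :=
  A \is hermsymmx /\ forall v : 'cV[R[i]]_d, 0 <= (v^t* *m A *m v) 0 0.

Definition is_state {R : realType} {d : nat} (A : 'M[R[i]]_d) : Prop :=
  psdmx A /\ \tr A = 1.

(* Hilbert-Schmidt norm; on a column vector it is the Euclidean norm. *)
Definition hsnorm {R : realType} {m n : nat} (X : 'M[R[i]]_(m, n)) : R :=
  Num.sqrt (complex.Re (\tr (X^t* *m X))).

Definition opnorm {R : realType} {d : nat} (A : 'M[R[i]]_d) : R :=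
  sup [set hsnorm (A *m v) | v in [set v : 'cV[R[i]]_d | hsnorm v = 1]].

Definition trnorm {R : realType} {d : nat} (X : 'M[R[i]]_d) : R :=
  complex.Re (\tr (sqrtmx (X^t* *m X))).

(* Cauchy principal value at 0 of the integral of F over the real line. *)
Definition pvint {R : realType} (F : R -> R) : R :=
  lim ((\int[lebesgue_measure]_(t in [set t : R | e < `|t|]) F t) @[e --> 0^'+]).

(* Extends a real-linear functional on real functions to matrix-valued ones,
   acting on the real and imaginary part of every entry. *)
Definition entrywise {R : realType} {d : nat} (J : (R -> R) -> R)
    (F : R -> 'M[R[i]]_d) : 'M[R[i]]_d :=
  \matrix_(i, j) (J (fun t => complex.Re (F t i j))
                  +i* J (fun t => complex.Im (F t i j))).

Definition mxint {R : realType} {d : nat} (F : R -> 'M[R[i]]_d) : 'M[R[i]]_d :=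
  entrywise (fun f => \int[lebesgue_measure]_t f t) F.

Definition mxpvint {R : realType} {d : nat} (F : R -> 'M[R[i]]_d) :
    'M[R[i]]_d :=
  entrywise pvint F.

Definition gauss_filter {R : realType} (kappa t : R) : R :=
  expR (- (kappa ^+ 2 * t ^+ 2)) * Num.sqrt (kappa * Num.sqrt (2 / pi)).

Definition gamma_rate {R : realType} (beta kappa w : R) : R :=
  expR (- (beta * Num.max (w + beta * kappa ^+ 2 / 2) 0)).

Definition sinhR {R : realType} (x : R) : R := (expR x - expR (- x)) / 2.
Definition coshR {R : realType} (x : R) : R := (expR x + expR (- x)) / 2.

Definition c_kernel {R : realType} (beta t : R) : R :=
  1 / (beta * sinhR (2 * pi * t / beta)).

Definition g_kernel {R : realType} (beta t : R) : R :=
  1 / (beta * coshR (2 * pi * t / beta)).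

(* The operator Fourier transform of A at frequency w. *)
Definition oft {R : realType} {d : nat} (H : 'M[R[i]]_d) (kappa : R)
    (A : 'M[R[i]]_d) (w : R) : 'M[R[i]]_d :=
  (1 / Num.sqrt (2 * pi))%:C *:
  mxint (fun t => (cis (- (w * t)) * (gauss_filter kappa t)%:C) *:
                  (evol H t *m A *m evol H (- t))).

Definition oft_t {R : realType} {d : nat} (H : 'M[R[i]]_d) (kappa : R)
    (A : 'M[R[i]]_d) (w t : R) : 'M[R[i]]_d :=
  evol H t *m oft H kappa A w *m evol H (- t).

(* For fixed w, the principal value is taken in the inner integral over t. *)
Definition coherent {R : realType} {d : nat} (H : 'M[R[i]]_d) (beta kappa : R)
    (A : 'M[R[i]]_d) : 'M[R[i]]_d :=
  mxint (fun w => (gamma_rate beta kappa w)%:C *: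
    mxpvint (fun t => (c_kernel beta t)%:C *:
      ((oft_t H kappa A w t)^t* *m oft_t H kappa A w t))).

Definition lindblad {R : realType} {d : nat} (H : 'M[R[i]]_d) (beta kappa : R)
    (A X : 'M[R[i]]_d) : 'M[R[i]]_d :=
  let C := coherent H beta kappa A in
  - 'i *: (C *m X - X *m C)
  + mxint (fun w =>
      let Aw := oft H kappa A w in
      (gamma_rate beta kappa w)%:C *:
      (Aw *m X *m Aw^t*
       - 2^-1 *: (Aw^t* *m Aw *m X + X *m (Aw^t* *m Aw)))).

Definition ADB {R : realType} {d : nat} (H : 'M[R[i]]_d) (beta kappa : R)
    (A sigma : 'M[R[i]]_d) : R :=
  let rho := gibbs beta H in
  \int[lebesgue_measure]_t \int[lebesgue_measure]_w
    (hsnorm (oft_t H kappa A w t *m sqrtmx sigma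
             - sqrtmx sigma *m powmx rho (- 2^-1) *m oft_t H kappa A w t
               *m powmx rho 2^-1) ^+ 2
     * gamma_rate beta kappa w * g_kernel beta t).

(* Main.v *)
Require Import Defs.
From HB Require Import structures.
From mathcomp Require Import all_boot all_order all_algebra.
From mathcomp Require Import complex.
From mathcomp Require Import all_classical all_reals all_analysis.
From mathcomp Require Import measurable_realfun ring lra.

(** In the energy eigenbasis every integral over [(w, t)] acts entry by entry:
    the [w]-integral of [gamma] against two Gaussian filters is computed exactly,
    and [g], [c] act as multipliers on Bohr frequencies.  Their transforms [ghat]
    and [chat] satisfy [expR (beta nu / 4) * ghat nu = 1/2 + chat nu]; this follows
    by shifting the contour for [e^{i nu t} / cosh t] towards the pole at [i pi / 2].
    Write [x] for the square root of the state, [P] and [Q] for the jump operators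
    reweighted by [expR (- beta nu / 4)] and [expR (beta nu / 4)].  The multiplier
    identity and the KMS symmetry of the rates then give the balanced form:
    [L] is the integral of [gamma g (B + B')] with [B = D x Q' - Q' D x] and
    [D = P x - x Q], where the prime denotes the adjoint.

    Since [D] is a linear factor, AM-GM against a contraction [Y] dual to the trace
    norm bounds the trace of [Y' L] by [l (\iint g |Q Z|^2) + l^-1 (\iint gamma g |D|^2)],
    with [Z] one of [x], [Y x], [Y' x], up to constants.
    The reweighting of a Gaussian filter is a shift of [w] by [beta kappa^2 / 2] up to a
    scalar, so the first integral is controlled by Parseval and the operator norm of
    [A], and the second one by [ADB], because [gamma] is nonincreasing.  Optimising
    over [l] gives the square root. *)
Set Implicit Arguments.
Unset Strict Implicit.
Unset Printing Implicit Defensive.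
Import Order.TTheory GRing.Theory Num.Theory.
Import numFieldNormedType.Exports.

Local Open Scope classical_set_scope.
Local Open Scope ring_scope.

(** The frequency shift extracts from [Q] the weight [expR (beta * w / 4)] and from [D] its inverse.
    Both are unbounded in [w], and a fixed AM-GM parameter would leave them in place. Because they
    are inverse to each other, the parameter [lam / expR (beta * w / 2)], chosen anew at each
    frequency, removes both at once; afterwards [gamma <= 1] serves the term in [Q], and
    monotonicity of [gamma] the term in [D].

    The price of the factorised form [D x Q' - Q' D x] is the extra term [Q x Q' - Q' x Q],
    multiplied by [x] on either side. It has no counterpart in the Lindbladian and integrates to
    zero by KMS symmetry and Hermiticity of [A].

    All double integrals are iterated, and their integrands are finite sums of products of a
    function of [w] and a function of [t], so the order of integration is never exchanged. The pole
    contribution [pi] is obtained as a limit of contours that avoid the pole, with no residue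
    calculus.

    The constant [2 * sqrt 2 * e] consists of the optimised AM-GM bound and a bound on [boost ^+ 2]
    that follows from [kappa * beta <= 1]. *)

Notation rintegrable f :=
  ((@lebesgue_measure _).-integrable setT (EFin \o f)).

(** * Contour integrals and Fourier transforms *)

Section change_of_variables.
Context {R : realType}.
Notation mu := (@lebesgue_measure R).
Implicit Types f : R -> R.

Lemma measurable_affine (a b : R) :
  measurable_fun [set: measurableTypeR R]
    ((fun x => a * x + b) : measurableTypeR R -> measurableTypeR R).
Proof. by apply: measurable_funD => //; exact: measurable_funM. Qed.

(** The pushforward of Lebesgue measure under [a x + b], scaled by [|a|], gives every interval []p,
    q]] its length, hence is Lebesgue measure by uniqueness. For [a < 0] the preimage is half-open
    at the other end, whence the two cases. *)
Lemma ge0_integral_affine (a b : R) (f : R -> \bar R) : a != 0 ->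
  measurable_fun setT f -> (forall x, 0 <= f x)%E ->
  (\int[mu]_x f (a * x + b)%R = (`|a|^-1)%:E * \int[mu]_x f x)%E.
Proof.
move=> a0 mf f0.
pose phi : measurableTypeR R -> measurableTypeR R := fun x => a * x + b.
have mphi : measurable_fun setT phi by exact: measurable_affine.
pose nu0 : {measure set (measurableTypeR R) -> \bar R} :=
  mscale (NngNum (normr_ge0 a)) (pushforward mu phi).
pose nu := nu0 mphi.
have -> : (\int[mu]_x f x = \int[nu]_x f x)%E.
  apply: eq_measure_integral => A mA _.
  apply: (@lebesgue_measure_unique R nu) => // X /ocitvP [->|[[p q] /= pq ->]].
    by rewrite !measure0.
  rewrite /nu /nu0 /mscale /= /pushforward.
  have [a_gt0|a_le0] := ltP 0 a.
    have -> : phi @^-1` `]p, q] = `](p - b) / a, (q - b) / a]%classic.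
      apply/seteqP; split => x /=; rewrite !in_itv/= /phi.
        move=> /andP[h1 h2].
        by rewrite ltr_pdivrMr// ler_pdivlMr// ltrBlDr lerBrDr (mulrC x) h1 h2.
      by rewrite ltr_pdivrMr// ler_pdivlMr// ltrBlDr lerBrDr (mulrC x).
    rewrite !lebesgue_measure_itv /= !lte_fin pq ltr_pM2r ?invr_gt0// ltrD2r pq.
    rewrite gtr0_norm// -!EFinD -EFinM; congr EFin; field.
    by rewrite gt_eqF.
  have a_lt0 : a < 0 by rewrite lt_neqAle a0.
  have -> : phi @^-1` `]p, q] = `[(q - b) / a, (p - b) / a[%classic.
    apply/seteqP; split => x /=; rewrite !in_itv/= /phi.
      move=> /andP[h1 h2].
      by rewrite ler_ndivrMr// ltr_ndivlMr// lerBrDr ltrBlDr (mulrC x) h1 h2.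
    rewrite ler_ndivrMr// ltr_ndivlMr// lerBrDr ltrBlDr (mulrC x).
    by move=> /andP[-> ->].
  rewrite !lebesgue_measure_itv /= !lte_fin pq ltr_nM2r ?invr_lt0// ltrD2r pq.
  rewrite ltr0_norm// -!EFinD -EFinM; congr EFin; field.
  by rewrite lt_eqF.
rewrite ge0_integral_mscale//= ge0_integral_pushforward//.
rewrite muleA -EFinM mulVf ?normr_eq0// mul1e.
by rewrite preimage_setT.
Qed.

Lemma integrable_affine (a b : R) f : a != 0 -> rintegrable f ->
  rintegrable (fun x => f (a * x + b)).
Proof.
move=> a0 /integrableP[/measurable_EFinP mf intf]; apply/integrableP; split.
  apply/measurable_EFinP; apply: (measurableT_comp mf).
  exact: measurable_affine.
rewrite (@ge0_integral_affine a b (fun x => `|(f x)%:E|%E))//.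
  by apply: lte_mul_pinfty => //; rewrite lee_fin invr_ge0.
by apply: measurableT_comp => //; exact/measurable_EFinP.
Qed.

Lemma Rintegral_affine (a b : R) f : a != 0 -> rintegrable f ->
  \int[mu]_x f (a * x + b) = `|a|^-1 * \int[mu]_x f x.
Proof.
move=> a0 intf; have /integrableP[mf _] := intf.
have p := @ge0_integral_affine a b ((EFin \o f)^\+)%E a0
  (measurable_funepos mf) (fun=> funepos_ge0 _ _).
have n := @ge0_integral_affine a b ((EFin \o f)^\-)%E a0
  (measurable_funeneg mf) (fun=> funeneg_ge0 _ _).
rewrite /Rintegral integralE [in RHS]integralE.
transitivity (fine (\int[mu]_x ((EFin \o f)^\+)%E (a * x + b)%R -
  \int[mu]_x ((EFin \o f)^\-)%E (a * x + b)%R)%E).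
  by congr (fine (_ - _)%E); apply: eq_integral => x _;
    rewrite ?funeposE ?funenegE.
rewrite p n.
have pf : (\int[mu]_x (EFin \o f)^\+ x)%E \is a fin_num.
  by apply: integrable_fin_num => //; exact: integrable_funepos.
have nf : (\int[mu]_x (EFin \o f)^\- x)%E \is a fin_num.
  by apply: integrable_fin_num => //; exact: integrable_funeneg.
by rewrite -muleBr ?fin_num_adde_defr// fineM// fin_numB pf nf.
Qed.

Lemma integrable_shift (b : R) f : rintegrable f ->
  rintegrable (fun x => f (x + b)).
Proof.
move=> intf; rewrite (_ : (fun x => f (x + b)) = (fun x => f (1 * x + b))).
  exact: integrable_affine.
by apply/funext => x; rewrite mul1r.
Qed.

Lemma Rintegral_shift (b : R) f : rintegrable f ->
  \int[mu]_x f (x + b) = \int[mu]_x f x.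
Proof.
move=> /(@Rintegral_affine 1 b _ (oner_neq0 _)).
rewrite normr1 invr1 mul1r => <-.
by apply: eq_Rintegral => x _; rewrite mul1r.
Qed.

Lemma integrable_opp f : rintegrable f -> rintegrable (fun x => f (- x)).
Proof.
move=> intf; rewrite (_ : (fun x => f (- x)) = (fun x => f (-1 * x + 0))).
  by apply: integrable_affine => //; rewrite oppr_eq0 oner_eq0.
by apply/funext => x; rewrite mulN1r addr0.
Qed.

Lemma Rintegral_opp f : rintegrable f ->
  \int[mu]_x f (- x) = \int[mu]_x f x.
Proof.
move=> /(@Rintegral_affine (-1) 0 _ (negbT (lt_eqF (ltrN10 _)))).
rewrite normrN1 invr1 mul1r => <-.
by apply: eq_Rintegral => x _; rewrite mulN1r addr0.
Qed.

Lemma Rintegral_odd f : rintegrable f -> (forall x, f (- x) = - f x) ->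
  \int[mu]_x f x = 0.
Proof.
move=> intf fodd; have := Rintegral_opp intf.
under eq_Rintegral do rewrite fodd -mulN1r.
by rewrite RintegralZl// mulN1r; lra.
Qed.

End change_of_variables.

(** * Integrability by domination *)

Section domination.
Context {R : realType}.
Notation mu := (@lebesgue_measure R).
Implicit Types f g : R -> R.

Lemma le_rintegrable f g : measurable_fun setT f -> rintegrable g ->
  (forall x, `|f x| <= g x) -> rintegrable f.
Proof.
move=> mf intg fg; apply: (le_integrable _ _ _ intg) => //.
  exact/measurable_EFinP.
by move=> x _ /=; rewrite lee_fin (le_trans (fg x))// ler_norm.
Qed.

Lemma rintegrableZl k f : rintegrable f -> rintegrable (fun x => k * f x).
Proof.
move=> intf; rewrite [X in _.-integrable _ X](_ : _ =
    fun x => k%:E * (EFin \o f) x)%E//.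
exact: integrableZl.
Qed.

Lemma rintegrableD f g : rintegrable f -> rintegrable g ->
  rintegrable (fun x => f x + g x).
Proof.
move=> intf intg; rewrite [X in _.-integrable _ X](_ : _ =
    fun x => (EFin \o f) x + (EFin \o g) x)%E//.
exact: integrableD.
Qed.

Lemma integrable_expR_norm : rintegrable (fun x : R => expR (- `|x|)).
Proof.
have h : rintegrable (fun x : R => exponential_pdf 1 x + exponential_pdf 1 (- x)).
  apply: rintegrableD; first exact: integrable_exponential_pdf.
  by apply: integrable_opp; exact: integrable_exponential_pdf.
apply: (le_rintegrable _ h).
  by apply: measurableT_comp => //; exact: measurableT_comp.
move=> x; rewrite ger0_norm ?expR_ge0//.
have [x0|x0] := leP 0 x.
  rewrite ger0_norm// exponential_pdfE// mul1r.
  by rewrite mulN1r lerDl exponential_pdf_ge0.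
rewrite ltr0_norm// opprK (@exponential_pdfE _ _ (- x)); last first.
  by rewrite oppr_ge0 ltW.
by rewrite mul1r mulrNN mul1r lerDr exponential_pdf_ge0.
Qed.

End domination.

(** * Shifting contours by a Cauchy-Riemann equation *)

Section contour_shift.
Context {R : realType}.
Notation mu := (@lebesgue_measure R).
Implicit Types f g G : R -> R.

(* [int v' = 0] by translation invariance: differentiate the constant function
   [s |-> int v (t + s) dt] at [s = 0]. *)
Lemma Rintegral_derive0 (v k G : R -> R) :
  (forall t : R, is_derive t 1 v (k t)) -> rintegrable v ->
  (forall t s, `|s| < 1 -> `|k (t + s)| <= G t) -> rintegrable G ->
  \int[mu]_t k t = 0.
Proof.
move=> dv iv kG iG.
have d (s t : R) : is_derive s 1 (fun s => v (t + s)) (k (t + s)).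
  have h : is_derive s 1 (fun s : R => t + s) 1.
    by apply: is_derive_eq; rewrite add0r mulr1.
  have := @is_derive1_comp R v (fun s => t + s) s _ _ (dv (t + s)) h.
  by rewrite mulr1.
have I0 : (`](-1), 1[%classic : set R) 0 by rewrite /= in_itv/= ltrN10 ltr01.
have iv' s : (`](-1), 1[%classic : set R) s -> rintegrable (fun t => v (t + s)).
  by move=> _; exact: integrable_shift.
have dv' s t : (`](-1), 1[%classic : set R) s -> setT t ->
  derivable (fun s => v (t + s)) s 1 by move=> _ _; have [] := d s t.
have G0 t : 0 <= G t.
  by apply: le_trans (normr_ge0 _) (kG t 0 _); rewrite normr0.
have ub s t : (`](-1), 1[%classic : set R) s -> setT t ->
    `|partial1of2 (fun s t => v (t + s)) s t| <= G t.
  rewrite /= in_itv/= => s1 _; rewrite partial1of2E.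
  by have /@derive_val -> := d s t; apply: kG; rewrite ltr_norml.
have := @differentiation_under_integral R _ _ mu (fun s t => v (t + s)) setT
  measurableT 0 (-1) 1 I0 iv' dv' G G0 iG ub.
have -> : (fun s => \int[mu]_t v (t + s)) = cst (\int[mu]_t v t).
  by apply/funext => s; rewrite Rintegral_shift.
rewrite derive1E derive_cst => ->.
apply: eq_Rintegral => t _; rewrite partial1of2E.
by have /@derive_val -> := d 0 t; rewrite addr0.
Qed.

(** With [u] and [v] the real part and minus the imaginary part of a holomorphic function at
    [t + i y], the common derivative [k] expresses a Cauchy-Riemann equation. The [y]-derivative of
    the integral of [u] is the integral of [k], a [t]-derivative, hence zero; the mean value theorem
    concludes. One majorant [G], uniform in [y] and under small translations of [t], justifies both
    differentiations under the integral. *)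
Lemma contour_shift (u v k : R -> R -> R) (G : R -> R) (y0 : R) :
  (forall y t : R, `|y| < y0 -> is_derive y 1 (u ^~ t) (k y t)) ->
  (forall y t : R, `|y| < y0 -> is_derive t 1 (v y) (k y t)) ->
  (forall y, `|y| < y0 -> rintegrable (u y)) ->
  (forall y, `|y| < y0 -> rintegrable (v y)) ->
  (forall y t s, `|y| < y0 -> `|s| < 1 -> `|k y (t + s)| <= G t) ->
  rintegrable G ->
  forall y, 0 <= y < y0 -> \int[mu]_t u y t = \int[mu]_t u 0 t.
Proof.
move=> du dv iu iv kG iG y /andP[y_ge0 yy0].
have G0 t : 0 <= G t.
  apply: le_trans (normr_ge0 _) (kG 0 t 0 _ _); rewrite normr0 ?ltr01//.
  exact: le_lt_trans yy0.
pose F y := \int[mu]_t u y t.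
have dF (x : R) : `|x| < y0 -> is_derive x 1 F 0.
  move=> xy0.
  have I0 : (`](- y0), y0[%classic : set R) x by rewrite /= in_itv/= -ltr_norml.
  have iu' z : (`](- y0), y0[%classic : set R) z -> rintegrable (u z).
    by rewrite /= in_itv/= -ltr_norml; exact: iu.
  have du' z t : (`](- y0), y0[%classic : set R) z -> setT t ->
      derivable (u ^~ t) z 1.
    by rewrite /= in_itv/= -ltr_norml => /(du z t) [].
  have ub z t : (`](- y0), y0[%classic : set R) z -> setT t ->
      `|partial1of2 u z t| <= G t.
    rewrite /= in_itv/= -ltr_norml => zy0 _; rewrite partial1of2E.
    have /@derive_val -> := du z t zy0.
    by have := kG z t 0 zy0; rewrite addr0 normr0; apply.
  apply: DeriveDef.
    exact: (@derivable_under_integral R _ _ mu u setT measurableT x _ _ I0 iu'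
      du' G G0 iG ub).
  rewrite -derive1E.
  rewrite (@differentiation_under_integral R _ _ mu u setT measurableT x _ _ I0
    iu' du' G G0 iG ub).
  rewrite -[RHS](@Rintegral_derive0 (v x) (k x) G (fun t => dv x t xy0)
    (iv x xy0) _ iG); last by move=> t s s1; exact: kG.
  apply: eq_Rintegral => t _; rewrite partial1of2E.
  by have /@derive_val -> := du x t xy0.
move: y_ge0; rewrite le_eqVlt => /predU1P[<-//|y_gt0].
have inI x : x \in `[0, y] -> `|x| < y0.
  rewrite in_itv/= => /andP[x0 xy]; rewrite ger0_norm//.
  exact: le_lt_trans xy yy0.
have cF : {within `[0, y], continuous F}.
  by apply: derivable_within_continuous => x xi; have [] := dF x (inI x xi).
have [x _] := @MVT _ F (fun=> 0) 0 y y_gt0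
  (fun x xi => dF x (inI x (subset_itv_oo_cc xi))) cF.
by rewrite mul0r => /eqP; rewrite subr_eq0 => /eqP.
Qed.

End contour_shift.

(** * Bounds on elementary and hyperbolic functions *)

Section elementary_bounds.
Context {R : realType}.
Implicit Types s t x y : R.

Lemma is_derive_div (f g : R -> R) (x df dg : R) : g x != 0 ->
  is_derive x 1 f df -> is_derive x 1 g dg ->
  is_derive x 1 (fun x => f x / g x) (df / g x - f x * dg / g x ^+ 2).
Proof.
move=> g0 hf hg.
have hV := @is_deriveV R g x dg 1 g0 hg.
have := @is_deriveM R R^o f (fun x => (g x)^-1) x 1 _ _ hf hV.
move=> /is_derive_eq; apply; rewrite /GRing.scale /=; field.
by [].
Qed.

(** Inversion is total, with value 0 at 0; splitting off this measurable singleton leaves an open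
    set on which it is continuous. *)
Lemma measurable_invr : measurable_fun setT (fun x : R => x^-1).
Proof.
have -> : [set: R] = [set 0] `|` [set x : R | x != 0].
  apply/seteqP; split => // x _.
  by have [->|x0] := eqVneq x 0; [left|right].
have o : open [set x : R | x != 0].
  rewrite (_ : mkset _ = [set x | x < 0] `|` [set x | x > 0]).
    by apply: openU; [exact: open_lt|exact: open_gt].
  apply/seteqP; split => x /=; first by rewrite neq_lt => /orP.
  by rewrite neq_lt => /orP.
apply/measurable_funU => //; first exact: open_measurable.
split; first exact: measurable_fun_set1.
apply: open_continuous_measurable_fun => // x /[!inE] /= x0.
exact: inv_continuous.
Qed.

Lemma measurable_funV d (T : measurableType d) (f : T -> R) :
  measurable_fun setT f -> measurable_fun setT (fun z => (f z)^-1).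
Proof. by move=> mf; apply: measurableT_comp mf; exact: measurable_invr. Qed.

Lemma expR_norm_shift t s : `|s| < 1 ->
  expR (- `|t + s|) <= expR 1 * expR (- `|t|).
Proof.
move=> s1; rewrite -expRD ler_expR.
have := ler_normD (t + s) (- s); rewrite addrK normrN; lra.
Qed.

Lemma norm_le_expR x : `|x| <= expR `|x|.
Proof. by apply: le_trans (expR_ge1Dx _); rewrite lerDr. Qed.

Lemma sin_le_norm x : `|sin x| <= `|x|.
Proof.
wlog x0 : x / 0 <= x.
  move=> h; have [/h//|/ltW x0] := leP 0 x.
  by rewrite -normrN -sinN -(normrN x); apply: h; rewrite oppr_ge0.
move: x0; rewrite le_eqVlt => /predU1P[<-|x0]; first by rewrite sin0.
have [c _] := @MVT R sin cos 0 x x0 (fun z _ => is_derive_sin z)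
  (continuous_subspaceT (@continuous_sin R)).
rewrite sin0 !subr0 => ->; rewrite normrM ler_piMl//.
exact: cos_max.
Qed.

End elementary_bounds.

Section hyperbolic.
Context {R : realType}.
Implicit Types x t : R.

Lemma coshRN t : coshR (- t) = coshR t.
Proof. by rewrite /coshR opprK addrC. Qed.

Lemma sinhRN t : sinhR (- t) = - sinhR t.
Proof. by rewrite /sinhR opprK -mulNr opprB. Qed.

Lemma coshR_sqr t : coshR t ^+ 2 = 1 + sinhR t ^+ 2.
Proof.
by have := @expRxMexpNx_1 R t; rewrite /coshR /sinhR; lra.
Qed.

Global Instance is_derive_sinhR t : is_derive t 1 (@sinhR R) (coshR t).
Proof.
by apply: is_derive_eq; rewrite /coshR /GRing.scale /=; field.
Qed.

Global Instance is_derive_coshR t : is_derive t 1 (@coshR R) (sinhR t).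
Proof.
by apply: is_derive_eq; rewrite /sinhR /GRing.scale /=; field.
Qed.

Lemma continuous_coshR : continuous (@coshR R).
Proof.
by move=> t; apply: differentiable_continuous; apply/derivable1_diffP;
  have [] := is_derive_coshR t.
Qed.

Lemma continuous_sinhR : continuous (@sinhR R).
Proof.
by move=> t; apply: differentiable_continuous; apply/derivable1_diffP;
  have [] := is_derive_sinhR t.
Qed.

Lemma coshR_ge_expR t : expR `|t| / 2 <= coshR t.
Proof.
rewrite /coshR ler_pM2r ?invr_gt0//.
have [t0|t0] := ger0P t; first by rewrite lerDl expR_ge0.
by rewrite lerDr expR_ge0.
Qed.

Lemma coshR_gt0 t : 0 < coshR t.
Proof. by apply: lt_le_trans (coshR_ge_expR t); rewrite divr_gt0// expR_gt0. Qed.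

Lemma coshR_ge1 t : 1 <= coshR t.
Proof.
rewrite -(@ler_pXn2r _ 2)// ?nnegrE// ?(ltW (coshR_gt0 _))//.
by rewrite coshR_sqr expr1n lerDl sqr_ge0.
Qed.

Lemma coshR_le_expR t : coshR t <= expR `|t|.
Proof.
rewrite /coshR ler_pdivrMr// mulr_natr mulr2n lerD// ler_expR ?ler_norm//.
by rewrite lerNl lerNnormlW.
Qed.

Lemma coshRV_le t : (coshR t)^-1 <= 2 * expR (- `|t|).
Proof.
rewrite expRN -(invrK 2) -invfM lef_pV2 ?posrE ?coshR_gt0//.
by rewrite mulrC coshR_ge_expR.
Qed.

Lemma sinhR_norm t : `|sinhR t| = sinhR `|t|.
Proof.
wlog t0 : t / 0 <= t.
  move=> h; have [/h//|/ltW t0] := leP 0 t.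
  by rewrite -normrN -sinhRN -(normrN t); apply: h; rewrite oppr_ge0.
rewrite (ger0_norm t0) ger0_norm// /sinhR divr_ge0// subr_ge0 ler_expR.
by rewrite (le_trans _ t0)// oppr_le0.
Qed.

Lemma norm_le_sinhR t : `|t| <= `|sinhR t|.
Proof.
suff h (x : R) : 0 <= x -> x <= sinhR x by rewrite sinhR_norm h.
rewrite le_eqVlt => /predU1P[<-|x0]; first by rewrite /sinhR oppr0 subrr mul0r.
have [c _] := @MVT R sinhR coshR 0 x x0 (fun z _ => is_derive_sinhR z)
  (continuous_subspaceT continuous_sinhR).
rewrite [sinhR 0]/sinhR oppr0 subrr mul0r oppr0 !addr0 => ->.
by rewrite ler_peMl ?coshR_ge1// ltW.
Qed.

(** For [|t| >= 1] one has [e^{|t|} >= 2], so [e^{-|t|}] is at most half of [e^{|t|}] and a quarter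
    of [e^{|t|}] survives in [sinh]. *)
Lemma sinhRV_le t : 1 <= `|t| -> `|sinhR t|^-1 <= 4 * expR (- `|t|).
Proof.
move=> t1; rewrite expRN -(invrK 4) -invfM.
have h : (4^-1 * expR `|t|) <= `|sinhR t|.
  rewrite sinhR_norm /sinhR.
  have h1 : expR (- `|t|) <= expR `|t| / 2.
    rewrite expRN -[X in X <= _]mul1r ler_pdivrMr ?expR_gt0//.
    rewrite mulrAC ler_pdivlMr// mul1r -expr2.
    have e2 : 2 <= expR `|t|.
      by apply: le_trans (expR_ge1Dx _); rewrite -[2](natrD _ 1 1) lerD.
    by rewrite expr2 (le_trans e2)// ler_peMl ?expR_ge0// (le_trans _ e2)// ler1n.
  lra.
rewrite lef_pV2// posrE; last first.
  by rewrite mulr_gt0 ?invr_gt0 ?expR_gt0.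
by apply: lt_le_trans h; rewrite mulr_gt0 ?invr_gt0 ?expR_gt0.
Qed.

(** Near zero, [|sin (nu t)| <= |nu| |t| <= |nu| |sinh t|], and the factor [expR 1] compensates for
    [e^{-|t|}]; for [|t| >= 1] the decay of [1 / sinh] takes over. At [t = 0] the quotient is 0 by
    the convention on division. *)
Lemma sin_div_sinhR_le (nu t : R) :
  `|sin (nu * t) / sinhR t| <= (`|nu| * expR 1 + 4) * expR (- `|t|).
Proof.
have e0 := expR_ge0 (- `|t|).
have n0 : 0 <= `|nu| * expR 1 * expR (- `|t|) by rewrite !mulr_ge0 ?expR_ge0.
rewrite mulrDl; have [t1|t1] := leP 1 `|t|.
  rewrite normrM normfV; apply: (@le_trans _ _ (1 * (4 * expR (- `|t|)))).
    by apply: ler_pM => //; [exact: sin_max|exact: sinhRV_le].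
  by rewrite mul1r lerDr.
apply: (@le_trans _ _ (`|nu| * expR 1 * expR (- `|t|))); last first.
  by rewrite lerDl mulr_ge0.
rewrite -mulrA -expRD.
have [->|t0] := eqVneq t 0.
  by rewrite mulr0 sin0 mul0r normr0 mulr_ge0 ?expR_ge0.
have s0 : 0 < `|sinhR t| by rewrite (lt_le_trans _ (norm_le_sinhR t))// normr_gt0.
apply: (@le_trans _ _ `|nu|).
  rewrite normrM normfV ler_pdivrMr// (le_trans (sin_le_norm _))// normrM.
  by rewrite ler_wpM2l// norm_le_sinhR.
rewrite ler_peMr// -[X in X <= _]expR0 ler_expR; lra.
Qed.

End hyperbolic.

(** * Fourier transform of the Gaussian *)

Section gaussian_fourier.
Context {R : realType}.
Notation mu := (@lebesgue_measure R).

(** [gu] and [gv] are the real part and minus the imaginary part of [e^{- z^2 / 2}] at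
    [z = t + i y]; [gk] is their common derivative. *)
Let gu (y t : R) := expR ((y ^+ 2 - t ^+ 2) / 2) * cos (t * y).
Let gv (y t : R) := expR ((y ^+ 2 - t ^+ 2) / 2) * sin (t * y).
Let gk (y t : R) :=
  expR ((y ^+ 2 - t ^+ 2) / 2) * (y * cos (t * y) - t * sin (t * y)).

Let dgu (y t : R) : is_derive y 1 (gu ^~ t) (gk y t).
Proof. by apply: is_derive_eq; rewrite /GRing.scale /= /gk; field. Qed.

Let dgv (y t : R) : is_derive t 1 (gv y) (gk y t).
Proof. by apply: is_derive_eq; rewrite /GRing.scale /= /gk; field. Qed.

Let dgu' (y t : R) : derivable (gu y) t 1.
Proof. by rewrite /gu; apply: ex_derive. Qed.

(** The rate 2 leaves one factor [e^{-|t|}] after the linear growth of [gk] in [t] has been absorbed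
    by the other. *)
Let expR_gauss_le (M y t : R) : `|y| < M ->
  expR ((y ^+ 2 - t ^+ 2) / 2) <= expR (M ^+ 2 / 2 + 2) * expR (- (2 * `|t|)).
Proof.
move=> yM; rewrite -expRD ler_expR.
have : y ^+ 2 <= M ^+ 2.
  by rewrite -(real_normK (num_real y)) ler_pXn2r ?nnegrE ?(ltW yM)//
    (le_trans _ (ltW yM)).
have := sqr_ge0 (`|t| - 2); rewrite sqrrB real_normK ?num_real//; lra.
Qed.

Lemma integral_gauss_cos (w : R) :
  \int[mu]_t (expR (- t ^+ 2 / 2) * cos (w * t)) =
  expR (- w ^+ 2 / 2) * \int[mu]_t expR (- t ^+ 2 / 2).
Proof.
wlog w0 : w / 0 <= w.
  move=> h; have [/h//|/ltW w0] := leP 0 w.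
  rewrite -sqrrN -h ?oppr_ge0//.
  by apply: eq_Rintegral => t _; rewrite (mulNr w) cosN.
(* The extra 1 puts the height [w] strictly inside the strip [|y| < M]. *)
pose M := w + 1; pose K := expR (M ^+ 2 / 2 + 2).
have M0 : 0 <= M by rewrite /M addr_ge0.
have K0 : 0 <= K := expR_ge0 _.
have iE : rintegrable (fun t : R => K * expR (- `|t|)).
  exact/rintegrableZl/integrable_expR_norm.
have bnd (a b : R) : `|b| <= 1 -> `|expR a * b| <= expR a.
  by move=> b1; rewrite normrM (ger0_norm (expR_ge0 _)) ler_piMr// expR_ge0.
have iu y : `|y| < M -> rintegrable (gu y).
  move=> yM; apply: (le_rintegrable _ iE).
    apply: continuous_measurable_fun => t.
    exact/differentiable_continuous/derivable1_diffP/dgu'.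
  move=> t; apply: (le_trans (bnd _ _ (cos_max _))).
  apply: (le_trans (expR_gauss_le _ yM)).
  by rewrite ler_wpM2l// ler_expR lerN2 ler_peMl// ler1n.
have iv y : `|y| < M -> rintegrable (gv y).
  move=> yM; apply: (le_rintegrable _ iE).
    apply: continuous_measurable_fun => t.
    by apply/differentiable_continuous/derivable1_diffP; have [] := dgv y t.
  move=> t; apply: (le_trans (bnd _ _ (sin_max _))).
  apply: (le_trans (expR_gauss_le _ yM)).
  by rewrite ler_wpM2l// ler_expR lerN2 ler_peMl// ler1n.
pose G (t : R) := K * (M + 1) * expR 1 * expR (- `|t|).
have iG : rintegrable G by exact/rintegrableZl/integrable_expR_norm.
have kG (y t s : R) : `|y| < M -> `|s| < 1 -> `|gk y (t + s)| <= G t.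
  move=> yM s1; rewrite /gk normrM (ger0_norm (expR_ge0 _)).
  apply: (@le_trans _ _ (K * expR (- (2 * `|t + s|)) *
    ((M + 1) * expR `|t + s|))).
    apply: ler_pM => //; [exact: expR_gauss_le|].
    apply: (le_trans (ler_normB _ _)); rewrite !normrM (mulrDl M) mul1r lerD//.
      apply: ler_pM => //; first exact: ltW.
      by apply: (le_trans (cos_max _)); rewrite -expR0 ler_expR.
    rewrite -[X in _ <= X]mulr1; apply: ler_pM => //.
      exact: norm_le_expR.
    exact: sin_max.
  rewrite mulrACA -expRD (_ : - (2 * _) + _ = - `|t + s|); last by ring.
  rewrite /G -(mulrA _ (expR 1)) ler_wpM2l ?expR_norm_shift//.
  by rewrite mulr_ge0// addr_ge0.
have := @contour_shift R gu gv gk G M (fun y t _ => dgu y t)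
  (fun y t _ => dgv y t) iu iv kG iG w.
rewrite w0 ltrDl ltr01 => /(_ isT) E.
have : \int[mu]_t expR (- t ^+ 2 / 2) = \int[mu]_t gu w t.
  rewrite E; apply: eq_Rintegral => t _.
  by rewrite /gu mulr0 cos0 mulr1 expr0n/= sub0r.
move=> ->; rewrite -RintegralZl//; last first.
  by apply: iu; rewrite ger0_norm// ltrDl.
apply: eq_Rintegral => t _; rewrite /gu mulrA -expRD (mulrC w).
by congr (expR _ * _); field.
Qed.

(* [normal_peak s * expR (- t^2 / (2 s^2))] is the library's [normal_pdf 0 s]. *)
Lemma integrable_normal_cos (s w : R) : 0 < s ->
  rintegrable (fun t => normal_pdf 0 s t * cos (w * t)).
Proof.
move=> s0; apply: (le_rintegrable _ (integrable_normal_pdf 0 s)).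
  apply: measurable_funM; first exact: measurable_normal_pdf.
  apply: measurableT_comp; last exact: measurable_funM.
  exact: continuous_measurable_fun (@continuous_cos R).
move=> t; rewrite normrM ger0_norm ?normal_pdf_ge0//.
by rewrite ler_piMr ?normal_pdf_ge0// cos_max.
Qed.

Lemma integral_normal_cos (s w : R) : 0 < s ->
  \int[mu]_t (normal_pdf 0 s t * cos (w * t)) = expR (- (s * w) ^+ 2 / 2).
Proof.
move=> s0; have sn0 : s != 0 by rewrite gt_eqF.
have I0 : \int[mu]_t normal_pdf 0 s t = 1.
  by rewrite /Rintegral integral_normal_pdf.
pose h (t : R) := normal_pdf 0 1 t * cos (s * w * t).
have ih : rintegrable h by exact: integrable_normal_cos.
have n1 (t : R) : normal_pdf 0 1 t = normal_peak 1 * expR (- t ^+ 2 / 2).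
  by rewrite normal_pdfE ?oner_neq0// /normal_fun subr0 expr1n.
have ins : rintegrable (fun t => normal_pdf 0 s t * cos (w * t)).
  exact: integrable_normal_cos.
have peak : s * normal_peak s = normal_peak 1.
  rewrite /normal_peak expr1n mul1r -mulrnAr sqrtrM ?sqr_ge0//.
  by rewrite sqrtr_sqr gtr0_norm// invfM mulrA mulfV// mul1r.
have -> : \int[mu]_t (normal_pdf 0 s t * cos (w * t)) = \int[mu]_t h t.
  have := Rintegral_affine 0 sn0 ins; rewrite gtr0_norm// => E.
  rewrite -[LHS](mulVKf sn0) -E -RintegralZl//; last first.
    exact: (integrable_affine 0 sn0 ins).
  apply: eq_Rintegral => t _; rewrite addr0 /h n1 normal_pdfE//.
  have -> : normal_fun 0 s (s * t) = expR (- t ^+ 2 / 2).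
    by rewrite /normal_fun subr0; congr expR; field.
  have -> : w * (s * t) = s * w * t by ring.
  by rewrite -peak; ring.
have i1 : rintegrable (fun t : R => expR (- t ^+ 2 / 2) * cos (s * w * t)).
  have p0 : normal_peak 1 != 0 :> R by rewrite gt_eqF// normal_peak_gt0// oner_neq0.
  rewrite (_ : (fun t => _) = (fun t => (normal_peak 1)^-1 * h t)).
    exact: rintegrableZl.
  by apply/funext => t; rewrite /h n1 !mulrA mulVf// mul1r.
have i0 : rintegrable (fun t : R => expR (- t ^+ 2 / 2)).
  have p0 : normal_peak 1 != 0 :> R by rewrite gt_eqF// normal_peak_gt0// oner_neq0.
  rewrite (_ : (fun t => _) = (fun t => (normal_peak 1)^-1 * normal_pdf 0 1 t)).
    exact/rintegrableZl/integrable_normal_pdf.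
  by apply/funext => t; rewrite n1 !mulrA mulVf// mul1r.
transitivity (normal_peak 1 *
    \int[mu]_t (expR (- t ^+ 2 / 2) * cos (s * w * t))).
  by rewrite -RintegralZl//; apply: eq_Rintegral => t _; rewrite /h n1 mulrA.
rewrite integral_gauss_cos mulrCA -RintegralZl//.
rewrite (_ : \int[mu]_t _ = 1) ?mulr1//.
transitivity (\int[mu]_t normal_pdf 0 1 t).
  by apply: eq_Rintegral => t _; rewrite n1.
by rewrite /Rintegral integral_normal_pdf.
Qed.

End gaussian_fourier.

(** * Fourier transforms of the hyperbolic secant and cosecant *)

Section hyperbolic_fourier.
Context {R : realType}.
Notation mu := (@lebesgue_measure R).

Section fixed_frequency.
Variable nu : R.

(* [hu y t] and [hv y t] are [Re F] and [- Im F] at [z = t + i y] for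
   [F z = e^{i nu z} / cosh z]; [hD] is [|cosh z|^2]. *)
Let hX (y t : R) :=
  cos (nu * t) * coshR t * cos y + sin (nu * t) * sinhR t * sin y.
Let hY (y t : R) :=
  sin (nu * t) * coshR t * cos y - cos (nu * t) * sinhR t * sin y.
Let hXy (y t : R) :=
  sin (nu * t) * sinhR t * cos y - cos (nu * t) * coshR t * sin y.
Let hD (y t : R) := sinhR t ^+ 2 + cos y ^+ 2.
Let hu (y t : R) := expR (- (nu * y)) * (hX y t / hD y t).
Let hv (y t : R) := - expR (- (nu * y)) * (hY y t / hD y t).
Let hk (y t : R) := expR (- (nu * y)) *
  ((hXy y t - nu * hX y t) / hD y t
   + hX y t * (2 * cos y * sin y) / hD y t ^+ 2).

Let hD_gt0 (y t : R) : `|y| < pi / 2 -> 0 < hD y t.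
Proof.
move=> yp; rewrite /hD ltr_wpDl// ?sqr_ge0// exprn_gt0//.
by apply: cos_gt0_pihalf; rewrite -ltr_norml.
Qed.

Let dhu (y t : R) : `|y| < pi / 2 -> is_derive y 1 (hu ^~ t) (hk y t).
Proof.
move=> yp; have D0 : hD y t != 0 by rewrite gt_eqF// hD_gt0.
have dX : is_derive y 1 (hX ^~ t) (hXy y t).
  by apply: is_derive_eq; rewrite /GRing.scale /= /hXy; ring.
have dD : is_derive y 1 (hD ^~ t) (- (2 * cos y * sin y)).
  by apply: is_derive_eq; rewrite /GRing.scale /=; ring.
have dQ := @is_derive_div _ (hX ^~ t) (hD ^~ t) y _ _ D0 dX dD.
have dE : is_derive y 1 (fun y => expR (- (nu * y))) (- nu * expR (- (nu * y))).
  by apply: is_derive_eq; rewrite /GRing.scale /=; ring.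
have := @is_deriveM R R^o _ _ y 1 _ _ dE dQ.
by move/is_derive_eq; apply; rewrite /GRing.scale /= /hk; ring.
Qed.

Let dhv (y t : R) : `|y| < pi / 2 -> is_derive t 1 (hv y) (hk y t).
Proof.
move=> yp; have D0 : hD y t != 0 by rewrite gt_eqF// hD_gt0.
have dY : is_derive t 1 (hY y) (nu * hX y t + hXy y t).
  by apply: is_derive_eq; rewrite /GRing.scale /= /hX /hXy; ring.
have dD : is_derive t 1 (hD y) (2 * sinhR t * coshR t).
  by apply: is_derive_eq; rewrite /GRing.scale /=; ring.
have dQ := is_derive_div D0 dY dD.
have := @is_deriveM R R^o (cst (- expR (- (nu * y)))) _ t 1 _ _
  (is_derive_cst _ _ _) dQ.
move/is_derive_eq; apply; rewrite /GRing.scale /= /cst mulr0 addr0 /hk.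
rewrite mulNr -mulrN; congr (_ * _).
suff -> : hY y t * (2 * sinhR t * coshR t) =
    2 * hXy y t * hD y t + hX y t * (2 * cos y * sin y).
  by field.
have h : sin y ^+ 2 = 1 - cos y ^+ 2 by rewrite sin2cos2.
have -> : hY y t * (2 * sinhR t * coshR t) =
  2 * sin (nu * t) * cos y * sinhR t * coshR t ^+ 2
  - 2 * cos (nu * t) * coshR t * sin y * sinhR t ^+ 2 by rewrite /hY; ring.
have -> : hX y t * (2 * cos y * sin y) =
  2 * cos (nu * t) * coshR t * cos y ^+ 2 * sin y
  + 2 * sin (nu * t) * sinhR t * cos y * sin y ^+ 2 by rewrite /hX; ring.
by rewrite coshR_sqr h /hXy /hD; ring.
Qed.

Let cont_hX y : continuous (hX y).
Proof.
move=> t; apply/differentiable_continuous/derivable1_diffP.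
by rewrite /hX; apply: ex_derive.
Qed.

Let cont_hY y : continuous (hY y).
Proof.
move=> t; apply/differentiable_continuous/derivable1_diffP.
by rewrite /hY; apply: ex_derive.
Qed.

Let cont_hD y : continuous (hD y).
Proof.
move=> t; apply/differentiable_continuous/derivable1_diffP.
by rewrite /hD; apply: ex_derive.
Qed.

Let mhu y : measurable_fun setT (hu y).
Proof.
apply: measurable_funM => //; apply: measurable_funM.
  exact: continuous_measurable_fun (@cont_hX y).
by apply: measurable_funV; exact: continuous_measurable_fun (@cont_hD y).
Qed.

Let mhv y : measurable_fun setT (hv y).
Proof.
apply: measurable_funM => //; apply: measurable_funM.
  exact: continuous_measurable_fun (@cont_hY y).
by apply: measurable_funV; exact: continuous_measurable_fun (@cont_hD y).
Qed.

Let trig_prod_le (a b c t : R) : `|a| <= 1 -> `|b| <= coshR t -> `|c| <= 1 ->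
  `|a * b * c| <= coshR t.
Proof.
move=> a1 bt c1; rewrite !normrM -[X in _ <= X]mulr1; apply: ler_pM => //.
by rewrite -[X in _ <= X]mul1r; apply: ler_pM.
Qed.

Let sinh_le (t : R) : `|sinhR t| <= coshR t.
Proof.
rewrite -(@ler_pXn2r _ 2)// ?nnegrE// ?(ltW (coshR_gt0 _))//.
by rewrite real_normK ?num_real// coshR_sqr lerDr.
Qed.

Let cosh_le (t : R) : `|coshR t| <= coshR t.
Proof. by rewrite gtr0_norm ?coshR_gt0. Qed.

Let hX_le y t : `|hX y t| <= 2 * coshR t.
Proof.
apply: (le_trans (ler_normD _ _)); rewrite mulr_natl mulr2n.
by apply: lerD; apply: trig_prod_le => //; rewrite ?cos_max ?sin_max.
Qed.

Let hY_le y t : `|hY y t| <= 2 * coshR t.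
Proof.
apply: (le_trans (ler_normB _ _)); rewrite mulr_natl mulr2n.
by apply: lerD; apply: trig_prod_le => //; rewrite ?cos_max ?sin_max.
Qed.

Let hXy_le y t : `|hXy y t| <= 2 * coshR t.
Proof.
apply: (le_trans (ler_normB _ _)); rewrite mulr_natl mulr2n.
by apply: lerD; apply: trig_prod_le => //; rewrite ?cos_max ?sin_max.
Qed.

Section strip.
Variable y0 : R.
Hypothesis y0_ge0 : 0 <= y0.
Hypothesis y0p : y0 < pi / 2.
Let c0 := cos y0 ^+ 2.
Let E := expR (`|nu| * y0).

Let c0_gt0 : 0 < c0.
Proof.
rewrite exprn_gt0//; apply: cos_gt0_pihalf; rewrite y0p andbT.
by rewrite (lt_le_trans _ y0_ge0)// oppr_lt0 divr_gt0// pi_gt0.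
Qed.

Let hD_ge (y t : R) : `|y| < y0 -> c0 * coshR t ^+ 2 <= hD y t.
Proof.
move=> yy0.
have c : cos y0 <= cos y.
  rewrite -(cos_norm y) ltW// ltr_cos ?in_itv/= ?normr_ge0 ?y0_ge0//=.
    by rewrite (le_trans (ltW yy0))// (le_trans (ltW y0p))// ler_pdivrMr//
      ler_peMr ?pi_ge0// ler1n.
  by rewrite (le_trans (ltW y0p))// ler_pdivrMr// ler_peMr ?pi_ge0// ler1n.
have c1 : c0 <= cos y ^+ 2.
  have p : 0 <= cos y0.
    apply: cos_ge0_pihalf; rewrite (ltW y0p) andbT.
    by rewrite (le_trans _ y0_ge0)// oppr_le0 divr_ge0// pi_ge0.
  by rewrite ler_pXn2r// nnegrE// (le_trans p).
have c2 : c0 <= 1 by apply: (le_trans c1); rewrite -(cos2Dsin2 y) lerDl sqr_ge0.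
by rewrite coshR_sqr /hD mulrDr mulr1 addrC lerD// ler_piMl// sqr_ge0.
Qed.

Let expR_le (y : R) : `|y| < y0 -> expR (- (nu * y)) <= E.
Proof.
move=> yy0; rewrite ler_expR (le_trans (ler_norm _))// normrN normrM.
by rewrite ler_wpM2l// ltW.
Qed.

Let hDV_le (y t : R) : `|y| < y0 -> (hD y t)^-1 <= c0^-1 * coshR t ^- 2.
Proof.
move=> yy0; rewrite -invfM lef_pV2 ?posrE ?hD_ge//.
  by apply: hD_gt0; exact: lt_trans y0p.
by rewrite mulr_gt0// exprn_gt0// coshR_gt0.
Qed.

Let ratio_le (y t X : R) : `|y| < y0 -> `|X| <= 2 * coshR t ->
  `|X / hD y t| <= 4 / c0 * expR (- `|t|).
Proof.
move=> yy0 Xt; rewrite normrM normfV (gtr0_norm (hD_gt0 _ _)); last first.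
  exact: lt_trans y0p.
have D0 : 0 <= (hD y t)^-1 by rewrite invr_ge0 ltW// hD_gt0// (lt_trans _ y0p).
apply: (@le_trans _ _ (2 * coshR t * (c0^-1 * coshR t ^- 2))).
  by apply: ler_pM => //; exact: hDV_le.
have -> : 2 * coshR t * (c0^-1 * coshR t ^- 2) = 2 / c0 * (coshR t)^-1.
  by field; rewrite !gt_eqF ?coshR_gt0.
have -> : 4 / c0 * expR (- `|t|) = 2 / c0 * (2 * expR (- `|t|)) by field;
  rewrite gt_eqF.
by rewrite ler_wpM2l ?coshRV_le// divr_ge0// ltW.
Qed.

(** For [|y| < y0 < pi / 2] one has [|cosh z|^2 >= cos y0 ^ 2 * cosh t ^ 2], so the function and its
    derivative decay like [e^{-|t|}] uniformly in the strip and the contour can be moved. The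
    constant degenerates as [y0] approaches the pole at [pi / 2]. *)
Lemma integral_strip (y : R) : 0 <= y < y0 ->
  rintegrable (hu y) /\
  \int[mu]_t hu y t = \int[mu]_t (cos (nu * t) / coshR t).
Proof.
move=> y0y.
have E0 : 0 <= E := expR_ge0 _.
have p (y' : R) : `|y'| < y0 -> `|y'| < pi / 2 by move=> h; exact: lt_trans y0p.
have iE k : rintegrable (fun t : R => k * expR (- `|t|)).
  exact/rintegrableZl/integrable_expR_norm.
have iu y' : `|y'| < y0 -> rintegrable (hu y').
  move=> yy0; apply: (le_rintegrable _ (iE (E * (4 / c0)))) => // t.
  rewrite normrM (ger0_norm (expR_ge0 _)) -(mulrA E); apply: ler_pM => //.
    exact: expR_le.
  exact: ratio_le.
have iv y' : `|y'| < y0 -> rintegrable (hv y').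
  move=> yy0; apply: (le_rintegrable _ (iE (E * (4 / c0)))) => // t.
  rewrite normrM normrN (ger0_norm (expR_ge0 _)) -(mulrA E); apply: ler_pM => //.
    exact: expR_le.
  exact: ratio_le.
pose K := E * ((1 + `|nu|) * (4 / c0) + 2 * c0^-1 * (4 / c0)).
have K0 : 0 <= K.
  have c00 : 0 <= c0^-1 by rewrite invr_ge0 ltW.
  by rewrite mulr_ge0// addr_ge0// !mulr_ge0// addr_ge0.
have kK y' t : `|y'| < y0 -> `|hk y' t| <= K * expR (- `|t|).
  move=> yy0; rewrite normrM (ger0_norm (expR_ge0 _)) -(mulrA E).
  apply: ler_pM => //; first exact: expR_le.
  apply: (le_trans (ler_normD _ _)); rewrite (mulrDl _ _ (expR _)); apply: lerD.
    rewrite (_ : (hXy _ _ - _) / _ = hXy y' t / hD y' t - nu * (hX y' t / hD y' t)).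
      rewrite -(mulrA (1 + `|nu|)) (mulrDl 1 `|nu|) mul1r.
      apply: (le_trans (ler_normB _ _)).
      apply: lerD; first exact: ratio_le.
      by rewrite normrM ler_wpM2l// ratio_le.
    by ring.
  rewrite (_ : hX y' t * _ / _ =
    (2 * cos y' * sin y') * (hD y' t)^-1 * (hX y' t / hD y' t)); last first.
    by rewrite expr2 invfM; ring.
  rewrite normrM -(mulrA _ _ (expR _)); apply: ler_pM => //; last exact: ratio_le.
  have D0 := hD_gt0 t (p _ yy0).
  rewrite normrM normfV (gtr0_norm D0); apply: ler_pM => //.
  - by rewrite invr_ge0 ltW.
  - rewrite !normrM -[X in _ <= X]mulr1; apply: ler_pM => //; last exact: sin_max.
    rewrite (ger0_norm (ler0n _ _)) ler_piMr//; exact: cos_max.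
  - apply: (le_trans (hDV_le t yy0)); rewrite ler_piMr ?invr_ge0 ?(ltW c0_gt0)//.
    by rewrite invf_le1 ?exprn_gt0 ?coshR_gt0// exprn_ege1// coshR_ge1.
pose G (t : R) := K * expR 1 * expR (- `|t|).
have kG (y' t s : R) : `|y'| < y0 -> `|s| < 1 -> `|hk y' (t + s)| <= G t.
  move=> yy0 s1; apply: (le_trans (kK _ _ yy0)).
  by rewrite /G -mulrA ler_wpM2l// expR_norm_shift.
split.
  by apply: iu; case/andP: y0y => ? ?; rewrite ger0_norm.
have := @contour_shift R hu hv hk G y0 (fun y t h => dhu t (p y h))
  (fun y t h => dhv t (p y h)) iu iv kG (iE _) y y0y.
move=> ->; apply: eq_Rintegral => t _.
rewrite /hu /hX /hD mulr0 oppr0 expR0 mul1r cos0 sin0 mulr1 mulr0 addr0.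
rewrite expr1n addrC -coshR_sqr; field.
by rewrite gt_eqF// coshR_gt0.
Qed.

End strip.

Lemma integral_strip_pihalf (y : R) : 0 <= y < pi / 2 ->
  rintegrable (hu y) /\
  \int[mu]_t hu y t = \int[mu]_t (cos (nu * t) / coshR t).
Proof.
move=> /andP[y0 yp].
apply: (@integral_strip ((y + pi / 2) / 2)); first by lra.
  by lra.
by rewrite y0/=; lra.
Qed.

End fixed_frequency.

Lemma measurable_coshRV : measurable_fun setT (fun t : R => (coshR t)^-1).
Proof.
by apply: measurable_funV; exact: continuous_measurable_fun continuous_coshR.
Qed.

Lemma integrable_coshRV : rintegrable (fun t : R => (coshR t)^-1).
Proof.
apply: (le_rintegrable measurable_coshRV
  (rintegrableZl 2 integrable_expR_norm)) => t.
by rewrite ger0_norm ?coshRV_le// invr_ge0 ltW// coshR_gt0.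
Qed.

(** The antiderivative is [atan (sinh t)], with limit [pi / 2] at infinity; evenness reduces the
    integral to the half line. *)
Lemma integral_coshRV : \int[mu]_t (coshR t)^-1 = pi :> R.
Proof.
have c : continuous (fun t : R => (coshR t)^-1).
  by move=> t; apply: cvgV; [rewrite gt_eqF ?coshR_gt0|exact: continuous_coshR].
have c0 (t : R) : 0 <= (coshR t)^-1 by rewrite invr_ge0 ltW// coshR_gt0.
have d (t : R) : is_derive t 1 (@atan R \o sinhR) (coshR t)^-1.
  have := @is_derive1_comp R atan sinhR t _ _ (is_derive1_atan _)
    (is_derive_sinhR t).
  by move/is_derive_eq; apply; rewrite -coshR_sqr; field; rewrite gt_eqF ?coshR_gt0.
rewrite /Rintegral ge0_symfun_integralT//; last first.
  by move=> t /=; rewrite coshRN.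
rewrite -set_itvcy.
rewrite (@ge0_continuous_FTC2y R _ (@atan R \o sinhR) 0 (pi / 2))//=.
- by rewrite /sinhR oppr0 subrr mul0r atan0 oppr0 addr0; field.
- exact: continuous_subspaceT.
- apply: (cvg_comp _ _ _ (@cvgy_atan R)).
  apply/cvgryPge => A; near=> x.
  have x0 : 0 <= x by near: x; apply: nbhs_pinfty_ge; exact: num_real.
  have xA : A <= x by near: x; apply: nbhs_pinfty_ge; exact: num_real.
  apply: (le_trans xA); have := norm_le_sinhR x.
  by rewrite (ger0_norm x0) sinhR_norm (ger0_norm x0).
- apply: cvg_at_right_filter; apply: differentiable_continuous.
  by apply/derivable1_diffP; have [] := d 0.
- by move=> x _; rewrite derive1E; have /@derive_val -> := d x.
Unshelve. all: by end_near. Qed.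

Section limit.
Variable nu : R.
Let q (t : R) := sin (nu * t) / sinhR t.
(** The strip integrand at frequency 0. It has mass [pi] for every [y] and concentrates at [t = 0]
    as [y] tends to [pi / 2]; this is how the contribution of the pole enters. *)
Let A (y t : R) := cos y * coshR t / (sinhR t ^+ 2 + cos y ^+ 2).
Let C1 := `|nu / 2| * expR 1 + 4.
Let C2 := `|nu| * expR 1 + 4.

Lemma measurable_sin_div_sinhR :
  measurable_fun setT (fun t => sin (nu * t) / sinhR t).
Proof.
apply: measurable_funM.
  apply: measurableT_comp; last exact: measurable_funM.
  exact: continuous_measurable_fun (@continuous_sin R).
by apply: measurable_funV; exact: continuous_measurable_fun continuous_sinhR.
Qed.

Lemma integrable_sin_div_sinhR : rintegrable (fun t => sin (nu * t) / sinhR t).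
Proof.
apply: (le_rintegrable measurable_sin_div_sinhR
  (rintegrableZl C2 integrable_expR_norm)) => t.
exact: sin_div_sinhR_le.
Qed.

Let A_int (y : R) : 0 <= y < pi / 2 ->
  rintegrable (A y) /\ \int[mu]_t A y t = pi.
Proof.
move=> yp; have [i e] := @integral_strip_pihalf 0 y yp.
have AE : (fun t => expR (- (0 * y)) *
  ((cos (0 * t) * coshR t * cos y + sin (0 * t) * sinhR t * sin y) /
   (sinhR t ^+ 2 + cos y ^+ 2))) = A y.
  apply/funext => t; rewrite !mul0r oppr0 expR0 cos0 sin0 !mul0r !mul1r addr0.
  by rewrite /A (mulrC (coshR t)).
move: i e; rewrite AE => i ->; split => //.
rewrite -integral_coshRV; apply: eq_Rintegral => t _.
by rewrite mul0r cos0 mul1r.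
Qed.

(** Writing [cos (nu t) = 1 - 2 sin (nu t / 2) ^ 2] splits off [A y t]. The square of the sine
    vanishes to second order where [A y] peaks, and in the sine term the replacement of the
    denominator by [sinh t ^ 2] costs [cos y ^ 2 / hD]. Each error carries a factor [cos y] and a
    majorant whose integral is bounded in [y]. *)
Let pointwise (y t : R) : 0 <= y < pi / 2 ->
  `|expR (nu * y) * (expR (- (nu * y)) *
  ((cos (nu * t) * coshR t * cos y + sin (nu * t) * sinhR t * sin y) /
   (sinhR t ^+ 2 + cos y ^+ 2))) - A y t - sin y * q t|
  <= cos y * (2 * C1 ^+ 2 * expR (- `|t|) + C2 * A y t).
Proof.
move=> /andP[y0 yp].
have cy : 0 < cos y.
  by apply: cos_gt0_pihalf; rewrite yp (lt_le_trans _ y0)// oppr_lt0 divr_gt0// pi_gt0.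
have D0 : 0 < sinhR t ^+ 2 + cos y ^+ 2 by rewrite ltr_wpDl ?sqr_ge0// exprn_gt0.
have Dn : sinhR t ^+ 2 + cos y ^+ 2 != 0 by rewrite gt_eqF.
have A0 : 0 <= A y t.
  by rewrite /A divr_ge0 ?(ltW D0)// mulr_ge0 ?(ltW cy)// ltW// coshR_gt0.
have C10 : 0 <= C1 by rewrite addr_ge0// mulr_ge0// expR_ge0.
have C20 : 0 <= C2 by rewrite addr_ge0// mulr_ge0// expR_ge0.
rewrite mulrA -expRD subrr expR0 mul1r.
have [->|t0] := eqVneq t 0.
  rewrite /q /A !mulr0 cos0 sin0 mul1r !mul0r addr0 mulr0 subr0.
  rewrite (mulrC (coshR _)) subrr normr0 mulr_ge0 ?(ltW cy)// addr_ge0//.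
    by rewrite !mulr_ge0// expR_ge0.
  rewrite mulr_ge0// divr_ge0//; last by rewrite addr_ge0 ?sqr_ge0.
  by rewrite mulr_ge0 ?(ltW cy)// ltW// coshR_gt0.
have s0 : sinhR t != 0.
  by rewrite -normr_gt0 (lt_le_trans _ (norm_le_sinhR t))// normr_gt0.
have c2 : cos (nu * t) = 1 - 2 * sin (nu / 2 * t) ^+ 2.
  have -> : nu * t = (nu / 2 * t) *+ 2 by rewrite mulr2n; field.
  by rewrite cos_mulr2n cos2sin2 -mulr_natl; ring.
rewrite (_ : _ - A y t - _ = - (2 * sin (nu / 2 * t) ^+ 2 * A y t)
  - sin y * (q t * (cos y ^+ 2 / (sinhR t ^+ 2 + cos y ^+ 2)))); last first.
  by rewrite c2 /q /A; field; rewrite s0 Dn.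
apply: (le_trans (ler_normB _ _)); rewrite normrN mulrDr lerD//.
- pose p := sin (nu / 2 * t) / sinhR t.
  have pC : p ^+ 2 <= C1 ^+ 2 * expR (- `|t|) ^+ 2.
    rewrite -exprMn -[p ^+ 2]real_normK ?num_real// ler_pXn2r ?nnegrE//.
      exact: sin_div_sinhR_le.
    by rewrite mulr_ge0// expR_ge0.
  rewrite ger0_norm; last by rewrite mulr_ge0// mulr_ge0// sqr_ge0.
  have -> : 2 * sin (nu / 2 * t) ^+ 2 * A y t = cos y * (2 * (p ^+ 2 * (coshR t *
    (sinhR t ^+ 2 / (sinhR t ^+ 2 + cos y ^+ 2))))).
    by rewrite /p /A; field; rewrite s0 Dn.
  rewrite ler_pM2l// -mulrA ler_pM2l//.
  apply: (@le_trans _ _ (C1 ^+ 2 * expR (- `|t|) ^+ 2 * expR `|t|)).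
    apply: ler_pM => //; first exact: sqr_ge0.
      by rewrite mulr_ge0 ?(ltW (coshR_gt0 _))// divr_ge0 ?sqr_ge0// ltW.
    rewrite -[X in _ <= X]mulr1; apply: ler_pM => //.
    - exact/ltW/coshR_gt0.
    - by rewrite divr_ge0 ?sqr_ge0// ltW.
    - exact: coshR_le_expR.
    - by rewrite ler_pdivrMr// mul1r lerDl sqr_ge0.
  rewrite -mulrA ler_wpM2l ?sqr_ge0// expr2 -mulrA -expRD addNr expR0 mulr1//.
- have -> : cos y * (C2 * A y t) = 1 * (C2 *
    (cos y ^+ 2 * coshR t / (sinhR t ^+ 2 + cos y ^+ 2))).
    by rewrite /A; field.
  rewrite normrM; apply: ler_pM => //; first exact: sin_max.
  rewrite normrM; apply: ler_pM => //.
    apply: (le_trans (sin_div_sinhR_le _ _)); rewrite -[X in _ <= X]mulr1.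
    by rewrite ler_wpM2l// -expR0 ler_expR oppr_le0.
  rewrite ger0_norm; last by rewrite divr_ge0 ?sqr_ge0// ltW.
  rewrite ler_pM2r ?invr_gt0// -[X in X <= _]mulr1 ler_wpM2l ?sqr_ge0//.
  exact: coshR_ge1.
Qed.

(* [e^{pi nu / 2} int e^{i nu t} / cosh t = pi + int sin (nu t) / sinh t]: as
   [y] tends to [pi / 2] the contour [R + i y] runs into the pole of
   [1 / cosh], which contributes [pi]. *)
Lemma sech_csch_fourier :
  expR (nu * (pi / 2)) * \int[mu]_t (cos (nu * t) / coshR t) =
  pi + \int[mu]_t (sin (nu * t) / sinhR t).
Proof.
set J := \int[mu]_t (cos _ / _); set S := \int[mu]_t (sin _ / _).
pose I := \int[mu]_t expR (- `|t|) : R.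
pose K := 2 * C1 ^+ 2 * I + C2 * pi.
have bound (y : R) : 0 <= y < pi / 2 ->
    `|expR (nu * y) * J - pi - sin y * S| <= cos y * K.
  move=> yp; have [iu eu] := @integral_strip_pihalf nu y yp.
  have [iA eA] := A_int yp.
  have iS := integrable_sin_div_sinhR.
  have iE := @integrable_expR_norm R.
  have i1 := rintegrableZl (expR (nu * y)) iu.
  have i2 := rintegrableZl (sin y) iS.
  have i3 := rintegrableZl (-1) iA.
  have i4 := rintegrableZl (-1) i2.
  have i5 := rintegrableD (rintegrableD i1 i3) i4.
  have -> : expR (nu * y) * J - pi - sin y * S = \int[mu]_t (
     expR (nu * y) * (expR (- (nu * y)) *
     ((cos (nu * t) * coshR t * cos y + sin (nu * t) * sinhR t * sin y) /
      (sinhR t ^+ 2 + cos y ^+ 2))) + -1 * A y t + -1 * (sin y * q t)).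
    rewrite RintegralD//; last exact: rintegrableD.
    rewrite RintegralD// (@RintegralZl _ _ _ mu setT _ _ measurableT iu) eu.
    rewrite (@RintegralZl _ _ _ mu setT _ _ measurableT i2).
    rewrite (@RintegralZl _ _ _ mu setT _ _ measurableT iA) eA.
    rewrite (@RintegralZl _ _ _ mu setT _ _ measurableT iS).
    by rewrite !mulN1r.
  apply: (le_trans (le_normr_Rintegral _ i5)) => //.
  have iA' := rintegrableZl C2 iA.
  have iE' := rintegrableZl (2 * C1 ^+ 2) iE.
  have <- : \int[mu]_t (cos y * (2 * C1 ^+ 2 * expR (- `|t|) + C2 * A y t)) =
     cos y * K.
    rewrite RintegralZl//; last exact: rintegrableD.
    by rewrite RintegralD// !RintegralZl// eA.
  apply: le_Rintegral => //.
  - by have := integrable_norm i5.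
  - exact/rintegrableZl/rintegrableD.
  - by move=> t _ /=; rewrite !mulN1r; exact: pointwise.
pose f (y : R) := `|expR (nu * y) * J - pi - sin y * S|.
have ce : continuous (fun y : R => expR (nu * y)).
  by move=> y; apply/differentiable_continuous/derivable1_diffP;
    exact: ex_derive.
have cf : continuous f.
  move=> y; apply: cvg_norm; apply: cvgB; last first.
    by apply: cvgMr_tmp; exact: continuous_sin.
  apply: cvgB; last exact: cvg_cst.
  by apply: cvgMr_tmp; exact: ce.
have cg : continuous (fun y : R => cos y * K).
  by move=> y; apply: cvgMr_tmp; exact: continuous_cos.
(* Both sides are continuous in [y] up to [pi / 2] once the integrals have become the constants [J],
   [S] and [K], and the right side vanishes there. *)
have : f (pi / 2) <= cos (pi / 2) * K.
  have lf := cvg_at_left_filter (cf (pi / 2)).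
  have lg := cvg_at_left_filter (cg (pi / 2)).
  apply: (ler_cvg_to lf lg).
  near=> y; apply: bound; apply/andP; split; near: y.
    by apply: nbhs_left_ge; rewrite divr_gt0// pi_gt0.
  exact: nbhs_left_lt.
rewrite cos_pihalf mul0r normr_le0 sin_pihalf mul1r => /eqP; lra.
Unshelve. all: by end_near. Qed.

End limit.
End hyperbolic_fourier.

Local Open Scope sesquilinear_scope.

(** * Matrices and unitary changes of basis *)

Section matrix_algebra.
Variable C : numClosedFieldType.

Lemma adjM m n p (A : 'M[C]_(m, n)) (B : 'M[C]_(n, p)) :
  (A *m B)^t* = B^t* *m A^t*.
Proof. by rewrite trmx_mul map_mxM. Qed.

Lemma adjB m n (A B : 'M[C]_(m, n)) : (A - B)^t* = A^t* - B^t*.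
Proof. by rewrite linearB map_mxB. Qed.

Lemma adjE m n (A : 'M[C]_(m, n)) i j : (A^t*) i j = (A j i)^*.
Proof. by rewrite !mxE. Qed.

Lemma mxtrace_adj n (A : 'M[C]_n) : \tr (A^t*) = (\tr A)^*.
Proof. by rewrite /mxtrace rmorph_sum; apply: eq_bigr => i _; rewrite adjE. Qed.

Lemma hermsym_adj n (A : 'M[C]_n) : (A \is hermsymmx) <-> A^t* = A.
Proof.
split.
  by move/is_hermitianmxP; rewrite expr0 scale1r => {2}->.
by move=> h; apply/is_hermitianmxP; rewrite expr0 scale1r h.
Qed.

Lemma adj_diag n (x : 'rV[C]_n) :
  (diag_mx x)^t* = diag_mx (map_mx (fun z => z^*) x).
Proof. by rewrite tr_diag_mx map_diag_mx. Qed.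

Lemma unitary_adjr n (U : 'M[C]_n) : U \is unitarymx -> U *m U^t* = 1%:M.
Proof. by move/unitarymxP. Qed.

Lemma unitary_adjl n (U : 'M[C]_n) : U \is unitarymx -> U^t* *m U = 1%:M.
Proof. by move=> h; rewrite -[RHS](mulVmx (unitarymx_unit h)) invmx_unitary. Qed.

Definition nrmC m n (X : 'M[C]_(m, n)) : C := \tr (X^t* *m X).

Lemma nrmCE m n (X : 'M[C]_(m, n)) : nrmC X = \sum_j \sum_i (X i j)^* * X i j.
Proof.
rewrite /nrmC /mxtrace; apply: eq_bigr => j _; rewrite mxE.
by apply: eq_bigr => i _; rewrite adjE.
Qed.

Lemma nrmC_ge0 m n (X : 'M[C]_(m, n)) : 0 <= nrmC X.
Proof.
rewrite nrmCE; do 2 apply: sumr_ge0 => ? _.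
by rewrite mulrC mul_conjC_ge0.
Qed.

Lemma nrmC_unitaryl m n (U : 'M[C]_m) (X : 'M[C]_(m, n)) :
  U^t* *m U = 1%:M -> nrmC (U *m X) = nrmC X.
Proof. by move=> h; rewrite /nrmC adjM mulmxA -(mulmxA _ _ U) h mulmx1. Qed.

Lemma nrmC_adj m n (X : 'M[C]_(m, n)) : nrmC (X^t*) = nrmC X.
Proof. by rewrite /nrmC trmxCK mxtrace_mulC. Qed.

Lemma nrmC_unitaryr m n (U : 'M[C]_n) (X : 'M[C]_(m, n)) :
  U *m U^t* = 1%:M -> nrmC (X *m U) = nrmC X.
Proof. by move=> h; rewrite -nrmC_adj adjM nrmC_unitaryl ?nrmC_adj// trmxCK. Qed.

(** Expansion of [nrmC (l *: X - Y) >= 0], divided by [l]. *)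
Lemma nrmC_amgm m n (X Y : 'M[C]_(m, n)) (l : C) : 0 < l ->
  \tr (X^t* *m Y) + (\tr (X^t* *m Y))^* <= l * nrmC X + l^-1 * nrmC Y.
Proof.
move=> l0; have := nrmC_ge0 (l *: X - Y).
have lr : l^* = l by apply/CrealP/gtr0_real.
have -> : nrmC (l *: X - Y) = l ^+ 2 * nrmC X
    - l * (\tr (X^t* *m Y) + (\tr (X^t* *m Y))^*) + nrmC Y.
  have aZ : (l *: X)^t* = l *: X^t*.
    by apply/matrixP => i j; rewrite !mxE rmorphM; congr (_ * _); exact: lr.
  rewrite {1}/nrmC adjB aZ mulmxBl !mulmxBr -!scalemxAl -!scalemxAr.
  rewrite opprB !mxtraceD !raddfN /= !mxtraceZ -mxtrace_adj adjM trmxCK.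
  by rewrite /nrmC; ring.
set u := \tr _ + _ => h; rewrite -(ler_pM2l l0).
have -> : l * (l * nrmC X + l^-1 * nrmC Y) = l ^+ 2 * nrmC X + nrmC Y.
  by rewrite mulrDr mulrA -expr2 mulrA mulfV ?gt_eqF// mul1r.
rewrite -subr_ge0.
have <- : l ^+ 2 * nrmC X - l * u + nrmC Y = l ^+ 2 * nrmC X + nrmC Y - l * u.
  by ring.
by [].
Qed.

Lemma mxtrace_nrmC m n (W : 'M[C]_n) (Y : 'M[C]_(n, m)) :
  \tr (Y^t* *m (W *m (W^t* *m Y))) = nrmC (W^t* *m Y).
Proof. by rewrite /nrmC adjM trmxCK !mulmxA. Qed.

Definition contraction n (W : 'M[C]_n) :=
  forall m (Y : 'M[C]_(n, m)), nrmC (W *m Y) <= nrmC Y.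

(** [|W' Y|^2] is the trace of [Y' W W' Y]; AM-GM and the bound for [W] give
    [2 |W' Y|^2 <= |Y|^2 + |W' Y|^2], and one copy is absorbed. *)
Lemma contraction_adj n (W : 'M[C]_n) : contraction W -> contraction (W^t*).
Proof.
move=> cW m Y; have := nrmC_amgm Y (W *m (W^t* *m Y)) ltr01.
rewrite mxtrace_nrmC invr1 !mul1r.
have -> : (nrmC (W^t* *m Y))^* = nrmC (W^t* *m Y).
  exact/CrealP/ger0_real/nrmC_ge0.
move=> h; have := lerD (lexx (nrmC Y)) (cW _ (W^t* *m Y)).
by move=> /(le_trans h); rewrite lerD2r.
Qed.

Definition sandwich n (U : 'M[C]_n) (x : 'I_n -> C) : 'M[C]_n :=
  U^t* *m diag_mx (\row_i x i) *m U.

Lemma eq_sandwich n (U : 'M[C]_n) (x y : 'I_n -> C) : x =1 y ->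
  sandwich U x = sandwich U y.
Proof. by move=> /funext ->. Qed.

Lemma sandwich_adj n (U : 'M[C]_n) (x : 'I_n -> C) : (forall i, (x i)^* = x i) ->
  (sandwich U x)^t* = sandwich U x.
Proof.
move=> h; rewrite /sandwich !adjM trmxCK adj_diag mulmxA.
congr (_ *m diag_mx _ *m _); apply/rowP => i; rewrite !mxE; exact: h.
Qed.

Lemma sandwichM n (U : 'M[C]_n) (x y : 'I_n -> C) : U \is unitarymx ->
  sandwich U x *m sandwich U y = sandwich U (fun i => x i * y i).
Proof.
move=> u; rewrite /sandwich !mulmxA -(mulmxA _ U) (unitary_adjr u) mulmx1.
rewrite -(mulmxA (U^t*)) mulmx_diag; congr (_ *m diag_mx _ *m _).
by apply/rowP => i; rewrite !mxE.
Qed.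

Lemma sandwich_tr n (U : 'M[C]_n) (x : 'I_n -> C) : U \is unitarymx ->
  \tr (sandwich U x) = \sum_i x i.
Proof.
move=> u; rewrite /sandwich mxtrace_mulC mulmxA (unitary_adjr u) mul1mx.
by rewrite mxtrace_diag; apply: eq_bigr => i _; rewrite mxE.
Qed.

Lemma sandwichZ n (U : 'M[C]_n) (x : 'I_n -> C) k :
  k *: sandwich U x = sandwich U (fun i => k * x i).
Proof.
rewrite /sandwich scalemxAl scalemxAr; congr (_ *m _ *m _).
by apply/matrixP => i j; rewrite !mxE; case: eqP => _;
  rewrite ?mulr0n ?mulr1n ?mulr0.
Qed.

Lemma intertwine_diag n (W : 'M[C]_n) (p x q y : 'I_n -> C) :
  (forall i j, p j = x i -> q j = y i) ->
  W *m diag_mx (\row_i p i) = diag_mx (\row_i x i) *m W ->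
  W *m diag_mx (\row_i q i) = diag_mx (\row_i y i) *m W.
Proof.
move=> pq key; apply/matrixP => i j; have /matrixP/(_ i j) := key.
rewrite !mul_mx_diag !mul_diag_mx !mxE.
have [->|W0] := eqVneq (W i j) 0; first by rewrite !mul0r !mulr0.
by rewrite mulrC => /(mulIf W0)/pq ->; rewrite mulrC.
Qed.

(** [W = U P'] intertwines the two diagonals, so a nonzero entry [W i j] forces [p j = x i], and [W]
    then intertwines [q] and [y] as well. This makes functional calculus independent of the
    diagonalisation that [spectralmx] happens to return. *)
Lemma sandwich_inj n (P U : 'M[C]_n) (p x q y : 'I_n -> C) :
  P \is unitarymx -> U \is unitarymx ->
  sandwich P p = sandwich U x -> (forall i j, p j = x i -> q j = y i) ->
  sandwich P q = sandwich U y.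
Proof.
move=> uP uU eB pq; pose W := U *m P^t*.
have key : W *m diag_mx (\row_i p i) = diag_mx (\row_i x i) *m W.
  have : U *m sandwich P p *m P^t* = diag_mx (\row_i x i) *m W.
    by rewrite eB /sandwich !mulmxA (unitary_adjr uU) mul1mx -mulmxA.
  move=> <-; rewrite /sandwich !mulmxA -(mulmxA _ P) (unitary_adjr uP) mulmx1.
  by [].
have keyq := intertwine_diag pq key.
rewrite /sandwich.
have -> : P^t* = U^t* *m W by rewrite /W mulmxA (unitary_adjl uU) mul1mx.
rewrite -(mulmxA (U^t*)) keyq -!mulmxA; congr (_ *m (_ *m _)).
by rewrite /W -?mulmxA (unitary_adjl uP) mulmx1.
Qed.

Lemma sandwich_quad n (U : 'M[C]_n) (x : 'I_n -> C) i : U \is unitarymx ->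
  (U^t* *m delta_mx i (0 : 'I_1))^t* *m sandwich U x *m (U^t* *m delta_mx i 0)
  = (x i)%:M.
Proof.
move=> u; rewrite /sandwich adjM trmxCK !mulmxA.
rewrite -(mulmxA _ U) (unitary_adjr u) mulmx1 -(mulmxA _ U) (unitary_adjr u) mulmx1.
have -> : (delta_mx i 0 : 'cV[C]_n)^t* = delta_mx 0 i.
  by rewrite trmx_delta; apply/matrixP => k l; rewrite !mxE; case: (_ && _);
    rewrite ?rmorph1 ?rmorph0.
rewrite -rowE -colE; apply/matrixP => k l; rewrite !mxE eqxx mulr1n.
by rewrite !ord1 eqxx mulr1n.
Qed.

Lemma gram_quad n (X : 'M[C]_n) (v : 'cV[C]_n) :
  0 <= (v^t* *m (X^t* *m X) *m v) 0 0.
Proof.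
have -> : v^t* *m (X^t* *m X) *m v = (X *m v)^t* *m (X *m v).
  by rewrite adjM !mulmxA.
by have := nrmC_ge0 (X *m v); rewrite /nrmC /mxtrace big_ord1.
Qed.

(** Intended for [g = k^{-1/2}] on the support of [k]: then [X *m sandwich U g] is the partial
    isometry in the polar decomposition of [X]. *)
Lemma contraction_sandwich n (X U : 'M[C]_n) (k g : 'I_n -> C) :
  U \is unitarymx -> X^t* *m X = sandwich U k -> (forall i, (g i)^* = g i) ->
  (forall i, g i * k i * g i <= 1) -> contraction (X *m sandwich U g).
Proof.
move=> u XX gr gk m Y.
have -> : nrmC (X *m sandwich U g *m Y) =
    \tr (Y^t* *m (sandwich U (fun i => g i * k i * g i) *m Y)).
  rewrite -!sandwichM// -XX /nrmC (adjM (X *m _)) (adjM X) sandwich_adj//.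
  by rewrite !mulmxA.
rewrite -(nrmC_unitaryl Y (unitary_adjl u)) /sandwich.
set D := diag_mx _; have -> : Y^t* *m (U^t* *m D *m U *m Y) =
  (U *m Y)^t* *m (D *m (U *m Y)) by rewrite adjM !mulmxA.
move: (U *m Y) => Z; rewrite nrmCE /mxtrace; apply: ler_sum => j _; rewrite mxE.
apply: ler_sum => i _; rewrite /D mul_diag_mx !mxE mulrCA ler_piMl ?gk//.
by rewrite mulrC mul_conjC_ge0.
Qed.

Lemma mxtrace_dual n (X U : 'M[C]_n) (k g : 'I_n -> C) :
  U \is unitarymx -> X^t* *m X = sandwich U k -> (forall i, (g i)^* = g i) ->
  \tr ((X *m sandwich U g)^t* *m X) = \sum_i g i * k i.
Proof.
move=> u XX gr; rewrite (adjM X) sandwich_adj// -mulmxA XX sandwichM//.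
by rewrite sandwich_tr.
Qed.

(** * Unitary change of basis *)

Definition to_basis n (V X : 'M[C]_n) : 'M[C]_n := V *m X *m V^t*.

Section to_basis.
Variables (n : nat) (V : 'M[C]_n).
Hypothesis uV : V \is unitarymx.
Implicit Types X Y : 'M[C]_n.

Lemma to_basisM X Y : to_basis V (X *m Y) = to_basis V X *m to_basis V Y.
Proof.
by rewrite /to_basis !mulmxA -(mulmxA _ (V^t*)) (unitary_adjl uV) mulmx1.
Qed.

Lemma to_basisK X : to_basis V (V^t* *m X *m V) = X.
Proof.
rewrite /to_basis !mulmxA (unitary_adjr uV) mul1mx -mulmxA (unitary_adjr uV).
by rewrite mulmx1.
Qed.

Lemma to_basis_inv X : V^t* *m to_basis V X *m V = X.
Proof.
rewrite /to_basis !mulmxA (unitary_adjl uV) mul1mx -mulmxA (unitary_adjl uV).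
by rewrite mulmx1.
Qed.

Lemma to_basis_adj X : to_basis V (X^t*) = (to_basis V X)^t*.
Proof. by rewrite /to_basis !adjM trmxCK mulmxA. Qed.

Lemma to_basisB X Y : to_basis V (X - Y) = to_basis V X - to_basis V Y.
Proof. by rewrite /to_basis mulmxBr mulmxBl. Qed.

Lemma to_basisD X Y : to_basis V (X + Y) = to_basis V X + to_basis V Y.
Proof. by rewrite /to_basis mulmxDr mulmxDl. Qed.

Lemma to_basisZ k X : to_basis V (k *: X) = k *: to_basis V X.
Proof. by rewrite /to_basis -scalemxAr -scalemxAl. Qed.

Lemma to_basis_tr X : \tr (to_basis V X) = \tr X.
Proof. by rewrite /to_basis mxtrace_mulC mulmxA (unitary_adjl uV) mul1mx. Qed.

Lemma to_basis_nrmC X : nrmC (to_basis V X) = nrmC X.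
Proof.
rewrite /to_basis nrmC_unitaryr ?trmxCK ?(unitary_adjl uV)//.
by rewrite nrmC_unitaryl// (unitary_adjl uV).
Qed.

Lemma to_basis_le (k : C) X :
  (forall m (Y : 'M[C]_(n, m)), nrmC (X *m Y) <= k * nrmC Y) ->
  forall m (Y : 'M[C]_(n, m)), nrmC (to_basis V X *m Y) <= k * nrmC Y.
Proof.
move=> h m Y; rewrite /to_basis -!mulmxA nrmC_unitaryl ?(unitary_adjl uV)//.
apply: (le_trans (h _ _)).
by rewrite nrmC_unitaryl// trmxCK (unitary_adjr uV).
Qed.

Lemma to_basis_contraction X : contraction X -> contraction (to_basis V X).
Proof.
move=> cX m Y; rewrite -[leRHS]mul1r; apply: to_basis_le => m' Y'.
by rewrite mul1r.
Qed.

(** Functions of one Hermitian matrix, placed on either side, become Schur multipliers in its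
    eigenbasis. Evolution and Gibbs conjugation are of this kind, which is why the analysis takes
    place in the energy basis. *)
Lemma to_basis_sandwich (x y : 'I_n -> C) X :
  to_basis V (sandwich V x *m X *m sandwich V y) =
  \matrix_(i, j) (x i * y j * to_basis V X i j).
Proof.
rewrite (to_basisM _ (sandwich V y)) (to_basisM (sandwich V x)).
rewrite /sandwich !to_basisK; apply/matrixP => i j.
by rewrite mul_mx_diag mul_diag_mx !mxE; ring.
Qed.

End to_basis.

(* The balanced form of the generator: [P, Q] stand for
   [rho^{1/4} A rho^{-1/4}] and [rho^{-1/4} A rho^{1/4}], [x] for
   [sqrt sigma]. *)
Lemma balanced_expansion n (P Q x : 'M[C]_n) : x^t* = x ->
  let E := P *m x - x *m Q in
  let B := E *m x *m Q^t* - Q^t* *m E *m x in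
  B + B^t* =
  Q *m (x *m x) *m P^t* + P *m (x *m x) *m Q^t*
  - (Q^t* *m P *m (x *m x) + x *m x *m (P^t* *m Q))
  - (Q *m x *m Q^t* - Q^t* *m x *m Q) *m x
  - x *m (Q *m x *m Q^t* - Q^t* *m x *m Q).
Proof.
move=> hx E B; rewrite /B /E.
rewrite !(adjB, adjM, trmxCK, hx) !(mulmxBl, mulmxBr, mulmxA) !opprB.
move: (P *m x *m x *m Q^t*) (x *m Q *m x *m Q^t*) (Q^t* *m P *m x *m x).
move: (Q^t* *m x *m Q *m x) (Q *m x *m x *m P^t*) (Q *m x *m Q^t* *m x).
move: (x *m x *m P^t* *m Q) (x *m Q^t* *m x *m Q) => a b c e f g h k.
apply/matrixP => i j; rewrite !mxE; ring.
Qed.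

End matrix_algebra.

Local Open Scope complex_scope.

(** * Integrals over time and frequency *)

Section linear_functionals.
Context {R : realType}.

(** Integrals are total functions but linear only on a suitable domain, so a functional is carried
    together with one. Single, iterated and principal value integrals then share one theory. *)
Definition linear_on (T : Type) (D : (T -> R) -> Prop) (J : (T -> R) -> R) :=
  [/\ D (fun=> 0),
      forall f g, D f -> D g ->
        D (fun t => f t + g t) /\ J (fun t => f t + g t) = J f + J g
    & forall k f, D f -> D (fun t => k * f t) /\ J (fun t => k * f t) = k * J f].

Definition complexify (T : Type) (J : (T -> R) -> R) (f : T -> R[i]) : R[i] :=
  J (fun t => complex.Re (f t)) +i* J (fun t => complex.Im (f t)).

Definition complex_dom (T : Type) (D : (T -> R) -> Prop) (f : T -> R[i]) :=
  D (fun t => complex.Re (f t)) /\ D (fun t => complex.Im (f t)).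

Section theory.
Variables (T : Type) (D : (T -> R) -> Prop) (J : (T -> R) -> R).
Hypothesis lin : linear_on D J.
Notation cJ := (complexify J).
Notation cD := (complex_dom D).

Lemma complexify0 : cD (fun=> 0) /\ cJ (fun=> 0) = 0.
Proof.
have [D0 _ Z] := lin; have [_ J0] := Z 0 _ D0.
have {}J0 : J (fun=> 0) = 0.
  by rewrite -[RHS](mul0r (J (fun=> 0))) -J0; congr J; apply/funext => t; rewrite mul0r.
by split; [split|rewrite /complexify /= J0].
Qed.

Lemma complexifyD f g : cD f -> cD g ->
  cD (fun t => f t + g t) /\ cJ (fun t => f t + g t) = cJ f + cJ g.
Proof.
have [_ A _] := lin; move=> [f1 f2] [g1 g2].
have [d1 e1] := A _ _ f1 g1; have [d2 e2] := A _ _ f2 g2.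
have r : (fun t => complex.Re (f t + g t)) =
    (fun t => complex.Re (f t) + complex.Re (g t)).
  by apply/funext => t; case: (f t) => ? ?; case: (g t).
have i : (fun t => complex.Im (f t + g t)) =
    (fun t => complex.Im (f t) + complex.Im (g t)).
  by apply/funext => t; case: (f t) => ? ?; case: (g t).
by split; [split; rewrite ?r ?i|rewrite /complexify r i e1 e2].
Qed.

Lemma complexifyZ (k : R[i]) f : cD f ->
  cD (fun t => k * f t) /\ cJ (fun t => k * f t) = k * cJ f.
Proof.
have [_ A Z] := lin; case: k => a b [f1 f2].
have [d1 e1] := Z a _ f1; have [d2 e2] := Z (- b) _ f2.
have [d3 e3] := Z b _ f1; have [d4 e4] := Z a _ f2.
have [d5 e5] := A _ _ d1 d2; have [d6 e6] := A _ _ d4 d3.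
have r : (fun t => complex.Re ((a +i* b) * f t)) =
    (fun t => a * complex.Re (f t) + - b * complex.Im (f t)).
  by apply/funext => t; case: (f t) => ? ? /=; rewrite mulNr.
have i : (fun t => complex.Im ((a +i* b) * f t)) =
    (fun t => a * complex.Im (f t) + b * complex.Re (f t)).
  by apply/funext => t; case: (f t).
split; first by split; rewrite ?r ?i.
rewrite /complexify r i e5 e6 e1 e2 e3 e4 /=.
by apply/eqP; rewrite eq_complex /= mulNr !eqxx.
Qed.

Lemma complexify_sum (I : Type) (s : seq I) (F : I -> T -> R[i]) :
  (forall i, cD (F i)) ->
  cD (fun t => \sum_(i <- s) F i t) /\
  cJ (fun t => \sum_(i <- s) F i t) = \sum_(i <- s) cJ (F i).
Proof.
move=> dF; elim: s => [|i s [IHd IHe]].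
  rewrite big_nil (_ : (fun t => _) = (fun=> 0)); first exact: complexify0.
  by apply/funext => t; rewrite big_nil.
rewrite big_cons (_ : (fun t => _) = (fun t => F i t + \sum_(j <- s) F j t)).
  by rewrite -IHe; exact: complexifyD.
by apply/funext => t; rewrite big_cons.
Qed.

Lemma complexify_real (f : T -> R) : D f ->
  cD (fun t => (f t)%:C) /\ cJ (fun t => (f t)%:C) = (J f)%:C.
Proof.
move=> df; have [D0 _ _] := lin; split; first by split.
by have [_] := complexify0; rewrite /complexify /= => -[_ ->].
Qed.

Lemma complexify_cis (f theta : T -> R) (k : R[i]) :
  D (fun t => f t * cos (theta t)) -> D (fun t => f t * sin (theta t)) ->
  k = J (fun t => f t * cos (theta t)) +i* J (fun t => f t * sin (theta t)) ->
  cD (fun t => (f t)%:C * cis (theta t)) /\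
  cJ (fun t => (f t)%:C * cis (theta t)) = k.
Proof.
move=> dc ds ->.
have r : (fun t => complex.Re ((f t)%:C * cis (theta t))) =
    (fun t => f t * cos (theta t)).
  by apply/funext => t /=; rewrite mul0r subr0.
have i : (fun t => complex.Im ((f t)%:C * cis (theta t))) =
    (fun t => f t * sin (theta t)).
  by apply/funext => t /=; rewrite mul0r addr0.
by split; [split; rewrite ?r ?i|rewrite /complexify r i].
Qed.

End theory.
End linear_functionals.

(** * Iterated and principal value integrals *)

Section integrals.
Context {R : realType}.
Notation mu := (@lebesgue_measure R).

Lemma linear_on_Rintegral :
  linear_on (fun f : R -> R => rintegrable f) (fun f => \int[mu]_t f t).
Proof.
split=> [|f g df dg|k f df].
- exact: (integrable0 mu setT).
- by split; [exact: rintegrableD|rewrite RintegralD].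
- by split; [exact: rintegrableZl|rewrite RintegralZl].
Qed.

Definition dbl_int (F : R * R -> R) : R := \int[mu]_t \int[mu]_w F (w, t).

(** Iterated integrability in the order that [ADB] prescribes, [w] inside and [t] outside. It is
    stable under linear combinations and holds for products [f w * g t], of which all later
    integrands are finite sums. *)
Definition dbl_integrable (F : R * R -> R) : Prop :=
  (forall t, rintegrable (fun w => F (w, t))) /\
  rintegrable (fun t => \int[mu]_w F (w, t)).

Lemma linear_on_dbl_int : linear_on dbl_integrable dbl_int.
Proof.
have i0 : rintegrable (fun=> 0 : R) by exact: (integrable0 mu setT).
have I0 : \int[mu]_w (0 : R) = 0 :> R.
  by have := @Rintegral_odd R _ i0; apply=> x; rewrite oppr0.
split=> [|F G [F1 F2] [G1 G2]|k F [F1 F2]].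
- by split=> //; rewrite I0.
- have E : (fun t => \int[mu]_w (F (w, t) + G (w, t))) =
      (fun t => \int[mu]_w F (w, t) + \int[mu]_w G (w, t)).
    by apply/funext => t; rewrite RintegralD.
  split; last by rewrite /dbl_int E RintegralD.
  by split=> [t|]; [exact: rintegrableD|rewrite E; exact: rintegrableD].
- have E : (fun t => \int[mu]_w (k * F (w, t))) =
      (fun t => k * \int[mu]_w F (w, t)).
    by apply/funext => t; rewrite RintegralZl.
  split; last by rewrite /dbl_int E RintegralZl.
  by split=> [t|]; [exact: rintegrableZl|rewrite E; exact: rintegrableZl].
Qed.

Lemma dbl_int_prod (f g : R -> R) : rintegrable f -> rintegrable g ->
  dbl_integrable (fun p => f p.1 * g p.2) /\
  dbl_int (fun p => f p.1 * g p.2) = (\int[mu]_w f w) * \int[mu]_t g t.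
Proof.
move=> intf intg.
have E : (fun t => \int[mu]_w (f w * g t)) = (fun t => (\int[mu]_w f w) * g t).
  by apply/funext => t; rewrite RintegralZr.
split; last by rewrite /dbl_int /= E RintegralZl.
split=> [t|] /=; last by rewrite E; exact: rintegrableZl.
rewrite (_ : (fun w => f w * g t) = (fun w => g t * f w)).
  exact: rintegrableZl.
by apply/funext => w; rewrite mulrC.
Qed.

Lemma le_dbl_int (F G : R * R -> R) : dbl_integrable F -> dbl_integrable G ->
  (forall p, F p <= G p) -> dbl_int F <= dbl_int G.
Proof.
move=> [F1 F2] [G1 G2] FG; apply: le_Rintegral => // t _.
exact: le_Rintegral.
Qed.

Let punctured (e : R) : set R := [set t : R | e < `|t|].

Let measurable_punctured e : measurable (punctured e).
Proof.
rewrite [X in measurable X](_ : _ = ~` `[- e, e]%classic).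
  by apply: measurableC.
apply/seteqP; split => t /=; rewrite in_itv/= -ler_norml.
  by move=> h h2; move: (lt_le_trans h h2); rewrite ltxx.
by move/negP; rewrite -ltNge.
Qed.

(** Integrability away from 0 makes each truncation linear; convergence makes the limit linear. *)
Definition pv_dom (F : R -> R) : Prop :=
  (forall e : R, 0 < e -> mu.-integrable [set t : R | e < `|t|] (EFin \o F)) /\
  cvg ((\int[mu]_(t in [set t : R | e < `|t|]) F t) @[e --> 0^'+]).

Let cvg_near (F G : R -> R) (l : R) : (forall e : R, 0 < e -> F e = G e) ->
  F e @[e --> 0^'+] --> l -> G e @[e --> 0^'+] --> l.
Proof.
move=> FG; apply: cvg_trans; apply: near_eq_cvg.
by near=> e; apply: FG; near: e; exact: nbhs_right_gt.
Unshelve. all: by end_near. Qed.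

Lemma linear_on_pvint : linear_on pv_dom (@pvint R).
Proof.
split=> [|F G [F1 F2] [G1 G2]|k F [F1 F2]].
- split; first by move=> e _; exact: (integrable0 mu _).
  rewrite (_ : (fun e => _) = cst 0); first exact: is_cvg_cst.
  apply/funext => e; rewrite Rintegral_mkcond (_ : _ \_ _ = fun=> 0).
    have i0 : rintegrable (fun=> 0 : R) by exact: (integrable0 mu setT).
    by have := @Rintegral_odd R _ i0; apply=> x; rewrite oppr0.
  by apply/funext => t; rewrite patchE; case: ifP.
- have h : (\int[mu]_(t in [set t : R | e < `|t|]) (F t + G t)) @[e --> 0^'+] -->
      pvint F + pvint G.
    apply: cvg_near (cvgD F2 G2) => e e0.
    by rewrite /= RintegralD//; [exact: measurable_punctured|exact: F1|exact: G1].
  split; last exact/cvg_lim.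
  split; last by apply/cvg_ex; exists (pvint F + pvint G).
  move=> e e0; rewrite [X in _.-integrable _ X](_ : _ =
    (fun x => (EFin \o F) x + (EFin \o G) x)%E)//.
  by apply: integrableD; [exact: measurable_punctured|exact: F1|exact: G1].
- have h : (\int[mu]_(t in [set t : R | e < `|t|]) (k * F t)) @[e --> 0^'+] -->
      k * pvint F.
    apply: cvg_near (cvgM (cvg_cst k) F2) => e e0.
    by rewrite /= RintegralZl//; [exact: measurable_punctured|exact: F1].
  split; last exact/cvg_lim.
  split; last by apply/cvg_ex; exists (k * pvint F).
  move=> e e0; rewrite [X in _.-integrable _ X](_ : _ =
    (fun x => k%:E * (EFin \o F) x)%E)//.
  by apply: integrableZl; [exact: measurable_punctured|exact: F1].
Qed.

(** Every symmetric truncation of an odd function integrates to zero. The majorant may degenerate as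
    [e] tends to 0, since [k] depends on [e]. *)
Lemma pvint_odd (F G : R -> R) : measurable_fun setT F ->
  (forall e : R, 0 < e -> exists k, forall t, e < `|t| -> `|F t| <= k * G t) ->
  (forall t, 0 <= G t) -> rintegrable G ->
  (forall t, F (- t) = - F t) -> pv_dom F /\ pvint F = 0.
Proof.
move=> mF FG G0 iG oF.
have iF (e : R) : 0 < e -> mu.-integrable [set t : R | e < `|t|] (EFin \o F).
  move=> e0; have [k kF] := FG e e0.
  have iG' : mu.-integrable [set t : R | e < `|t|] (EFin \o (fun t => k * G t)).
    apply: (integrableS _ _ _ (rintegrableZl k iG)) => //.
    exact: measurable_punctured.
  apply: (le_integrable _ _ _ iG'); first exact: measurable_punctured.
    exact/measurable_EFinP/measurable_funTS.
  move=> t /= et; rewrite lee_fin (le_trans (kF t et))//; exact: ler_norm.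
have I0 (e : R) : 0 < e -> \int[mu]_(t in [set t : R | e < `|t|]) F t = 0.
  move=> e0; rewrite Rintegral_mkcond; apply: Rintegral_odd.
    have := iF e e0; rewrite integrable_mkcond//; last exact: measurable_punctured.
    by rewrite restrict_EFin.
  move=> t; rewrite !patchE.
  have -> : (- t \in [set t : R | e < `|t|]) = (t \in [set t : R | e < `|t|]).
    by apply/idP/idP => /[!inE] /=; rewrite normrN.
  by case: ifP => _; rewrite ?oF ?oppr0.
have c : (\int[mu]_(t in [set t : R | e < `|t|]) F t) @[e --> 0^'+] --> (0 : R).
  apply: (@cvg_near (cst 0)); last exact: cvg_cst.
  by move=> e e0; rewrite I0.
split; last exact: (cvg_lim _ c).
by split=> //; apply/cvg_ex; exists 0.
Qed.

(** The removed interval [[- e, e]] contributes at most [2 k e]. *)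
Lemma pvint_integrable (F : R -> R) (k : R) : rintegrable F ->
  (forall t, `|F t| <= k) -> pv_dom F /\ pvint F = \int[mu]_t F t.
Proof.
move=> iF Fk.
have k0 : 0 <= k := le_trans (normr_ge0 _) (Fk 0).
have iS (A : set R) : measurable A -> mu.-integrable A (EFin \o F).
  by move=> mA; apply: (integrableS _ _ _ iF).
have b (e : R) : 0 < e -> `|(\int[mu]_t F t) -
    \int[mu]_(t in [set t : R | e < `|t|]) F t| <= k * (2 * e).
  move=> e0; have mI : measurable (`[- e, e]%classic : set R) by [].
  have U : [set: R] = [set t : R | e < `|t|] `|` `[- e, e]%classic.
    apply/seteqP; split => // t _ /=; rewrite in_itv/= -ler_norml.
    by have [h|h] := leP `|t| e; [right|left].
  rewrite U Rintegral_setU//; last 2 first.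
  - by rewrite -U.
  - rewrite disj_set2E; apply/eqP/seteqP; split => // t /= [].
    by rewrite in_itv/= -ler_norml ltNge => /negP.
  rewrite addrAC subrr add0r (le_trans (le_normr_Rintegral _ (iS _ mI)))//.
  have -> : k * (2 * e) = \int[mu]_(t in `[- e, e]) (cst k t).
    rewrite Rintegral_cst//= lebesgue_measure_itv/= lte_fin gtrN// opprK/=.
    by rewrite mulrDl mul1r.
  apply: le_Rintegral => //.
  - exact: (integrable_norm (iS _ mI)).
  - apply/integrableP; split; first exact/measurable_EFinP.
    rewrite [X in (X < _)%E](_ : _ =
      (\int[mu]_(x in `[(- e)%R, e]) cst (`|k|%R%:E) x)%E)//.
    rewrite integral_cst//= lebesgue_measure_itv/=; case: ifP => _.
      by rewrite -EFinD -EFinM ltry.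
    by rewrite mule0 ltry.
  exact: measurable_punctured.
have c : (\int[mu]_(t in [set t : R | e < `|t|]) F t) @[e --> 0^'+] -->
    (\int[mu]_t F t).
  have p : 0 < 2 * k + 1 by rewrite ltr_wpDl// mulr_ge0.
  apply/cvgrPdist_le => /= eps eps0; near=> r.
  have r0 : 0 < r by near: r; exact: nbhs_right_gt.
  apply: (le_trans (b r r0)).
  have rl : r <= eps / (2 * k + 1).
    by near: r; apply: nbhs_right_le; rewrite divr_gt0.
  move: rl; rewrite ler_pdivlMr// => rl; apply: le_trans rl.
  have -> : k * (2 * r) = r * (2 * k) by ring.
  by rewrite ler_wpM2l ?(ltW r0)// lerDl.
split; last exact: (cvg_lim _ c).
split; last by apply/cvg_ex; exists (\int[mu]_t F t).
by move=> e _; apply: iS; exact: measurable_punctured.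
Unshelve. all: by end_near. Qed.

End integrals.

(** * Frequency multipliers of the thermal kernels *)

Section kernels.
Context {R : realType}.
Notation mu := (@lebesgue_measure R).

Section bath.
Variable beta : R.
Hypothesis beta0 : 0 < beta.
Let b := 2 * pi / beta.

Let b0 : 0 < b.
Proof. by rewrite divr_gt0// mulr_gt0// pi_gt0. Qed.

Let bt (t : R) : 2 * pi * t / beta = b * t.
Proof. by rewrite /b; field; rewrite gt_eqF. Qed.

Let beta_b : beta * b = 2 * pi.
Proof. by rewrite /b mulrC divfK// gt_eqF. Qed.

Definition ghat (nu : R) := \int[mu]_t (g_kernel beta t * cos (nu * t)).
Definition chat (nu : R) := \int[mu]_t (c_kernel beta t * sin (nu * t)).

Lemma g_kernel_ge0 (t : R) : 0 <= g_kernel beta t.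
Proof. by rewrite divr_ge0// mulr_ge0 ?(ltW beta0)// ltW// coshR_gt0. Qed.

Lemma measurable_g_kernel : measurable_fun setT (g_kernel beta).
Proof.
apply: measurable_funM => //; apply: measurable_funV; apply: measurable_funM => //.
apply: measurableT_comp.
  exact: continuous_measurable_fun continuous_coshR.
by apply: measurable_funM => //; exact: measurable_funM.
Qed.

Lemma integrable_g_kernel : rintegrable (g_kernel beta).
Proof.
have := rintegrableZl beta^-1
  (integrable_affine 0 (negbT (gt_eqF b0)) (@integrable_coshRV R)).
rewrite (_ : (fun x => _) = g_kernel beta)//.
by apply/funext => t; rewrite /g_kernel addr0 bt div1r (invfM beta).
Qed.

Lemma integrable_g_cos (nu : R) :
  rintegrable (fun t => g_kernel beta t * cos (nu * t)).
Proof.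
apply: (le_rintegrable _ integrable_g_kernel).
  apply: measurable_funM; first exact: measurable_g_kernel.
  apply: measurableT_comp; last exact: measurable_funM.
  exact: continuous_measurable_fun (@continuous_cos R).
move=> t; rewrite normrM ger0_norm ?g_kernel_ge0//.
by rewrite ler_piMr ?g_kernel_ge0// cos_max.
Qed.

Lemma integrable_g_sin (nu : R) :
  rintegrable (fun t => g_kernel beta t * sin (nu * t)).
Proof.
apply: (le_rintegrable _ integrable_g_kernel).
  apply: measurable_funM; first exact: measurable_g_kernel.
  apply: measurableT_comp; last exact: measurable_funM.
  exact: continuous_measurable_fun (@continuous_sin R).
move=> t; rewrite normrM ger0_norm ?g_kernel_ge0//.
by rewrite ler_piMr ?g_kernel_ge0// sin_max.
Qed.

Lemma g_kernelN (t : R) : g_kernel beta (- t) = g_kernel beta t.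
Proof. by rewrite /g_kernel !bt mulrN coshRN. Qed.

Lemma c_kernelN (t : R) : c_kernel beta (- t) = - c_kernel beta t.
Proof. by rewrite /c_kernel !bt mulrN sinhRN mulrN invrN mulrN. Qed.

Lemma integral_g_sin (nu : R) : \int[mu]_t (g_kernel beta t * sin (nu * t)) = 0.
Proof.
apply: Rintegral_odd; first exact: integrable_g_sin.
by move=> t; rewrite g_kernelN mulrN sinN mulrN.
Qed.

Lemma ghatN (nu : R) : ghat (- nu) = ghat nu.
Proof. by apply: eq_Rintegral => t _; rewrite mulNr cosN. Qed.

Lemma c_kernelE (nu t : R) : c_kernel beta t * sin (nu * t) =
  beta^-1 * (sin (nu / b * (b * t)) / sinhR (b * t)).
Proof.
have -> : nu / b * (b * t) = nu * t by rewrite mulrA divfK// gt_eqF.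
by rewrite /c_kernel bt div1r (invfM beta); ring.
Qed.

Let sin_int (nu : R) := integrable_affine 0 (negbT (gt_eqF b0))
  (@integrable_sin_div_sinhR R nu).

Lemma integrable_c_sin (nu : R) :
  rintegrable (fun t => c_kernel beta t * sin (nu * t)).
Proof.
have := rintegrableZl beta^-1 (sin_int (nu / b)).
rewrite (_ : (fun x => _) = (fun t => c_kernel beta t * sin (nu * t)))//.
by apply/funext => t; rewrite addr0 c_kernelE.
Qed.

Lemma chatN (nu : R) : chat (- nu) = - chat nu.
Proof.
rewrite -[RHS]mulN1r -RintegralZl//; last exact: integrable_c_sin.
by apply: eq_Rintegral => t _; rewrite mulNr sinN; ring.
Qed.

(** This is [sech_csch_fourier] at frequency [nu / b] with [b = 2 pi / beta]; division by [2 pi]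
    turns the contribution [pi] of the pole into [1/2]. *)
Lemma expR_ghat (nu : R) : expR (beta * nu / 4) * ghat nu = 2^-1 + chat nu.
Proof.
have bn : b != 0 by rewrite gt_eqF.
have betan : beta != 0 by rewrite gt_eqF.
have pin : pi != 0 :> R by rewrite gt_eqF// pi_gt0.
have pi_b (X : R) : (2 * pi)^-1 * (b * X) = beta^-1 * X.
  by rewrite mulrA /b (mulrA (2 * pi)^-1) mulVf ?mul1r// mulf_neq0.
have icos : rintegrable (fun t => cos (nu / b * t) / coshR t).
  apply: (le_rintegrable _ (@integrable_coshRV R)).
    apply: measurable_funM; last exact: measurable_coshRV.
    apply: measurableT_comp; last exact: measurable_funM.
    exact: continuous_measurable_fun (@continuous_cos R).
  move=> t; have c0 : 0 <= (coshR t)^-1 by rewrite invr_ge0 ltW// coshR_gt0.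
  by rewrite normrM (ger0_norm c0) ler_piMl// cos_max.
have -> : ghat nu = (2 * pi)^-1 * \int[mu]_t (cos (nu / b * t) / coshR t).
  have := Rintegral_affine 0 bn icos; rewrite gtr0_norm// => E.
  have -> : \int[mu]_t (cos (nu / b * t) / coshR t) = b * \int[mu]_t
    (cos (nu / b * (b * t + 0)) / coshR (b * t + 0)) by rewrite E mulVKf.
  rewrite pi_b.
  have i := integrable_affine 0 bn icos.
  rewrite -RintegralZl//; apply: eq_Rintegral => t _.
  rewrite addr0 /g_kernel bt div1r (invfM beta).
  have -> : nu / b * (b * t) = nu * t by rewrite mulrA divfK.
  by ring.
have -> : chat nu = (2 * pi)^-1 * \int[mu]_t (sin (nu / b * t) / sinhR t).
  have := Rintegral_affine 0 bn (@integrable_sin_div_sinhR R (nu / b)).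
  rewrite gtr0_norm// => E.
  have -> : \int[mu]_t (sin (nu / b * t) / sinhR t) = b * \int[mu]_t
    (sin (nu / b * (b * t + 0)) / sinhR (b * t + 0)) by rewrite E mulVKf.
  rewrite pi_b.
  rewrite -RintegralZl//; apply: eq_Rintegral => t _.
  by rewrite addr0 c_kernelE.
have -> : beta * nu / 4 = nu / b * (pi / 2).
  have -> : pi / 2 = b * (beta / 4) by rewrite mulrA (mulrC b) beta_b; field.
  by rewrite (mulrA _ b) divfK//; ring.
by rewrite mulrCA sech_csch_fourier mulrDr invfM -(mulrA 2^-1) mulVf// mulr1.
Qed.

Lemma expRN_ghat (nu : R) : expR (- (beta * nu / 4)) * ghat nu = 2^-1 - chat nu.
Proof. by rewrite -chatN -expR_ghat ghatN mulrN mulNr. Qed.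

Lemma ghat0 : ghat 0 = 2^-1.
Proof.
have := expR_ghat 0; rewrite mulr0 mul0r expR0 mul1r => ->.
have : chat 0 = 0 by have := chatN 0; rewrite oppr0; lra.
by move=> ->; rewrite addr0.
Qed.

(** The zero of the sine cancels the pole of [c_kernel], so this part of the principal value is an
    ordinary integral; the cosine part is odd and vanishes. *)
Lemma pv_c_sin (nu : R) :
  pv_dom (fun t => c_kernel beta t * sin (nu * t)) /\
  pvint (fun t => c_kernel beta t * sin (nu * t)) = chat nu.
Proof.
apply: (@pvint_integrable R _ (beta^-1 * (`|nu / b| * expR 1 + 4))).
  exact: integrable_c_sin.
move=> t; rewrite c_kernelE normrM ger0_norm ?invr_ge0 ?(ltW beta0)//.
rewrite ler_wpM2l ?invr_ge0 ?(ltW beta0)//.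
apply: (le_trans (sin_div_sinhR_le _ _)); rewrite -[X in _ <= X]mulr1.
by rewrite ler_wpM2l ?addr_ge0 ?mulr_ge0 ?expR_ge0// -expR0 ler_expR oppr_le0.
Qed.

Lemma pv_c_cos (nu : R) :
  pv_dom (fun t => c_kernel beta t * cos (nu * t)) /\
  pvint (fun t => c_kernel beta t * cos (nu * t)) = 0.
Proof.
apply: (@pvint_odd R _ (fun t => expR (- `|b * t + 0|))).
- apply: measurable_funM; last first.
    apply: measurableT_comp; last exact: measurable_funM.
    exact: continuous_measurable_fun (@continuous_cos R).
  apply: measurable_funM => //; apply: measurable_funV; apply: measurable_funM => //.
  apply: measurableT_comp.
    exact: continuous_measurable_fun continuous_sinhR.
  by apply: measurable_funM => //; exact: measurable_funM.
(* Where [|b t| < 1], the bound [|sinh x| >= |x|] gives the constant [1 / (b e)]; elsewhere the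
   exponential decay gives 4. *)
- move=> e e0; exists (beta^-1 * (4 + (b * e)^-1 * expR 1)) => t et.
  rewrite addr0 /c_kernel bt div1r (invfM beta) normrM.
  apply: (@le_trans _ _ `|beta^-1 / sinhR (b * t)|).
    by rewrite ler_piMr// cos_max.
  have bV0 : 0 <= beta^-1 by rewrite invr_ge0 ltW.
  rewrite normrM (ger0_norm bV0) -(mulrA beta^-1) ler_wpM2l// normfV.
  have be : b * e < `|b * t| by rewrite normrM (gtr0_norm b0) ltr_pM2l.
  have be0 : 0 < b * e by rewrite mulr_gt0.
  have E0 := expR_ge0 (- `|b * t|).
  rewrite mulrDl; have [t1|t1] := leP 1 `|b * t|.
    by apply: (le_trans (sinhRV_le t1)); rewrite lerDl !mulr_ge0 ?expR_ge0// invr_ge0 ltW.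
  apply: (@le_trans _ _ ((b * e)^-1 * expR 1 * expR (- `|b * t|))); last first.
    by rewrite lerDr mulr_ge0.
  rewrite -mulrA -expRD -[X in X <= _]mulr1; apply: ler_pM => //.
    have h := lt_le_trans be (norm_le_sinhR (b * t)).
    by rewrite lef_pV2 ?posrE// ?ltW// (lt_trans be0).
  by rewrite -[X in X <= _]expR0 ler_expR subr_ge0 ltW.
- by move=> t; exact: expR_ge0.
- exact: (integrable_affine 0 (negbT (gt_eqF b0)) (@integrable_expR_norm R)).
- by move=> t; rewrite c_kernelN mulrN cosN mulNr.
Qed.

End bath.
End kernels.

(** * The Gaussian filter and the transition rates *)

Section gaussian_filter.
Context {R : realType}.
Notation mu := (@lebesgue_measure R).
Variable kappa : R.
Hypothesis kappa0 : 0 < kappa.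

Let kn : kappa != 0. Proof. by rewrite gt_eqF. Qed.

(** The unitary Fourier transform of [gauss_filter]; its square is the normal density of standard
    deviation [kappa]. *)
Definition fhat (w : R) :=
  Num.sqrt (normal_peak kappa) * expR (- (w ^+ 2 / (4 * kappa ^+ 2))).

Lemma fhatN (w : R) : fhat (- w) = fhat w.
Proof. by rewrite /fhat sqrrN. Qed.

Let s := (kappa * Num.sqrt 2)^-1.

Let s0 : 0 < s.
Proof. by rewrite invr_gt0 mulr_gt0// sqrtr_gt0. Qed.

Let gauss_const : Num.sqrt (kappa * Num.sqrt (2 / pi)) / normal_peak s =
  Num.sqrt (2 * pi) * Num.sqrt (normal_peak kappa).
Proof.
have p0 : 0 < pi :> R := pi_gt0 R.
have sp : 0 < Num.sqrt (pi : R) by rewrite sqrtr_gt0.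
have s2 : 0 < Num.sqrt (2 : R) by rewrite sqrtr_gt0.
have e1 : Num.sqrt (2 / pi) = Num.sqrt 2 / Num.sqrt pi :> R.
  by rewrite sqrtrM// sqrtrV// ltW.
have e2 : Num.sqrt (2 * pi) = Num.sqrt 2 * Num.sqrt pi :> R by rewrite sqrtrM.
have sq2 : Num.sqrt 2 ^+ 2 = 2 :> R by rewrite sqr_sqrtr.
have peak x : 0 < x -> normal_peak x = (x * Num.sqrt 2 * Num.sqrt pi)^-1 :> R.
  move=> x0; rewrite /normal_peak -mulr_natr sqrtrM; last first.
    by rewrite mulr_ge0 ?sqr_ge0// ltW.
  rewrite sqrtrM ?sqr_ge0// sqrtr_sqr gtr0_norm//; congr (_^-1); ring.
have ps : normal_peak s = kappa / Num.sqrt pi.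
  by rewrite peak// /s; field; rewrite !gt_eqF// mulr_gt0.
rewrite ps peak// e1 e2 -[LHS]gtr0_norm; last first.
  by rewrite divr_gt0// ?divr_gt0// sqrtr_gt0 mulr_gt0// divr_gt0.
rewrite -[RHS]gtr0_norm; last first.
  by rewrite mulr_gt0 ?mulr_gt0// sqrtr_gt0 invr_gt0 !mulr_gt0.
rewrite -!sqrtr_sqr; congr Num.sqrt.
have X0 : 0 <= kappa * (Num.sqrt 2 / Num.sqrt pi).
  by rewrite mulr_ge0 ?(ltW kappa0)// ltW// divr_gt0.
have Y0 : 0 <= (kappa * Num.sqrt 2 * Num.sqrt pi)^-1.
  by rewrite invr_ge0 ltW// !mulr_gt0.
rewrite [LHS]expr_div_n [RHS]exprMn (sqr_sqrtr X0) (sqr_sqrtr Y0).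
move: (Num.sqrt (pi : R)) sp {X0 Y0 e1 e2 peak ps} => p pp.
move: (Num.sqrt (2 : R)) s2 sq2 => r rp r2.
by field; rewrite kn !gt_eqF.
Qed.

Lemma gauss_filterE (t : R) : gauss_filter kappa t =
  Num.sqrt (2 * pi) * Num.sqrt (normal_peak kappa) * normal_pdf 0 s t.
Proof.
have sn : s != 0 by rewrite gt_eqF.
have pn : normal_peak s != 0 by rewrite gt_eqF// normal_peak_gt0.
rewrite -gauss_const normal_pdfE// -[RHS]/(_ / normal_peak s *
  (normal_peak s * normal_fun 0 s t)) [RHS]mulrA divfK//.
rewrite /gauss_filter mulrC; congr (_ * _).
rewrite /normal_fun subr0; congr expR.
have -> : s ^+ 2 *+ 2 = (kappa ^+ 2)^-1.
  rewrite /s exprVn exprMn sqr_sqrtr// -mulr_natr invfM -mulrA mulVf ?mulr1//.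
by rewrite invrK mulrC mulNr mulrC.
Qed.

Lemma integrable_filter_cos (w : R) :
  rintegrable (fun t => gauss_filter kappa t * cos (w * t)).
Proof.
have := rintegrableZl (Num.sqrt (2 * pi) * Num.sqrt (normal_peak kappa))
  (integrable_normal_cos w s0).
rewrite (_ : (fun t => _) = (fun t => gauss_filter kappa t * cos (w * t)))//.
by apply/funext => t; rewrite gauss_filterE mulrA.
Qed.

Lemma integral_filter_cos (w : R) :
  \int[mu]_t (gauss_filter kappa t * cos (w * t)) = Num.sqrt (2 * pi) * fhat w.
Proof.
rewrite (_ : fhat w = Num.sqrt (normal_peak kappa) *
    \int[mu]_t (normal_pdf 0 s t * cos (w * t))).
  rewrite mulrA -RintegralZl//; last exact: integrable_normal_cos.
  by apply: eq_Rintegral => t _; rewrite gauss_filterE mulrA.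
rewrite integral_normal_cos// /fhat; congr (_ * expR _).
rewrite /s exprMn exprVn exprMn sqr_sqrtr//; field.
exact: kn.
Qed.

Lemma integrable_filter_sin (w : R) :
  rintegrable (fun t => gauss_filter kappa t * sin (w * t)).
Proof.
have iN : rintegrable (fun t => gauss_filter kappa t).
  have := integrable_filter_cos 0.
  rewrite (_ : (fun t => _) = (fun t => gauss_filter kappa t))//.
  by apply/funext => t; rewrite mul0r cos0 mulr1.
have g0 t : 0 <= gauss_filter kappa t by rewrite mulr_ge0 ?expR_ge0.
apply: (le_rintegrable _ iN).
  apply: measurable_funM.
    by have /integrableP[/measurable_EFinP] := iN.
  apply: measurableT_comp; last exact: measurable_funM.
  exact: continuous_measurable_fun (@continuous_sin R).
by move=> t; rewrite normrM (ger0_norm (g0 t)) ler_piMr// sin_max.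
Qed.

Lemma integral_filter_sin (w : R) :
  \int[mu]_t (gauss_filter kappa t * sin (w * t)) = 0.
Proof.
apply: Rintegral_odd; first exact: integrable_filter_sin.
by move=> t; rewrite /gauss_filter sqrrN mulrN sinN mulrN.
Qed.

Lemma fhat_prod (a b w : R) : fhat (w - a) * fhat (w - b) =
  expR (- ((a - b) ^+ 2 / (8 * kappa ^+ 2))) * normal_pdf ((a + b) / 2) kappa w.
Proof.
rewrite normal_pdfE// /fhat mulrACA -expr2 sqr_sqrtr ?normal_peak_ge0//.
rewrite [RHS]mulrCA; congr (_ * _); rewrite /normal_fun -!expRD; congr expR.
by rewrite -mulr_natr; field; rewrite kn.
Qed.

Lemma integrable_fhat_prod (omega : R -> R) (a b : R) :
  measurable_fun setT omega -> (forall w, 0 <= omega w <= 1) ->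
  rintegrable (fun w => omega w * (fhat (w - a) * fhat (w - b))).
Proof.
move=> mo o1.
set m := (a + b) / 2; set C := expR (- ((a - b) ^+ 2 / (8 * kappa ^+ 2))).
have i : rintegrable (fun w => C * normal_pdf m kappa w).
  exact/rintegrableZl/integrable_normal_pdf.
rewrite (_ : (fun w => _) = (fun w => omega w * (C * normal_pdf m kappa w))).
  apply: (le_rintegrable _ i).
    by apply: measurable_funM => //; apply: measurable_funM => //;
      exact: measurable_normal_pdf.
  move=> w; have /andP[w0 w1] := o1 w.
  have p0 : 0 <= C * normal_pdf m kappa w.
    by rewrite mulr_ge0 ?expR_ge0// normal_pdf_ge0.
  by rewrite normrM (ger0_norm w0) (ger0_norm p0) ler_piMl.
by apply/funext => w; rewrite fhat_prod.
Qed.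

(* Parseval: the overlap of two filters is the Fourier transform of the squared
   time-domain filter. *)
Lemma fhat_overlap (a b : R) : \int[mu]_w (1 * (fhat (w - a) * fhat (w - b))) =
  \int[mu]_t (normal_pdf 0 (2 * kappa)^-1 t * cos ((a - b) * t)).
Proof.
rewrite integral_normal_cos ?invr_gt0 ?mulr_gt0//.
under eq_Rintegral do rewrite mul1r fhat_prod.
rewrite RintegralZl//; last exact: integrable_normal_pdf.
rewrite (_ : \int[mu]_w _ = 1).
  by rewrite mulr1 exprMn exprVn; congr expR; field; rewrite kn.
by rewrite /Rintegral integral_normal_pdf.
Qed.

Section rate.
Variable beta : R.
Hypothesis beta0 : 0 < beta.
Let delta := beta * kappa ^+ 2 / 2.
Let boost := expR (beta ^+ 2 * kappa ^+ 2 / 16).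

Lemma gamma_rate_bound (w : R) : 0 <= gamma_rate beta kappa w <= 1.
Proof.
rewrite expR_ge0/= -expR0 ler_expR oppr_le0 mulr_ge0 ?(ltW beta0)//.
by rewrite le_max lexx orbT.
Qed.

Lemma gamma_rate_mono (v w : R) : v <= w ->
  gamma_rate beta kappa w <= gamma_rate beta kappa v.
Proof.
move=> vw; rewrite ler_expR lerN2 ler_pM2l// le_max2 ?lerD2r//.
Qed.

Lemma measurable_gamma_rate : measurable_fun setT (gamma_rate beta kappa).
Proof.
apply: measurableT_comp => //; apply: measurableT_comp => //.
apply: measurable_funM => //; apply: measurable_maxr => //.
exact: measurable_funD.
Qed.

(** Completing the square: the weight linear in [a] moves the centre by [delta] and leaves a scalar
    free of [a], hence common to all entries of a jump operator. *)
Lemma fhat_boost (a w : R) : expR (beta * a / 4) * fhat (w - a) =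
  expR (beta * w / 4) * boost * fhat (w + delta - a).
Proof.
rewrite /fhat /boost /delta [LHS]mulrCA [RHS]mulrCA -!expRD; congr (_ * expR _).
by field; rewrite kn.
Qed.

Lemma fhat_unboost (a w : R) : expR (- (beta * a / 4)) * fhat (w - a) =
  expR (- (beta * w / 4)) * boost * fhat (w - delta - a).
Proof.
rewrite /fhat /boost /delta [LHS]mulrCA [RHS]mulrCA -!expRD; congr (_ * expR _).
by field; rewrite kn.
Qed.

Definition rate_overlap (a b : R) :=
  \int[mu]_w (gamma_rate beta kappa w * (fhat (w - a) * fhat (w - b))).

Lemma integrable_rate_overlap (a b : R) :
  rintegrable (fun w => gamma_rate beta kappa w * (fhat (w - a) * fhat (w - b))).
Proof.
apply: integrable_fhat_prod; first exact: measurable_gamma_rate.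
exact: gamma_rate_bound.
Qed.

Let damped (m u : R) := expR (- (beta * `|u| / 2)) * normal_pdf m kappa u.

Let integrable_damped m : rintegrable (damped m).
Proof.
apply: (le_rintegrable _ (integrable_normal_pdf m kappa)).
  apply: measurable_funM; last exact: measurable_normal_pdf.
  apply: measurableT_comp => //; apply: measurableT_comp => //.
  apply: measurable_funM => //; apply: measurable_funM => //.
move=> u; rewrite normrM (ger0_norm (expR_ge0 _)).
rewrite (ger0_norm (normal_pdf_ge0 _ _ _)) ler_piMl ?normal_pdf_ge0//.
by rewrite -expR0 ler_expR oppr_le0 divr_ge0// mulr_ge0// ltW.
Qed.

(** The exact shape of [gamma_rate] enters here. With [u = w + delta] one has
    [max (u, 0) = (u + |u|) / 2]; the linear half of the exponent, combined with
    [expR (beta * (a + b) / 4)], recentres the Gaussian in [u]. What remains depends on [a - b] and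
    on an integral that reflection shows to be even in [a + b]. *)
Let rate_overlap_damped (a b : R) :
  expR (beta * (a + b) / 4) * rate_overlap a b =
  expR (- ((a - b) ^+ 2 / (8 * kappa ^+ 2))) *
  expR (- (beta ^+ 2 * kappa ^+ 2 / 8)) * \int[mu]_u damped ((a + b) / 2) u.
Proof.
rewrite -(Rintegral_shift delta (integrable_damped _)).
rewrite -!RintegralZl//; last 2 first.
- exact: integrable_rate_overlap.
- exact/integrable_shift/integrable_damped.
apply: eq_Rintegral => w _; rewrite fhat_prod /damped !normal_pdfE//.
rewrite /gamma_rate -/delta /normal_fun.
set m := (a + b) / 2.
have -> : beta * (a + b) / 4 = beta * m / 2 by rewrite /m; field.
have -> : Num.max (w + delta) 0 = (w + delta + `|w + delta|) / 2.
  have [h|h] := leP 0 (w + delta).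
    by rewrite ger0_norm//; field.
  by rewrite ltr0_norm// subrr mul0r.
have E : expR (beta * m / 2) *
   (expR (- (beta * ((w + delta + `|w + delta|) / 2))) *
    expR (- (w - m) ^+ 2 / (kappa ^+ 2 *+ 2))) =
   expR (- (beta ^+ 2 * kappa ^+ 2 / 8)) * (expR (- (beta * `|w + delta| / 2)) *
     expR (- (w + delta - m) ^+ 2 / (kappa ^+ 2 *+ 2))).
  rewrite -!expRD; congr expR; rewrite -mulr_natr /delta.
  move: (`|_|) => x; field; exact: kn.
move: E; set e1 := expR (beta * m / 2); set e2 := expR (- (beta * _)).
set e3 := expR (- (w - m) ^+ 2 / _); set e4 := expR (- (beta ^+ 2 * _ / _)).
set e5 := expR (- (beta * _ / 2)); set e6 := expR (- (w + delta - m) ^+ 2 / _).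
move=> E; set c := expR _; set p := normal_peak _.
transitivity (c * p * (e1 * (e2 * e3))); first by ring.
by rewrite E; ring.
Qed.

Let integral_dampedN (m : R) :
  \int[mu]_u damped (- m) u = \int[mu]_u damped m u.
Proof.
rewrite -(Rintegral_opp (integrable_damped m)); apply: eq_Rintegral => u _.
rewrite /damped normrN; congr (_ * _); rewrite !normal_pdfE// /normal_fun.
have -> : (u - - m) ^+ 2 = (- u - m) ^+ 2 by rewrite -sqrrN; congr (_ ^+ 2); ring.
by [].
Qed.

(* KMS symmetry of the transition rates. *)
Lemma rate_overlap_sym (a b : R) :
  expR (beta * (a + b) / 4) * rate_overlap a b =
  expR (- (beta * (a + b) / 4)) * rate_overlap (- b) (- a).
Proof.
have e0 : - (beta * (a + b) / 4) = beta * (- b + - a) / 4 by ring.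
have e1 : (- b + - a) / 2 = - ((a + b) / 2) by ring.
have e2 : - b - - a = a - b by ring.
rewrite e0 (rate_overlap_damped a b) (rate_overlap_damped (- b) (- a)) e1 e2.
by rewrite integral_dampedN.
Qed.

End rate.
End gaussian_filter.

(** * Functional calculus, Gibbs state and trace norm duality *)

Section complex_parts.
Context {R : realType}.
Notation C := R[i].

Lemma ReD (z w : C) : complex.Re (z + w) = complex.Re z + complex.Re w.
Proof. by case: z; case: w. Qed.

Lemma ReM_real (a : R) (z : C) : complex.Re (a%:C * z) = a * complex.Re z.
Proof. by case: z => x y /=; rewrite mul0r subr0. Qed.

Lemma Re_conj (z : C) : complex.Re (z^*) = complex.Re z.
Proof. by case: z. Qed.

Lemma Re_le (z w : C) : z <= w -> complex.Re z <= complex.Re w.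
Proof. by rewrite lecE => /andP[]. Qed.

Lemma realC_conj (x : R) : (x%:C : C)^* = x%:C.
Proof. by apply/eqP; rewrite eq_complex /= oppr0 !eqxx. Qed.

Lemma realCM (x y : R) : (x * y)%:C = x%:C * y%:C :> C.
Proof. by rewrite rmorphM. Qed.

Definition nrm2 m n (X : 'M[C]_(m, n)) : R := complex.Re (nrmC X).

Lemma nrm2_ge0 m n (X : 'M[C]_(m, n)) : 0 <= nrm2 X.
Proof. exact: (Re_le (nrmC_ge0 X)). Qed.

Lemma nrmC_nrm2 m n (X : 'M[C]_(m, n)) : nrmC X = (nrm2 X)%:C.
Proof.
have := nrmC_ge0 X; rewrite /nrm2 lecE; case: (nrmC X) => x y /= /andP[/eqP -> _].
by [].
Qed.

Lemma hsnorm_sqr m n (X : 'M[C]_(m, n)) : hsnorm X ^+ 2 = nrm2 X.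
Proof. by rewrite sqr_sqrtr// nrm2_ge0. Qed.

Lemma nrm2_amgm m n (X Y : 'M[C]_(m, n)) (l : R) : 0 < l ->
  complex.Re (\tr (X^t* *m Y)) <= (l * nrm2 X + l^-1 * nrm2 Y) / 2.
Proof.
move=> l0; have l0' : 0 < l%:C :> C by rewrite ltcR.
rewrite /nrm2; move: (nrmC X) (nrmC Y) (\tr _) (nrmC_amgm X Y l0') => a b z.
by move=> /Re_le; rewrite !ReD Re_conj -fmorphV !ReM_real; lra.
Qed.

Lemma nrm2_contraction n m (W : 'M[C]_n) (Y : 'M[C]_(n, m)) : contraction W ->
  nrm2 (W *m Y) <= nrm2 Y.
Proof. by move=> cW; exact: (Re_le (cW _ Y)). Qed.

Definition energies n (H : 'M[C]_n) (i : 'I_n) : R :=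
  complex.Re (spectral_diag H 0 i).

Lemma fun_hermE n (f : R -> C) (H : 'M[C]_n) :
  fun_herm f H = sandwich (spectralmx H) (fun i => f (energies H i)).
Proof.
rewrite /fun_herm invmx_unitary; last exact: spectral_unitarymx.
rewrite /sandwich; set D1 := map_mx (fun z => f (complex.Re z)) _; set D2 := \row_i _.
suff -> : D1 = D2 by [].
by apply/rowP => i; rewrite !mxE.
Qed.

Lemma hermitian_spectral n (H : 'M[C]_n) : H \is hermsymmx ->
  sandwich (spectralmx H) (fun i => (energies H i)%:C) = H.
Proof.
move=> hH; have /orthomx_spectralP := hermitian_normalmx hH.
have /mxOverP real := hermitian_spectral_diag_real hH.
move=> e; rewrite [RHS]e invmx_unitary; last exact: spectral_unitarymx.
rewrite /sandwich; suff -> : \row_i (energies H i)%:C = spectral_diag H by [].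
apply/rowP => i; rewrite !mxE /energies.
have := real 0 i; rewrite realE !lecE; case: (spectral_diag H 0 i) => x y /=.
by case/orP => /andP[/eqP h _]; rewrite ?h // -h.
Qed.

Lemma fun_herm_sandwich n (f : R -> C) (U : 'M[C]_n) (x : 'I_n -> R) :
  U \is unitarymx ->
  fun_herm f (sandwich U (fun i => (x i)%:C)) = sandwich U (fun i => f (x i)).
Proof.
move=> uU; set B := sandwich U _.
have hB : B \is hermsymmx.
  by apply/hermsym_adj; rewrite /B sandwich_adj// => i; exact: realC_conj.
rewrite fun_hermE.
apply: (sandwich_inj (spectral_unitarymx B) uU (hermitian_spectral hB)).
by move=> i j [->].
Qed.

Lemma fun_herm_adj n (f : R -> R) (H : 'M[C]_n) :
  (fun_herm (fun x => (f x)%:C) H)^t* = fun_herm (fun x => (f x)%:C) H.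
Proof. by rewrite fun_hermE sandwich_adj// => i; exact: realC_conj. Qed.

Lemma psd_energies_ge0 n (B : 'M[C]_n) : psdmx B -> forall i, 0 <= energies B i.
Proof.
move=> [hB pB] i; have := pB ((spectralmx B)^t* *m (delta_mx i 0)).
rewrite -{2}(hermitian_spectral hB) sandwich_quad; last exact: spectral_unitarymx.
by rewrite mxE eqxx mulr1n lecR.
Qed.

Lemma sqrtmx_sqr n (B : 'M[C]_n) : psdmx B -> sqrtmx B *m sqrtmx B = B.
Proof.
move=> pB; rewrite /sqrtmx fun_hermE sandwichM; last exact: spectral_unitarymx.
rewrite -[RHS](hermitian_spectral pB.1); apply: eq_sandwich => i.
by rewrite -realCM -expr2 sqr_sqrtr// psd_energies_ge0.
Qed.

Lemma psd_gram n (X : 'M[C]_n) : psdmx (X^t* *m X).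
Proof.
split; last exact: gram_quad.
by apply/hermsym_adj; rewrite adjM trmxCK.
Qed.

(** [W] is the partial isometry in the polar decomposition of [X]. The function [g] is the inverse
    square root extended by 0 to the kernel, so that [g k g <= 1] and [g k = sqrt k] hold for zero
    eigenvalues too. *)
Lemma trnorm_dual n (X : 'M[C]_n) : exists2 W : 'M[C]_n, contraction W &
  trnorm X = complex.Re (\tr (W^t* *m X)).
Proof.
have pK := psd_gram X.
have u := spectral_unitarymx (X^t* *m X).
have KE := hermitian_spectral pK.1.
have k0 := psd_energies_ge0 pK.
rewrite /trnorm /sqrtmx fun_hermE.
move: (spectralmx _) (energies _) u KE k0 => P k u KE k0 {pK}.
pose g (x : R) := if 0 < x then (Num.sqrt x)^-1 else 0.
have gr i : ((g (k i))%:C : C)^* = (g (k i))%:C by exact: realC_conj.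
exists (X *m sandwich P (fun i => (g (k i))%:C)).
  apply: (contraction_sandwich u (esym KE) gr) => i.
  rewrite -!realCM lecR /g; case: ifP => ki; last by rewrite !mul0r.
  have s0 : Num.sqrt (k i) != 0 by rewrite gt_eqF// sqrtr_gt0.
  have e := sqr_sqrtr (k0 i); move: (Num.sqrt (k i)) s0 e => s s0 <-.
  by rewrite expr2 mulKf// mulfV.
rewrite (mxtrace_dual u (esym KE) gr) sandwich_tr//; congr complex.Re.
apply: eq_bigr => i _.
rewrite -realCM /g; congr (_%:C); case: ifP => ki.
  have s0 : Num.sqrt (k i) != 0 by rewrite gt_eqF// sqrtr_gt0.
  have e := sqr_sqrtr (k0 i); move: (Num.sqrt (k i)) s0 e => s s0 <-.
  by rewrite expr2 mulKf.
by rewrite mul0r ler0_sqrtr// leNgt ki.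
Qed.

Lemma to_basis_evol n (H : 'M[C]_n) t X :
  to_basis (spectralmx H) (evol H t *m X *m evol H (- t)) =
  \matrix_(i, j) (cis ((energies H i - energies H j) * t) *
    to_basis (spectralmx H) X i j).
Proof.
rewrite /evol !fun_hermE to_basis_sandwich; last exact: spectral_unitarymx.
apply/matrixP => i j; rewrite !mxE; congr (_ * _).
apply/eqP; rewrite eq_complex /= !mulrN sinN cosN mulrBl sinB cosB.
by apply/andP; split; apply/eqP; ring.
Qed.

Lemma gibbsE n (beta : R) (H : 'M[C]_n) : gibbs beta H =
  sandwich (spectralmx H) (fun i => (expR (- beta * energies H i) /
    \sum_k expR (- beta * energies H k))%:C).
Proof.
rewrite /gibbs fun_hermE sandwichZ sandwich_tr; last exact: spectral_unitarymx.
apply: eq_sandwich => i; rewrite -rmorph_sum -fmorphV -realCM.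
by congr (_%:C); rewrite mulrC.
Qed.

(** The partition function cancels between the powers [- 1/2] and [1/2], leaving a function of the
    Bohr frequency. *)
Lemma to_basis_gibbs n (beta : R) (H : 'M[C]_n) X : 0 < beta ->
  to_basis (spectralmx H) (powmx (gibbs beta H) (- 2^-1) *m X *m
    powmx (gibbs beta H) 2^-1) =
  \matrix_(i, j) ((expR (beta * (energies H i - energies H j) / 2))%:C *
    to_basis (spectralmx H) X i j).
Proof.
move=> b0; have uV := spectral_unitarymx H.
rewrite gibbsE /powmx !fun_herm_sandwich// to_basis_sandwich//.
apply/matrixP => i j; rewrite !mxE -realCM; congr (_%:C * _).
set Z := \sum_k _.
have Z0 : 0 < Z.
  by rewrite /Z (bigD1 i)//= ltr_pwDl ?expR_gt0// sumr_ge0.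
have p k q : (expR (- beta * energies H k) / Z) `^ q =
    expR (q * (- beta * energies H k - ln Z)).
  rewrite -{1}(lnK Z0) -expRN -expRD.
  by rewrite -(expRK (_ * _)) /powR gt_eqF ?expR_gt0// !expRK.
by rewrite !p -expRD; congr expR; field.
Qed.

End complex_parts.

(** * Frobenius norm and operator norm *)

Section frobenius.
Context {R : realType}.
Notation C := R[i].

Lemma Re_sum (I : Type) (s : seq I) (P : pred I) (F : I -> C) :
  complex.Re (\sum_(i <- s | P i) F i) = \sum_(i <- s | P i) complex.Re (F i).
Proof. by apply: (big_morph _ ReD). Qed.

Definition sqn (z : C) : R := complex.Re z ^+ 2 + complex.Im z ^+ 2.

Lemma sqn_ge0 z : 0 <= sqn z.
Proof. by rewrite addr_ge0 ?sqr_ge0. Qed.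

Lemma sqnE z : complex.Re (z^* * z) = sqn z.
Proof. by case: z => x y; rewrite /sqn /=; ring. Qed.

Lemma nrm2E m n (X : 'M[C]_(m, n)) : nrm2 X = \sum_j \sum_i sqn (X i j).
Proof.
rewrite /nrm2 nrmCE Re_sum; apply: eq_bigr => j _.
by rewrite Re_sum; apply: eq_bigr => i _; rewrite sqnE.
Qed.

Lemma nrm2_col m n p (A : 'M[C]_(m, n)) (Y : 'M[C]_(n, p)) :
  nrm2 (A *m Y) = \sum_j nrm2 (A *m col j Y).
Proof.
rewrite nrm2E; apply: eq_bigr => j _; rewrite nrm2E big_ord1.
apply: eq_bigr => i _; congr sqn; rewrite !mxE.
by apply: eq_bigr => k _; rewrite mxE.
Qed.

(** Only finiteness matters: a supremum dominates its set once the set is bounded above. The factor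
    4 and the added units in [B] are slack for a termwise estimate. *)
Lemma opnorm_has_ubound n (A : 'M[C]_n) :
  has_ubound [set hsnorm (A *m v) | v in [set v : 'cV[C]_n | hsnorm v = 1]].
Proof.
pose B := \sum_i \sum_k \sum_l 4 * (1 + sqn (A i k)) * (1 + sqn (A i l)).
exists (1 + B) => _ [v /= v1 <-].
have v2 k : sqn (v k ord0) <= 1.
  have : nrm2 v = 1 by rewrite -hsnorm_sqr v1 expr1n.
  rewrite nrm2E big_ord1 => <-; rewrite (bigD1 k)//= lerDl.
  by apply: sumr_ge0 => i _; exact: sqn_ge0.
have h : nrm2 (A *m v) <= B.
  rewrite nrm2E big_ord1; apply: ler_sum => i _.
  rewrite -sqnE mxE rmorph_sum big_distrlr /= Re_sum.
  apply: ler_sum => k _; rewrite Re_sum; apply: ler_sum => l _.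
  have := v2 k; have := v2 l; rewrite /sqn.
  case: (A i k) => a1 a2; case: (A i l) => b1 b2.
  case: (v k ord0) => c1 c2; case: (v l ord0) => d1 d2 /=.
  set x := a1 * c1 - a2 * c2; set y := a1 * c2 + a2 * c1.
  set z := b1 * d1 - b2 * d2; set t := b1 * d2 + b2 * d1.
  move=> hd hc.
  have hx : x ^+ 2 + y ^+ 2 <= a1 ^+ 2 + a2 ^+ 2.
    have -> : x ^+ 2 + y ^+ 2 = (a1 ^+ 2 + a2 ^+ 2) * (c1 ^+ 2 + c2 ^+ 2).
      by rewrite /x /y; ring.
    by rewrite ler_piMr// addr_ge0 ?sqr_ge0.
  have hz : z ^+ 2 + t ^+ 2 <= b1 ^+ 2 + b2 ^+ 2.
    have -> : z ^+ 2 + t ^+ 2 = (b1 ^+ 2 + b2 ^+ 2) * (d1 ^+ 2 + d2 ^+ 2).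
      by rewrite /z /t; ring.
    by rewrite ler_piMr// addr_ge0 ?sqr_ge0.
  have : x * z + y * t <= (x ^+ 2 + y ^+ 2 + (z ^+ 2 + t ^+ 2)) / 2.
    have := sqr_ge0 (x - z); have := sqr_ge0 (y - t); rewrite !sqrrB; lra.
  have : 0 <= (a1 ^+ 2 + a2 ^+ 2) * (b1 ^+ 2 + b2 ^+ 2).
    by rewrite mulr_ge0// addr_ge0 ?sqr_ge0.
  have : 0 <= a1 ^+ 2 + a2 ^+ 2 by rewrite addr_ge0 ?sqr_ge0.
  have : 0 <= b1 ^+ 2 + b2 ^+ 2 by rewrite addr_ge0 ?sqr_ge0.
  nra.
have B0 : 0 <= B := le_trans (nrm2_ge0 _) h.
rewrite -(@ler_pXn2r _ 2)// ?nnegrE ?sqrtr_ge0 ?addr_ge0// hsnorm_sqr.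
by apply: (le_trans h); nra.
Qed.

(** The supremum in [opnorm] runs over unit vectors, so the columns are treated one at a time and
    normalised. *)
Lemma nrm2_opnorm n m (A : 'M[C]_n) (Y : 'M[C]_(n, m)) :
  nrm2 (A *m Y) <= opnorm A ^+ 2 * nrm2 Y.
Proof.
rewrite nrm2_col -[Y in X in _ <= X]mul1mx nrm2_col mulr_sumr.
apply: ler_sum => j _; rewrite mul1mx; move: (col j Y) => {Y j} v.
have [v0|v0] := eqVneq (nrm2 v) 0.
  have -> : v = 0.
    apply/matrixP => i j; rewrite mxE; apply/eqP.
    have : sqn (v i j) = 0.
      move: v0; rewrite nrm2E => /eqP; rewrite psumr_eq0; last first.
        by move=> k _; apply: sumr_ge0 => l _; exact: sqn_ge0.
      move=> /allP/(_ j); rewrite mem_index_enum => /(_ isT).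
      rewrite psumr_eq0; last by move=> l _; exact: sqn_ge0.
      by move=> /allP/(_ i); rewrite mem_index_enum => /(_ isT)/eqP.
    case: (v i j) => a b /eqP; rewrite /sqn paddr_eq0 ?sqr_ge0// !sqrf_eq0 /=.
    by rewrite eq_complex.
  by rewrite mulmx0 /nrm2 /nrmC !mulmx0 mxtrace0 /= mulr0.
have v_gt0 : 0 < nrm2 v by rewrite lt_neqAle eq_sym v0 nrm2_ge0.
set r := Num.sqrt (nrm2 v).
have r0 : 0 < r by rewrite sqrtr_gt0.
have r2 : r ^+ 2 = nrm2 v by rewrite sqr_sqrtr// ltW.
have sc (a : R) (w : 'cV[C]_n) : nrm2 (a%:C *: w) = a ^+ 2 * nrm2 w.
  rewrite !nrm2E mulr_sumr; apply: eq_bigr => j _; rewrite mulr_sumr.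
  apply: eq_bigr => i _; rewrite mxE /sqn; case: (w i j) => x y /=; ring.
pose u := (r^-1)%:C *: v.
have u1 : hsnorm u = 1.
  by rewrite /hsnorm -/(nrm2 u) sc exprVn r2 mulVf// sqrtr1.
have vE : v = r%:C *: u.
  by rewrite /u scalerA -rmorphM /= mulfV ?gt_eqF// scale1r.
have : hsnorm (A *m u) <= opnorm A.
  by apply: ub_le_sup; [exact: opnorm_has_ubound|exists u].
move=> h; rewrite {1}vE -scalemxAr sc r2 mulrC ler_wpM2r ?(ltW v_gt0)//.
rewrite -hsnorm_sqr ler_pXn2r// nnegrE ?sqrtr_ge0//.
by apply: le_trans h; rewrite sqrtr_ge0.
Qed.

Lemma opnorm_ge0 n (A : 'M[C]_n) : 0 <= opnorm A.
Proof.
have [[x Sx]|S0] := pselect (exists x,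
    [set hsnorm (A *m v) | v in [set v : 'cV[C]_n | hsnorm v = 1]] x).
  apply: (@le_trans _ _ x); first by case: Sx => v _ <-; exact: sqrtr_ge0.
  by apply: ub_le_sup => //; exact: opnorm_has_ubound.
(* In the absence of unit vectors the supremum takes its default value 0. *)
rewrite /opnorm (_ : [set _ | _ in _] = set0) ?sup0//.
by apply/seteqP; split => // x Sx; apply: S0; exists x.
Qed.

End frobenius.

Section matrix_entries.
Variable C : numClosedFieldType.

Lemma mulmx3E n (U X V : 'M[C]_n) i j : (U *m X *m V) i j =
  \sum_(k : 'I_n * 'I_n) U i k.1 * X k.1 k.2 * V k.2 j.
Proof.
rewrite mxE [RHS](_ : _ = \sum_(k : 'I_n * 'I_n) (fun l k => U i k * X k l * V l j) k.2 k.1)//.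
rewrite -(pair_bigA _ (fun k l => (fun l k => U i k * X k l * V l j) l k)) /=.
rewrite exchange_big /=; apply: eq_bigr => l _.
by rewrite mxE mulr_suml.
Qed.

Lemma mxtraceME n (Y X : 'M[C]_n) : \tr (Y *m X) =
  \sum_(k : 'I_n * 'I_n) Y k.1 k.2 * X k.2 k.1.
Proof.
rewrite /mxtrace -(pair_bigA _ (fun k l => Y k l * X l k)) /=.
by apply: eq_bigr => i _; rewrite mxE.
Qed.

Lemma mxtrace_jump1 n (Z E x Q : 'M[C]_n) : x^t* = x ->
  \tr (Z *m (E *m x *m Q^t*)) = \tr ((Z^t* *m Q *m x)^t* *m E).
Proof.
move=> hx; rewrite (adjM (_ *m Q)) (adjM _ Q) trmxCK hx.
by rewrite -(mulmxA E) (mulmxA Z) mxtrace_mulC !mulmxA.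
Qed.

Lemma mxtrace_jump2 n (Z E x Q : 'M[C]_n) : x^t* = x ->
  \tr (Z *m (Q^t* *m E *m x)) = \tr ((Q *m Z^t* *m x)^t* *m E).
Proof.
move=> hx; rewrite (adjM (Q *m _)) (adjM Q) trmxCK hx !mulmxA.
by rewrite mxtrace_mulC !mulmxA.
Qed.

Lemma mxtrace_herm n (y B : 'M[C]_n) :
  \tr (y^t* *m (B + B^t*)) = \tr (y^t* *m B) + (\tr (y *m B))^*.
Proof. by rewrite mulmxDr mxtraceD -(adjM B y) mxtrace_adj (mxtrace_mulC B). Qed.

(** Commutator and anticommutator merge into one left and one right factor, the form in which the
    balanced expansion delivers them. *)
Lemma split_generator n (K N T X : 'M[C]_n) :
  K *m X - X *m K + (T - 2^-1 *: (N *m X + X *m N)) =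
  T - ((2^-1 *: N - K) *m X + X *m (2^-1 *: N + K)).
Proof.
rewrite !(mulmxBl, mulmxDr, scalerDr) -!scalemxAl -!scalemxAr.
move: (K *m X) (X *m K) (2^-1 *: (N *m X)) (2^-1 *: (X *m N)) => a b c e.
by apply/matrixP => i j; rewrite !mxE; ring.
Qed.

End matrix_entries.

Section cis.
Context {R : realType}.
Notation C := R[i].

Lemma cis_conj (x : R) : (cis x : C)^*%R = cis (- x).
Proof. by apply/eqP; rewrite eq_complex /= cosN sinN !eqxx. Qed.

Lemma cisD (x y : R) : cis (x + y) = cis x * cis y :> C.
Proof.
by apply/eqP; rewrite eq_complex /= cosD sinD; apply/andP; split; apply/eqP; ring.
Qed.

Lemma cis0 : cis 0 = 1 :> C.
Proof. by rewrite /cis cos0 sin0. Qed.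

End cis.

Section basis_functionals.
Context {R : realType}.
Notation C := R[i].

(** Entries in one basis are fixed finite combinations of entries in the other, so linearity moves
    [J] through the change of basis. Integrability is checked only in the energy basis, where
    entries are explicit. *)
Lemma to_basis_entrywise n (V : 'M[C]_n) (D : (R -> R) -> Prop)
    (J : (R -> R) -> R) (F : R -> 'M[C]_n) : V \is unitarymx -> linear_on D J ->
  (forall i j, complex_dom D (fun t => to_basis V (F t) i j)) ->
  to_basis V (entrywise J F) =
  \matrix_(i, j) complexify J (fun t => to_basis V (F t) i j).
Proof.
move=> uV lin dF; set M := \matrix_(i, j) _.
rewrite -[RHS](to_basisK uV); congr to_basis; apply/matrixP => p q.
rewrite mulmx3E.
have FE t : F t p q = \sum_(k : 'I_n * 'I_n)
    ((V^t*) p k.1 * V k.2 q) * to_basis V (F t) k.1 k.2.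
  rewrite -{1}(to_basis_inv uV (F t)) mulmx3E.
  by apply: eq_bigr => k _; rewrite mulrAC.
have dk (k : 'I_n * 'I_n) := complexifyZ lin ((V^t*) p k.1 * V k.2 q) (dF k.1 k.2).
rewrite mxE -[LHS]/(complexify J (fun t => F t p q)) (funext FE).
have [_ ->] := complexify_sum lin (index_enum _) (fun k => (dk k).1).
by apply: eq_bigr => k _; rewrite (dk k).2 [M _ _]mxE mulrAC.
Qed.

End basis_functionals.

(** * Weighted integrals of matrix-valued functions *)

Section mx_functional.
Context {R : realType}.
Notation C := R[i].
Variables (T : Type) (D : (T -> R) -> Prop) (J : (T -> R) -> R).
Hypothesis lin : linear_on D J.
Variables (n : nat) (wt : T -> C).
Implicit Types (F G : T -> 'M[C]_n) (X Y : 'M[C]_n).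

Definition mx_dom F := forall i j, complex_dom D (fun p => wt p * F p i j).
Definition mx_val F : 'M[C]_n :=
  \matrix_(i, j) complexify J (fun p => wt p * F p i j).

Lemma mx_valD F G : mx_dom F -> mx_dom G ->
  mx_dom (fun p => F p + G p) /\ mx_val (fun p => F p + G p) = mx_val F + mx_val G.
Proof.
move=> dF dG; have h i j := complexifyD lin (dF i j) (dG i j).
have e i j : (fun p => wt p * (F p + G p) i j) =
    (fun p => wt p * F p i j + wt p * G p i j).
  by apply/funext => p; rewrite mxE mulrDr.
split; first by move=> i j; rewrite e; exact: (h i j).1.
by apply/matrixP => i j; rewrite !mxE e (h i j).2.
Qed.

Lemma mx_valN F : mx_dom F ->
  mx_dom (fun p => - F p) /\ mx_val (fun p => - F p) = - mx_val F.
Proof.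
move=> dF; have h i j := complexifyZ lin (-1) (dF i j).
have e i j : (fun p => wt p * (- F p) i j) = (fun p => -1 * (wt p * F p i j)).
  by apply/funext => p; rewrite mxE mulN1r mulrN.
split; first by move=> i j; rewrite e; exact: (h i j).1.
by apply/matrixP => i j; rewrite !mxE e (h i j).2 mulN1r.
Qed.

Lemma mx_valB F G : mx_dom F -> mx_dom G ->
  mx_dom (fun p => F p - G p) /\ mx_val (fun p => F p - G p) = mx_val F - mx_val G.
Proof.
by move=> dF /mx_valN[dG <-]; exact: (mx_valD dF dG).
Qed.

Lemma mx_valMr F X : mx_dom F ->
  mx_dom (fun p => F p *m X) /\ mx_val (fun p => F p *m X) = mx_val F *m X.
Proof.
move=> dF; have z i j k := complexifyZ lin (X k j) (dF i k).
have e i j : (fun p => wt p * (F p *m X) i j) =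
    (fun p => \sum_k X k j * (wt p * F p i k)).
  apply/funext => p; rewrite mxE mulr_sumr; apply: eq_bigr => k _; ring.
have s i j := complexify_sum lin (index_enum _) (fun k => (z i j k).1).
split; first by move=> i j; rewrite e; exact: (s i j).1.
apply/matrixP => i j; rewrite [LHS]mxE [RHS]mxE e (s i j).2.
by apply: eq_bigr => k _; rewrite (z i j k).2 [mx_val F i k]mxE mulrC.
Qed.

Lemma mx_valMl F X : mx_dom F ->
  mx_dom (fun p => X *m F p) /\ mx_val (fun p => X *m F p) = X *m mx_val F.
Proof.
move=> dF; have z i j k := complexifyZ lin (X i k) (dF k j).
have e i j : (fun p => wt p * (X *m F p) i j) =
    (fun p => \sum_k X i k * (wt p * F p k j)).
  apply/funext => p; rewrite mxE mulr_sumr; apply: eq_bigr => k _; ring.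
have s i j := complexify_sum lin (index_enum _) (fun k => (z i j k).1).
split; first by move=> i j; rewrite e; exact: (s i j).1.
apply/matrixP => i j; rewrite [LHS]mxE [RHS]mxE e (s i j).2.
by apply: eq_bigr => k _; rewrite (z i j k).2 [mx_val F k j]mxE.
Qed.

Lemma mx_val_tr F Y : mx_dom F ->
  let f p := complex.Re (wt p * \tr (Y *m F p)) in
  D f /\ J f = complex.Re (\tr (Y *m mx_val F)).
Proof.
move=> dF f; have z (k : 'I_n * 'I_n) := complexifyZ lin (Y k.1 k.2) (dF k.2 k.1).
have [s v] := complexify_sum lin (index_enum _) (fun k => (z k).1).
have e p : f p = complex.Re (\sum_(k : 'I_n * 'I_n)
    Y k.1 k.2 * (wt p * F p k.2 k.1)).
  rewrite /f mxtraceME mulr_sumr; congr complex.Re.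
  by apply: eq_bigr => k _; ring.
rewrite (funext e); split; first exact: s.1.
rewrite mxtraceME -[LHS]/(complex.Re (complexify _ _)) v; congr complex.Re.
by apply: eq_bigr => k _; rewrite (z k).2 [mx_val F _ _]mxE.
Qed.

End mx_functional.

(** * Integrals of products of two jump operators *)

Section pair_integrals.
Context {R : realType}.
Notation C := R[i].
Notation mu := (@lebesgue_measure R).
Variables (beta kappa : R).
Hypotheses (beta0 : 0 < beta) (kappa0 : 0 < kappa).
Notation fhat := (fhat kappa).

Section weight.
(** The weight stays general: [gamma_rate] yields the generator and [ADB], the constant 1 yields
    Parseval. *)
Variable om : R -> R.
Hypotheses (mom : measurable_fun setT om) (om01 : forall w, 0 <= om w <= 1).

Definition overlap (a b : R) := \int[mu]_w (om w * (fhat (w - a) * fhat (w - b))).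

Definition wt (p : R * R) : C := (om p.1 * g_kernel beta p.2)%:C.

Let cD2 := complex_dom (@dbl_integrable R).
Let cJ2 := complexify (@dbl_int R).
Let lin2 := @linear_on_dbl_int R.

(** The two phases combine into [cis ((n1 - n2) * t)], so the integrand factors into a part in [w]
    and a part in [t]; the sine part vanishes because [g_kernel] is even. *)
Lemma pair_int (e1 e2 n1 n2 : R) :
  let phi p := wt p * (((e1 * fhat (p.1 - n1))%:C * cis (n1 * p.2)) *
                ((e2 * fhat (p.1 - n2))%:C * cis (n2 * p.2))^*) in
  cD2 phi /\ cJ2 phi = (e1 * e2 * overlap n1 n2 * ghat beta (n1 - n2))%:C.
Proof.
move=> phi.
pose F w := e1 * e2 * (om w * (fhat (w - n1) * fhat (w - n2))).
have iF : rintegrable F by apply: rintegrableZl; exact: integrable_fhat_prod.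
have phiE : phi = fun p => (F p.1 * g_kernel beta p.2)%:C * cis ((n1 - n2) * p.2).
  apply/funext => p; apply/eqP; rewrite eq_complex /phi /wt /F /= (mulrBl p.2 n1 n2) cosB sinB.
  by apply/andP; split; apply/eqP; ring.
rewrite phiE.
have [d1 v1] := dbl_int_prod iF (integrable_g_cos beta0 (n1 - n2)).
have [d2 v2] := dbl_int_prod iF (integrable_g_sin beta0 (n1 - n2)).
have e3 : (fun p : R * R => F p.1 * g_kernel beta p.2 * cos ((n1 - n2) * p.2)) =
  (fun p => F p.1 * (g_kernel beta p.2 * cos ((n1 - n2) * p.2))).
  by apply/funext => p; rewrite mulrA.
have e4 : (fun p : R * R => F p.1 * g_kernel beta p.2 * sin ((n1 - n2) * p.2)) =
  (fun p => F p.1 * (g_kernel beta p.2 * sin ((n1 - n2) * p.2))).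
  by apply/funext => p; rewrite mulrA.
apply: complexify_cis; rewrite ?e3 ?e4//.
rewrite v1 v2 integral_g_sin// mulr0 /F RintegralZl//.
exact: integrable_fhat_prod.
Qed.

Variables (n : nat) (E : 'I_n -> R) (a : 'M[C]_n).

Definition jump (h : R -> R) (t : R) : 'M[C]_n :=
  \matrix_(i, j) ((h (E i - E j))%:C * cis ((E i - E j) * t) * a i j).

(** The factor [e] is a function of the Bohr frequency. With [e = 1] this is [oft_t] in the energy
    basis; exponentials give its conjugates by powers of the Gibbs state. *)
Definition tilted (e : R -> R) (p : R * R) : 'M[C]_n :=
  jump (fun nu => e nu * fhat (p.1 - nu)) p.2.

Notation mx_dom2 := (mx_dom (@dbl_integrable R) wt).
Notation mx_dbl := (mx_val (@dbl_int R) wt).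

Definition pair_kernel (e1 e2 : R -> R) (n1 n2 : R) : C :=
  (e1 n1 * e2 n2 * overlap n1 n2 * ghat beta (n1 - n2))%:C.

Lemma mx_dbl_jump_l e1 e2 X :
  let F p := tilted e1 p *m X *m (tilted e2 p)^t* in
  mx_dom2 F /\ mx_dbl F = \matrix_(i, j) \sum_(k : 'I_n * 'I_n)
    (a i k.1 * X k.1 k.2 * (a j k.2)^*) *
    pair_kernel e1 e2 (E i - E k.1) (E j - E k.2).
Proof.
move=> F; suff h i j : cD2 (fun p => wt p * F p i j) /\
    cJ2 (fun p => wt p * F p i j) = \sum_(k : 'I_n * 'I_n)
    (a i k.1 * X k.1 k.2 * (a j k.2)^*) *
    pair_kernel e1 e2 (E i - E k.1) (E j - E k.2).
  split; first by move=> i j; have [] := h i j.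
  by apply/matrixP => i j; rewrite !mxE; have [] := h i j.
have FE p : wt p * F p i j = \sum_(k : 'I_n * 'I_n)
    (a i k.1 * X k.1 k.2 * (a j k.2)^*) * (wt p *
     (((e1 (E i - E k.1) * fhat (p.1 - (E i - E k.1)))%:C *
         cis ((E i - E k.1) * p.2)) *
      ((e2 (E j - E k.2) * fhat (p.1 - (E j - E k.2)))%:C *
         cis ((E j - E k.2) * p.2))^*)).
  rewrite /F mulmx3E mulr_sumr; apply: eq_bigr => k _.
  by rewrite adjE !mxE !rmorphM; ring.
rewrite (funext FE).
have dk (k : 'I_n * 'I_n) := pair_int (e1 (E i - E k.1)) (e2 (E j - E k.2))
  (E i - E k.1) (E j - E k.2).
have zk (k : 'I_n * 'I_n) := complexifyZ lin2 (a i k.1 * X k.1 k.2 * (a j k.2)^*)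
  (dk k).1.
have [d v] := complexify_sum lin2 (index_enum _) (fun k => (zk k).1).
split; first exact: d.
by rewrite /cJ2 v; apply: eq_bigr => k _; rewrite (zk k).2; congr (_ * _);
  exact: (dk k).2.
Qed.

Lemma mx_dbl_jump_r e1 e2 X :
  let F p := (tilted e1 p)^t* *m X *m tilted e2 p in
  mx_dom2 F /\ mx_dbl F = \matrix_(i, j) \sum_(k : 'I_n * 'I_n)
    ((a k.1 i)^* * X k.1 k.2 * a k.2 j) *
    pair_kernel e2 e1 (E k.2 - E j) (E k.1 - E i).
Proof.
move=> F; suff h i j : cD2 (fun p => wt p * F p i j) /\
    cJ2 (fun p => wt p * F p i j) = \sum_(k : 'I_n * 'I_n)
    ((a k.1 i)^* * X k.1 k.2 * a k.2 j) *
    pair_kernel e2 e1 (E k.2 - E j) (E k.1 - E i).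
  split; first by move=> i j; have [] := h i j.
  by apply/matrixP => i j; rewrite !mxE; have [] := h i j.
have FE p : wt p * F p i j = \sum_(k : 'I_n * 'I_n)
    ((a k.1 i)^* * X k.1 k.2 * a k.2 j) * (wt p *
     (((e2 (E k.2 - E j) * fhat (p.1 - (E k.2 - E j)))%:C *
         cis ((E k.2 - E j) * p.2)) *
      ((e1 (E k.1 - E i) * fhat (p.1 - (E k.1 - E i)))%:C *
         cis ((E k.1 - E i) * p.2))^*)).
  rewrite /F mulmx3E mulr_sumr; apply: eq_bigr => k _.
  by rewrite adjE !mxE !rmorphM; ring.
rewrite (funext FE).
have dk (k : 'I_n * 'I_n) := pair_int (e2 (E k.2 - E j)) (e1 (E k.1 - E i))
  (E k.2 - E j) (E k.1 - E i).
have zk (k : 'I_n * 'I_n) := complexifyZ lin2 ((a k.1 i)^* * X k.1 k.2 * a k.2 j)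
  (dk k).1.
have [d v] := complexify_sum lin2 (index_enum _) (fun k => (zk k).1).
split; first exact: d.
by rewrite /cJ2 v; apply: eq_bigr => k _; rewrite (zk k).2; congr (_ * _);
  exact: (dk k).2.
Qed.

Lemma mx_dbl_gram e1 e2 :
  let F p := (tilted e1 p)^t* *m tilted e2 p in
  mx_dom2 F /\ mx_dbl F = \matrix_(i, j) \sum_k
    ((a k i)^* * a k j) * pair_kernel e2 e1 (E k - E j) (E k - E i).
Proof.
move=> F; suff h i j : cD2 (fun p => wt p * F p i j) /\
    cJ2 (fun p => wt p * F p i j) = \sum_k
    ((a k i)^* * a k j) * pair_kernel e2 e1 (E k - E j) (E k - E i).
  split; first by move=> i j; have [] := h i j.
  by apply/matrixP => i j; rewrite !mxE; have [] := h i j.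
have FE p : wt p * F p i j = \sum_k
    ((a k i)^* * a k j) * (wt p *
     (((e2 (E k - E j) * fhat (p.1 - (E k - E j)))%:C *
         cis ((E k - E j) * p.2)) *
      ((e1 (E k - E i) * fhat (p.1 - (E k - E i)))%:C *
         cis ((E k - E i) * p.2))^*)).
  rewrite /F mxE mulr_sumr; apply: eq_bigr => k _.
  by rewrite adjE !mxE !rmorphM; ring.
rewrite (funext FE).
have dk k := pair_int (e2 (E k - E j)) (e1 (E k - E i)) (E k - E j) (E k - E i).
have zk k := complexifyZ lin2 ((a k i)^* * a k j) (dk k).1.
have [d v] := complexify_sum lin2 (index_enum _) (fun k => (zk k).1).
split; first exact: d.
by rewrite /cJ2 v; apply: eq_bigr => k _; rewrite (zk k).2; congr (_ * _);
  exact: (dk k).2.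
Qed.

Definition bare (w : R) : 'M[C]_n :=
  \matrix_(i, j) ((fhat (w - (E i - E j)))%:C * a i j).

Notation mx_dom1 := (mx_dom (fun f : R -> R => rintegrable f) (fun w => (om w)%:C)).
Notation mx_int1 := (mx_val (fun f : R -> R => \int[mu]_w f w) (fun w => (om w)%:C)).
Let lin1 := @linear_on_Rintegral R.

Let pair_int1 (n1 n2 : R) := complexify_real lin1
  (integrable_fhat_prod kappa0 n1 n2 mom om01).

Lemma mx_int1_bare X :
  let F w := bare w *m X *m (bare w)^t* in
  mx_dom1 F /\ mx_int1 F = \matrix_(i, j) \sum_(k : 'I_n * 'I_n)
    (a i k.1 * X k.1 k.2 * (a j k.2)^*) *
    (overlap (E i - E k.1) (E j - E k.2))%:C.
Proof.
move=> F; suff h i j : complex_dom (fun f : R -> R => rintegrable f)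
    (fun w => (om w)%:C * F w i j) /\
    complexify (fun f : R -> R => \int[mu]_w f w) (fun w => (om w)%:C * F w i j) =
    \sum_(k : 'I_n * 'I_n) (a i k.1 * X k.1 k.2 * (a j k.2)^*) *
    (overlap (E i - E k.1) (E j - E k.2))%:C.
  split; first by move=> i j; have [] := h i j.
  by apply/matrixP => i j; rewrite !mxE; have [] := h i j.
have FE w : (om w)%:C * F w i j = \sum_(k : 'I_n * 'I_n)
    (a i k.1 * X k.1 k.2 * (a j k.2)^*) *
    (om w * (fhat (w - (E i - E k.1)) * fhat (w - (E j - E k.2))))%:C.
  rewrite /F mulmx3E mulr_sumr; apply: eq_bigr => k _.
  rewrite adjE !mxE [X in _ * (_ * X)]rmorphM [X in _ * (_ * (X * _))]realC_conj.
  by rewrite !realCM; ring.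
rewrite (funext FE).
have dk (k : 'I_n * 'I_n) := pair_int1 (E i - E k.1) (E j - E k.2).
have zk (k : 'I_n * 'I_n) := complexifyZ lin1 (a i k.1 * X k.1 k.2 * (a j k.2)^*)
  (dk k).1.
have [d v] := complexify_sum lin1 (index_enum _) (fun k => (zk k).1).
split; first exact: d.
by rewrite v; apply: eq_bigr => k _; rewrite (zk k).2 (dk k).2.
Qed.

Lemma mx_int1_bare_gram :
  let F w := (bare w)^t* *m bare w in
  mx_dom1 F /\ mx_int1 F = \matrix_(i, j) \sum_k
    ((a k i)^* * a k j) * (overlap (E k - E j) (E k - E i))%:C.
Proof.
move=> F; suff h i j : complex_dom (fun f : R -> R => rintegrable f)
    (fun w => (om w)%:C * F w i j) /\
    complexify (fun f : R -> R => \int[mu]_w f w) (fun w => (om w)%:C * F w i j) =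
    \sum_k ((a k i)^* * a k j) * (overlap (E k - E j) (E k - E i))%:C.
  split; first by move=> i j; have [] := h i j.
  by apply/matrixP => i j; rewrite !mxE; have [] := h i j.
have FE w : (om w)%:C * F w i j = \sum_k ((a k i)^* * a k j) *
    (om w * (fhat (w - (E k - E j)) * fhat (w - (E k - E i))))%:C.
  rewrite /F mxE mulr_sumr; apply: eq_bigr => k _.
  rewrite adjE !mxE rmorphM [X in _ * (X * _ * _)]realC_conj !realCM; ring.
rewrite (funext FE).
have dk k := pair_int1 (E k - E j) (E k - E i).
have zk k := complexifyZ lin1 ((a k i)^* * a k j) (dk k).1.
have [d v] := complexify_sum lin1 (index_enum _) (fun k => (zk k).1).
split; first exact: d.
by rewrite v; apply: eq_bigr => k _; rewrite (zk k).2 (dk k).2.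
Qed.

End weight.
End pair_integrals.

Section unitary_gram.
Variable C : numClosedFieldType.

Lemma unitary_gram n (U O U' : 'M[C]_n) : U^t* *m U = 1%:M ->
  (U *m O *m U')^t* *m (U *m O *m U') = U'^t* *m (O^t* *m O) *m U'.
Proof.
move=> h; rewrite !adjM !mulmxA; congr (_ *m _).
by rewrite -(mulmxA _ _ U) h mulmx1.
Qed.

Lemma scale_comm n k (K X : 'M[C]_n) :
  k *: (K *m X - X *m K) = (k *: K) *m X - X *m (k *: K).
Proof. by rewrite scalerBr -scalemxAl -scalemxAr. Qed.

End unitary_gram.

(** * The Lindbladian in the energy basis *)

Section generator.
Context {R : realType}.
Notation C := R[i].
Notation mu := (@lebesgue_measure R).
Variables (beta kappa : R).
Hypotheses (beta0 : 0 < beta) (kappa0 : 0 < kappa).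
Variables (n : nat) (H A : 'M[C]_n).
Hypothesis hA : A^t* = A.
Let V := spectralmx H.
Let uV : V \is unitarymx := spectral_unitarymx H.
Let E := energies H.
Let a := to_basis V A.
Let gam := gamma_rate beta kappa.
Let mg := @measurable_gamma_rate R kappa beta.
Let g01 := gamma_rate_bound kappa beta0.
Let lin1 := @linear_on_Rintegral R.

Lemma evol_adj t : (evol H t)^t* = evol H (- t).
Proof.
rewrite /evol !fun_hermE /sandwich !adjM trmxCK adj_diag mulmxA.
set D1 := diag_mx _; set D2 := diag_mx _; suff -> : D1 = D2 by [].
rewrite /D1 /D2; congr diag_mx; apply/rowP => i; rewrite !mxE.
by rewrite cis_conj mulrN.
Qed.

Lemma evol_unitary t : (evol H t)^t* *m evol H t = 1%:M.
Proof.
rewrite evol_adj /evol !fun_hermE sandwichM//.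
rewrite (@eq_sandwich _ _ _ _ (fun=> 1)); last first.
  by move=> i; rewrite -cisD mulrN addNr cis0.
rewrite /sandwich (_ : \row_i 1 = const_mx 1); last by apply/rowP => i; rewrite !mxE.
by rewrite diag_const_mx mulmx1 (unitary_adjl uV).
Qed.

Lemma to_basis_oft w : to_basis V (oft H kappa A w) = bare kappa E a w.
Proof.
have key i j : complex_dom (fun f : R -> R => rintegrable f)
   (fun t => to_basis V ((cis (- (w * t)) * (gauss_filter kappa t)%:C) *:
                  (evol H t *m A *m evol H (- t))) i j) /\
   complexify (fun f : R -> R => \int[mu]_t f t)
   (fun t => to_basis V ((cis (- (w * t)) * (gauss_filter kappa t)%:C) *:
                  (evol H t *m A *m evol H (- t))) i j) =
   a i j * (Num.sqrt (2 * pi) * fhat kappa (w - (E i - E j)))%:C.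
  have -> : (fun t => to_basis V ((cis (- (w * t)) * (gauss_filter kappa t)%:C) *:
                  (evol H t *m A *m evol H (- t))) i j) =
      (fun t => a i j * ((gauss_filter kappa t)%:C * cis ((E i - E j - w) * t))).
    apply/funext => t; rewrite to_basisZ mxE to_basis_evol mxE.
    by rewrite (mulrBl t _ w) cisD; ring.
  have [d v] := @complexify_cis R R (fun f : R -> R => rintegrable f)
    (fun f : R -> R => \int[mu]_t f t) (gauss_filter kappa)
    (fun t => (E i - E j - w) * t) _ (integrable_filter_cos kappa0 _)
    (integrable_filter_sin kappa0 _) erefl.
  have [dz vz] := complexifyZ lin1 (a i j) d.
  split; first exact: dz.
  rewrite vz v integral_filter_sin// integral_filter_cos//.
  by rewrite -fhatN opprB.
rewrite /oft to_basisZ (to_basis_entrywise uV lin1 (fun i j => (key i j).1)).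
apply/matrixP => i j; rewrite [LHS]mxE [X in _ * X]mxE (key i j).2 [RHS]mxE.
have s0 : Num.sqrt (2 * pi) != 0 :> R.
  by rewrite gt_eqF// sqrtr_gt0 mulr_gt0// pi_gt0.
by rewrite mulrCA -realCM mulrA div1r mulVf// mul1r mulrC.
Qed.

Lemma to_basis_oft_t w t : to_basis V (oft_t H kappa A w t) =
  tilted kappa E a (fun=> 1) (w, t).
Proof.
rewrite /oft_t to_basis_evol to_basis_oft; apply/matrixP => i j; rewrite !mxE.
by rewrite mul1r; ring.
Qed.

(** [rateN] and [rateT] are the decay and jump parts of the dissipator; [shiftN] below is [- i]
    times the coherent term. *)
Definition rateN : 'M[C]_n := \matrix_(i, j) \sum_k
  ((a k i)^* * a k j) * (rate_overlap kappa beta (E k - E j) (E k - E i))%:C.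

Definition rateT (X : 'M[C]_n) : 'M[C]_n := \matrix_(i, j)
  \sum_(k : 'I_n * 'I_n) (a i k.1 * X k.1 k.2 * (a j k.2)^*) *
    (rate_overlap kappa beta (E i - E k.1) (E j - E k.2))%:C.

Definition shiftN : 'M[C]_n :=
  \matrix_(i, j) ((chat beta (E i - E j))%:C * rateN i j).

(** Evolution multiplies each entry by a phase, of which the principal value against [c_kernel]
    keeps only the sine part, [i * chat]; the prefactor [- i] makes it real. The coherent term is
    thus the Schur multiplier [chat] applied to [rateN]. *)
Lemma to_basis_coherent :
  - 'i *: to_basis V (coherent H beta kappa A) = shiftN.
Proof.
have linp := @linear_on_pvint R.
have inner w i j : complex_dom (@pv_dom R) (fun t => to_basis V
     ((c_kernel beta t)%:C *:
      ((oft_t H kappa A w t)^t* *m oft_t H kappa A w t)) i j) /\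
    complexify (@pvint R) (fun t => to_basis V
     ((c_kernel beta t)%:C *:
      ((oft_t H kappa A w t)^t* *m oft_t H kappa A w t)) i j) =
    ((bare kappa E a w)^t* *m bare kappa E a w) i j * (0 +i* chat beta (E i - E j)).
  have -> : (fun t => to_basis V ((c_kernel beta t)%:C *:
      ((oft_t H kappa A w t)^t* *m oft_t H kappa A w t)) i j) =
      (fun t => ((bare kappa E a w)^t* *m bare kappa E a w) i j *
        ((c_kernel beta t)%:C * cis ((E i - E j) * t))).
    apply/funext => t; rewrite /oft_t unitary_gram ?evol_unitary// evol_adj opprK.
    rewrite to_basisZ mxE to_basis_evol mxE to_basisM// to_basis_adj to_basis_oft.
    by ring.
  have [dc vc] := pv_c_cos beta0 (E i - E j).
  have [ds vs] := pv_c_sin beta0 (E i - E j).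
  have [d v] := @complexify_cis R R (@pv_dom R) (@pvint R) (c_kernel beta)
    (fun t => (E i - E j) * t) _ dc ds erefl.
  have [dz vz] := complexifyZ linp (((bare kappa E a w)^t* *m bare kappa E a w) i j) d.
  split; first exact: dz.
  by rewrite vz v vc vs.
have [dN vN] := mx_int1_bare_gram kappa0 mg g01 E a.
have outer i j : (fun w => to_basis V ((gam w)%:C *: mxpvint (fun t =>
      (c_kernel beta t)%:C *:
      ((oft_t H kappa A w t)^t* *m oft_t H kappa A w t))) i j) =
    (fun w => (0 +i* chat beta (E i - E j)) *
      ((gam w)%:C * ((bare kappa E a w)^t* *m bare kappa E a w) i j)).
  apply/funext => w; rewrite to_basisZ mxE.
  rewrite (to_basis_entrywise uV linp (fun i j => (inner w i j).1)) mxE.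
  by rewrite (inner w i j).2; ring.
have key i j := complexifyZ lin1 (0 +i* chat beta (E i - E j)) (dN i j).
rewrite /coherent (to_basis_entrywise uV lin1); last first.
  by move=> i j; rewrite outer; exact: (key i j).1.
apply/matrixP => i j; rewrite [LHS]mxE [X in _ * X]mxE outer (key i j).2 [RHS]mxE.
have := congr1 (fun M : 'M[C]_n => M i j) vN; rewrite [LHS]mxE => ->.
rewrite mulrA [X in _ * X]mxE [X in _ = _ * X]mxE; congr (_ * _).
by apply/eqP; rewrite eq_complex /=; apply/andP; split; apply/eqP; ring.
Qed.

Lemma to_basis_lindblad X : to_basis V (lindblad H beta kappa A X) =
  rateT (to_basis V X)
  - ((2^-1 *: rateN - shiftN) *m to_basis V X
     + to_basis V X *m (2^-1 *: rateN + shiftN)).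
Proof.
have [dN vN] := mx_int1_bare_gram kappa0 mg g01 E a.
have [dT vT] := mx_int1_bare kappa0 mg g01 E a (to_basis V X).
have [dNX vNX] := mx_valMr lin1 (to_basis V X) dN.
have [dXN vXN] := mx_valMl lin1 (to_basis V X) dN.
have [dS vS] := mx_valD lin1 dNX dXN.
(* The factor [2^-1] is written as a scalar matrix so that the rule for constant left factors
   applies. *)
have [dZ vZ] := mx_valMl lin1 ((2^-1)%:M) dS.
have [dB vB] := mx_valB lin1 dT dZ.
rewrite -split_generator /lindblad to_basisD !to_basisZ to_basisB !to_basisM//.
rewrite scale_comm to_basis_coherent; congr (_ + _).
have e i j : (fun w => to_basis V (let Aw := oft H kappa A w in
      (gam w)%:C *: (Aw *m X *m Aw^t*
       - 2^-1 *: (Aw^t* *m Aw *m X + X *m (Aw^t* *m Aw)))) i j) =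
    (fun w => (gam w)%:C * (bare kappa E a w *m to_basis V X *m (bare kappa E a w)^t*
      - 2^-1%:M *m ((bare kappa E a w)^t* *m bare kappa E a w *m to_basis V X +
        to_basis V X *m ((bare kappa E a w)^t* *m bare kappa E a w))) i j).
  apply/funext => w /=; rewrite to_basisZ mxE to_basisB to_basisZ to_basisD.
  by rewrite !to_basisM// to_basis_adj !to_basis_oft mul_scalar_mx.
rewrite /mxint (to_basis_entrywise uV lin1); last first.
  by move=> i j; rewrite e; exact: dB.
transitivity (mx_val (fun f : R -> R => \int[mu]_w f w) (fun w => (gam w)%:C)
   (fun w => bare kappa E a w *m to_basis V X *m (bare kappa E a w)^t*
      - 2^-1%:M *m ((bare kappa E a w)^t* *m bare kappa E a w *m to_basis V X +
        to_basis V X *m ((bare kappa E a w)^t* *m bare kappa E a w)))).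
  by apply/matrixP => i j; rewrite [LHS]mxE e [RHS]mxE.
apply: (etrans vB); apply: (congr2 (fun x y => x - y) vT).
apply: (etrans vZ); apply: (etrans (mul_scalar_mx _ _)).
apply: (congr1 (fun M => 2^-1 *: M)); apply: (etrans vS).
exact: (congr2 (fun x y => x + y)
  (etrans vNX (congr1 (fun M => M *m to_basis V X) vN))
  (etrans vXN (congr1 (fun M => to_basis V X *m M) vN))).
Qed.

End generator.

Lemma drop_cancelling (S : pzRingType) n
    (M11 M10 M9 M8 M7 M6 M5 M56 M34 M12 x : 'M[S]_n) :
  M11 = M10 - M8 -> M10 = M9 - M7 -> M8 = x *m M56 -> M7 = M56 *m x ->
  M56 = M5 - M6 -> M5 - M6 = 0 -> M9 = M12 - M34 -> M11 = M12 - M34.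
Proof. by move=> -> -> -> -> -> -> ->; rewrite mul0mx mulmx0 !subr0. Qed.

(** * The balanced form of the generator *)

Section balanced_generator.
Context {R : realType}.
Notation C := R[i].
Notation mu := (@lebesgue_measure R).
Variables (beta kappa : R).
Hypotheses (beta0 : 0 < beta) (kappa0 : 0 < kappa).
Variables (n : nat) (H A : 'M[C]_n).
Hypothesis hA : A^t* = A.
Let V := spectralmx H.
Let uV : V \is unitarymx := spectral_unitarymx H.
Let E := energies H.
Let a := to_basis V A.
Let gam := gamma_rate beta kappa.
Let mg := @measurable_gamma_rate R kappa beta.
Let g01 := gamma_rate_bound kappa beta0.
Let lin2 := @linear_on_dbl_int R.

Definition quarter_dn (nu : R) := expR (- (beta * nu / 4)).
Definition quarter_up (nu : R) := expR (beta * nu / 4).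

Notation pk := (pair_kernel beta kappa gam).
Notation ov := (rate_overlap kappa beta).
Notation mx_dbl := (mx_val (@dbl_int R) (wt beta gam)).

(** Opposite quarter powers leave [expR (beta * (n1 - n2) / 4)], exactly the factor that turns
    [ghat] into [1/2 + chat]: dissipator and coherent term arise from the same integral. *)
Lemma pair_kernel_up_dn n1 n2 : pk quarter_up quarter_dn n1 n2 =
  ((2^-1 + chat beta (n1 - n2)) * ov n1 n2)%:C.
Proof.
rewrite /pair_kernel -expR_ghat// /quarter_up /quarter_dn -expRD.
have -> : beta * n1 / 4 + - (beta * n2 / 4) = beta * (n1 - n2) / 4 by ring.
by congr (_%:C); rewrite [RHS]mulrAC.
Qed.

Lemma pair_kernel_dn_up n1 n2 : pk quarter_dn quarter_up n1 n2 =
  ((2^-1 - chat beta (n1 - n2)) * ov n1 n2)%:C.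
Proof.
rewrite /pair_kernel -expRN_ghat// /quarter_up /quarter_dn -expRD.
have -> : - (beta * n1 / 4) + beta * n2 / 4 = - (beta * (n1 - n2) / 4) by ring.
by congr (_%:C); rewrite [RHS]mulrAC.
Qed.

(** KMS symmetry of the rates together with evenness of [ghat]; it disposes of the products of [Q]
    with itself. *)
Lemma pair_kernel_up_up n1 n2 : pk quarter_up quarter_up n1 n2 =
  pk quarter_up quarter_up (- n2) (- n1).
Proof.
have e1 : quarter_up n1 * quarter_up n2 = expR (beta * (n1 + n2) / 4).
  by rewrite /quarter_up -expRD; congr expR; ring.
have e2 : quarter_up (- n2) * quarter_up (- n1) = expR (- (beta * (n1 + n2) / 4)).
  by rewrite /quarter_up -expRD; congr expR; ring.
have eg : ghat beta (- n2 - - n1) = ghat beta (n1 - n2) by rewrite opprK addrC.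
rewrite /pair_kernel e1 e2 eg; apply: (congr1 (fun z : R => z%:C)).
exact: (congr1 (fun z : R => z * ghat beta (n1 - n2))
  (rate_overlap_sym kappa0 beta0 n1 n2)).
Qed.

Section state.
Variable x : 'M[C]_n.
Hypothesis hx : x^t* = x.

Let P := tilted kappa E a quarter_dn.
Let Q := tilted kappa E a quarter_up.

Definition defect p : 'M[C]_n := P p *m x - x *m Q p.
Definition half_gen p : 'M[C]_n :=
  defect p *m x *m (Q p)^t* - (Q p)^t* *m defect p *m x.

Let aH i j : (a i j)^*%R = a j i.
Proof. by rewrite -adjE -to_basis_adj hA. Qed.

Lemma generator_dbl :
  let F p := half_gen p + (half_gen p)^t* in
  mx_dom (@dbl_integrable R) (wt beta gam) F /\
  mx_dbl F = rateT beta kappa H A (x *m x)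
  - ((2^-1 *: rateN beta kappa H A - shiftN beta kappa H A) *m (x *m x)
     + x *m x *m (2^-1 *: rateN beta kappa H A + shiftN beta kappa H A)).
Proof.
have [d1 v1] := mx_dbl_jump_l beta0 kappa0 mg g01 E a quarter_up quarter_dn (x *m x).
have [d2 v2] := mx_dbl_jump_l beta0 kappa0 mg g01 E a quarter_dn quarter_up (x *m x).
have [d3 v3] := mx_dbl_gram beta0 kappa0 mg g01 E a quarter_up quarter_dn.
have [d4 v4] := mx_dbl_gram beta0 kappa0 mg g01 E a quarter_dn quarter_up.
have [d5 v5] := mx_dbl_jump_l beta0 kappa0 mg g01 E a quarter_up quarter_up x.
have [d6 v6] := mx_dbl_jump_r beta0 kappa0 mg g01 E a quarter_up quarter_up x.
have [d12 v12] := mx_valD lin2 d1 d2.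
have [d3' v3'] := mx_valMr lin2 (x *m x) d3.
have [d4' v4'] := mx_valMl lin2 (x *m x) d4.
have [d34 v34] := mx_valD lin2 d3' d4'.
have [d56 v56] := mx_valB lin2 d5 d6.
have [d7 v7] := mx_valMr lin2 x d56.
have [d8 v8] := mx_valMl lin2 x d56.
have [d9 v9] := mx_valB lin2 d12 d34.
have [d10 v10] := mx_valB lin2 d9 d7.
have [d11 v11] := mx_valB lin2 d10 d8.
have FE : (fun p => half_gen p + (half_gen p)^t*) = _ :=
  funext (fun p => balanced_expansion (P p) (Q p) hx).
rewrite /= FE; split; first exact: d11.
(* The two mixed jump terms carry [1/2 + chat] and [1/2 - chat], with sum 1, so the jump part
   retains no trace of the coherent multiplier. *)
have w12 : mx_dbl (fun p => Q p *m (x *m x) *m (P p)^t*) +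
    mx_dbl (fun p => P p *m (x *m x) *m (Q p)^t*) = rateT beta kappa H A (x *m x).
  apply: (etrans (congr2 (fun x y => x + y) v1 v2)).
  apply/matrixP => i j; rewrite 3!mxE [RHS]mxE -big_split /=; apply: eq_bigr => k _.
  rewrite pair_kernel_up_dn pair_kernel_dn_up -mulrDr -rmorphD /=.
  rewrite -mulrDl addrACA subrr addr0 (_ : 2^-1 + 2^-1 = 1 :> R) ?mul1r//; lra.
(* The decay terms keep [chat] with opposite signs on the two sides of the state, which is the
   commutator with the coherent term. *)
have w3 : mx_dbl (fun p => (Q p)^t* *m P p) =
    2^-1 *: rateN beta kappa H A - shiftN beta kappa H A.
  apply: (etrans v3); apply/matrixP => i j; rewrite !mxE.
  rewrite [RHS](_ : _ = (2^-1 - chat beta (E i - E j))%:C * rateN beta kappa H A i j).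
    rewrite [rateN _ _ _ _ _ _]mxE mulr_sumr; apply: eq_bigr => k _.
    rewrite pair_kernel_dn_up realCM mulrCA.
    by have -> : E k - E j - (E k - E i) = E i - E j by ring.
  rewrite [rateN _ _ _ _ _ _]mxE rmorphB mulrBl; congr (_ * _ - _).
  by rewrite fmorphV rmorph_nat.
have w4 : mx_dbl (fun p => (P p)^t* *m Q p) =
    2^-1 *: rateN beta kappa H A + shiftN beta kappa H A.
  apply: (etrans v4); apply/matrixP => i j; rewrite !mxE.
  rewrite [RHS](_ : _ = (2^-1 + chat beta (E i - E j))%:C * rateN beta kappa H A i j).
    rewrite [rateN _ _ _ _ _ _]mxE mulr_sumr; apply: eq_bigr => k _.
    rewrite pair_kernel_up_dn realCM mulrCA.
    by have -> : E k - E j - (E k - E i) = E i - E j by ring.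
  rewrite [rateN _ _ _ _ _ _]mxE rmorphD mulrDl; congr (_ * _ + _).
  by rewrite fmorphV rmorph_nat.
(* Swapping and negating the two frequencies exchanges [Q x Q'] with [Q' x Q], since [A] is
   Hermitian. *)
have w56 : mx_dbl (fun p => Q p *m x *m (Q p)^t*) -
    mx_dbl (fun p => (Q p)^t* *m x *m Q p) = 0.
  apply/eqP; rewrite subr_eq0; apply/eqP; apply: (etrans v5); apply: (etrans _ (esym v6)).
  apply/matrixP => i j; rewrite [LHS]mxE [RHS]mxE; apply: eq_bigr => k _.
  rewrite pair_kernel_up_up !opprB; congr (_ * _ * _ * _); first exact: esym (aH _ _).
  exact: (aH j k.2).
apply: (etrans (drop_cancelling v11 v10 v8 v7 v56 w56 v9)).
apply: (congr2 (fun x y => x - y)).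
  exact: (etrans v12 w12).
apply: (etrans v34); apply: (congr2 (fun x y => x + y)).
  exact: (etrans v3' (congr1 (fun M => M *m (x *m x)) w3)).
exact: (etrans v4' (congr1 (fun M => x *m x *m M) w4)).
Qed.

End state.
End balanced_generator.

(** * Frequency shifts and optimisation of the AM-GM parameter *)

Section dbl_shift.
Context {R : realType}.

Lemma dbl_int_shift (s : R) (F : R * R -> R) : dbl_integrable F ->
  dbl_integrable (fun p => F (p.1 + s, p.2)) /\
  dbl_int (fun p => F (p.1 + s, p.2)) = dbl_int F.
Proof.
move=> [F1 F2].
have e : (fun t => \int[@lebesgue_measure R]_w F (w + s, t)) =
    (fun t => \int[@lebesgue_measure R]_w F (w, t)).
  by apply/funext => t; rewrite (Rintegral_shift s (F1 t)).
split; last by rewrite /dbl_int /= e.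
split=> [t|] /=; last by rewrite e.
exact: (integrable_shift s (F1 t)).
Qed.

Lemma optimise_scale (X p q : R) : 0 <= p -> 0 <= q ->
  (forall l, 0 < l -> X <= l * p + l^-1 * q) -> X <= 2 * Num.sqrt (p * q).
Proof.
move=> p0 q0 h; have [pz|pn] := eqVneq p 0.
  rewrite pz mul0r sqrtr0 mulr0 leNgt; apply/negP => X0.
  have q1 : 0 < q + 1 by rewrite ltr_wpDl.
  have := h (2 * (q + 1) / X) _; rewrite divr_gt0 ?mulr_gt0// => /(_ isT).
  rewrite pz mulr0 add0r invf_div leNgt => /negP; apply.
  rewrite mulrAC ltr_pdivrMr ?mulr_gt0// ltr_pM2l//; lra.
have p_gt0 : 0 < p by rewrite lt_neqAle eq_sym pn.
rewrite sqrtrM//; set r := Num.sqrt p; set s := Num.sqrt q.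
have r0 : 0 < r by rewrite sqrtr_gt0.
have r2 : r ^+ 2 = p by rewrite sqr_sqrtr.
have s2 : s ^+ 2 = q by rewrite sqr_sqrtr.
have s0 : 0 <= s by exact: sqrtr_ge0.
have [sz|sn] := eqVneq s 0.
  rewrite sz mulr0 mulr0 leNgt; apply/negP => X0.
  have := h (X / (2 * p)) _; rewrite divr_gt0 ?mulr_gt0// => /(_ isT).
  rewrite -s2 sz expr0n /= mulr0 addr0.
  have -> : X / (2 * p) * p = X / 2 by field.
  lra.
have s_gt0 : 0 < s by rewrite lt_neqAle eq_sym sn.
have := h (s / r) _; rewrite divr_gt0// => /(_ isT).
rewrite -r2 -s2.
suff -> : s / r * r ^+ 2 + (s / r)^-1 * s ^+ 2 = 2 * (r * s) by [].
by field; rewrite !gt_eqF.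
Qed.

End dbl_shift.

(** * Estimates in Frobenius norm *)

Section gram.
Variable C : numClosedFieldType.

Lemma nrmC_gram n m (T : 'M[C]_n) (Z : 'M[C]_(n, m)) :
  nrmC (T *m Z) = \tr (Z^t* *m ((T^t* *m T) *m Z)).
Proof. by rewrite /nrmC adjM !mulmxA. Qed.

Lemma nrmC_defect n (T U x : 'M[C]_n) : x^t* = x ->
  nrmC (T *m x - x *m U) = \tr (x *m (T^t* *m T) *m x - x *m (T^t* *m x *m U)
    - (U^t* *m x *m T *m x - U^t* *m (x *m x) *m U)).
Proof.
move=> hx; by rewrite /nrmC adjB !adjM hx mulmxBl !mulmxBr !mulmxA.
Qed.

Lemma nrmCZ n m (r : C) (X : 'M[C]_(n, m)) : r^*%R = r ->
  nrmC (r *: X) = r ^+ 2 * nrmC X.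
Proof.
move=> hr; rewrite !nrmCE mulr_sumr; apply: eq_bigr => j _; rewrite mulr_sumr.
by apply: eq_bigr => i _; rewrite mxE rmorphM /= hr; ring.
Qed.

Lemma nrmCN n m (X : 'M[C]_(n, m)) : nrmC (- X) = nrmC X.
Proof. by rewrite -scaleN1r nrmCZ ?sqrrN ?expr1n ?mul1r// rmorphN rmorph1. Qed.

Lemma nrmC_rot n m (U B U' : 'M[C]_n) (Y : 'M[C]_(n, m)) : U^t* *m U = 1%:M ->
  nrmC (U *m B *m U' *m Y) = nrmC (B *m (U' *m Y)).
Proof. by move=> h; rewrite -!mulmxA nrmC_unitaryl. Qed.

Lemma to_basis_unitary n (V U : 'M[C]_n) : V \is unitarymx ->
  U^t* *m U = 1%:M -> (to_basis V U)^t* *m to_basis V U = 1%:M.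
Proof.
move=> uV h; rewrite -to_basis_adj -to_basisM// h.
by rewrite /to_basis mulmx1 (unitary_adjr uV).
Qed.

Lemma mxtrace_jump_diff n (Z D x Q : 'M[C]_n) : x^t* = x ->
  \tr (Z *m (D *m x *m Q^t* - Q^t* *m D *m x)) =
  \tr ((Z^t* *m (Q *m x))^t* *m D) + \tr ((- (Q *m (Z^t* *m x)))^t* *m D).
Proof.
move=> hx; rewrite mulmxBr raddfB /= mxtrace_jump1// mxtrace_jump2// mulmxA.
congr (_ + _); rewrite (mulmxA Q) -[- (Q *m _ *m x)]sub0r adjB mulmxBl raddfB /=.
by rewrite trmx0 map_mx0 mul0mx mxtrace0 sub0r.
Qed.

Lemma to_basis_defect n (V B s r1 r2 : 'M[C]_n) : V \is unitarymx ->
  to_basis V (B *m s - s *m r1 *m B *m r2) =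
  to_basis V B *m to_basis V s - to_basis V s *m to_basis V (r1 *m B *m r2).
Proof. by move=> u; rewrite to_basisB -!to_basisM// !mulmxA. Qed.

End gram.

Section complex_gram.
Context {R : realType}.
Notation C := R[i].

Lemma realC_scale (r s : R) (c d : C) :
  (r * s)%:C * c * d = r%:C * (s%:C * c * d).
Proof. by rewrite realCM !mulrA. Qed.

Lemma dbl_integrable_ext (F G : R * R -> R) : F =1 G ->
  dbl_integrable F -> dbl_integrable G.
Proof. by move=> /funext ->. Qed.

Lemma Rintegral_normal_cst (sd k : R) : 0 < sd ->
  \int[@lebesgue_measure R]_s (normal_pdf 0 sd s * k) = k.
Proof.
move=> sd0; have ip : rintegrable (normal_pdf (0 : R) sd) by exact: integrable_normal_pdf.
rewrite RintegralZr//.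
apply: (etrans (congr1 (fun y : R => y * k) (_ : _ = 1))); last exact: mul1r.
by rewrite /Rintegral integral_normal_pdf.
Qed.

Lemma le_normal_average (f : R -> R) (sd k : R) : 0 < sd -> rintegrable f ->
  (forall s, f s <= normal_pdf 0 sd s * k) ->
  \int[@lebesgue_measure R]_s f s <= k.
Proof.
move=> sd0 fi fk; rewrite -[leRHS](Rintegral_normal_cst k sd0).
apply: le_Rintegral => //.
rewrite (_ : (fun s => _ * k) = (fun s => k * normal_pdf 0 sd s)); last first.
  by apply/funext => s; rewrite mulrC.
by apply: rintegrableZl; exact: integrable_normal_pdf.
Qed.

Lemma nrmC_opnorm n m (B : 'M[C]_n) (Y : 'M[C]_(n, m)) :
  nrmC (B *m Y) <= (opnorm B ^+ 2)%:C * nrmC Y.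
Proof.
rewrite (nrmC_nrm2 (B *m Y)) (nrmC_nrm2 Y) -realCM lecR; exact: nrm2_opnorm.
Qed.

Lemma Re_weighted_tr n (r : R) (M : 'M[C]_n) :
  complex.Re (r%:C * \tr (1%:M *m M)) = r * complex.Re (\tr M).
Proof. by rewrite ReM_real mul1mx. Qed.

(** The parameter [lam / u ^+ 2] cancels the weights [u ^+ 2] and [u ^- 2] of the two kinds of
    terms; then [c <= 1] is used on the first kind and [c <= c'] on the second. *)
Lemma pointwise_arith (lam u k c c' gg X z1 z2 z3 z4 : R) :
  0 < lam -> 0 < u -> 0 <= gg -> 0 <= c <= 1 -> c <= c' ->
  0 <= z1 -> 0 <= z2 -> 0 <= z3 -> 0 <= z4 ->
  X <= lam / u ^+ 2 / 2 * (2 * ((u * k) ^+ 2 * z1) + (u * k) ^+ 2 * z2 +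
    (u * k) ^+ 2 * z3) + 2 * (lam / u ^+ 2)^-1 * ((u^-1 * k) ^+ 2 * z4) ->
  c * gg * X <= lam * k ^+ 2 / 2 * (2 * (gg * z1) + (gg * z2 + gg * z3)) +
    2 * lam^-1 * k ^+ 2 * (c' * gg * z4).
Proof.
move=> l0 u0 g0 /andP[c0 c1] cc z10 z20 z30 z40.
have -> : lam / u ^+ 2 / 2 * (2 * ((u * k) ^+ 2 * z1) + (u * k) ^+ 2 * z2 +
    (u * k) ^+ 2 * z3) + 2 * (lam / u ^+ 2)^-1 * ((u^-1 * k) ^+ 2 * z4) =
    lam * k ^+ 2 / 2 * (2 * z1 + (z2 + z3)) + 2 * lam^-1 * k ^+ 2 * z4.
  by field; rewrite !gt_eqF.
move=> b; set P := lam * k ^+ 2 / 2 in b *; set P' := 2 * lam^-1 * k ^+ 2 in b *.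
have P0 : 0 <= P.
  by apply: divr_ge0 => //; apply: mulr_ge0; [exact: ltW|exact: sqr_ge0].
have P'0 : 0 <= P'.
  apply: mulr_ge0; last exact: sqr_ge0.
  by apply: mulr_ge0 => //; rewrite invr_ge0 ltW.
apply: (le_trans (ler_wpM2l (mulr_ge0 c0 g0) b)); rewrite mulrDr; apply: lerD.
  rewrite [leRHS](_ : _ = 1 * gg * (P * (2 * z1 + (z2 + z3)))); last by ring.
  apply: ler_wpM2r; last exact: ler_wpM2r.
  by apply: mulr_ge0 => //; rewrite addr_ge0 ?mulr_ge0 ?addr_ge0.
rewrite [leRHS](_ : _ = c' * gg * (P' * z4)); last by ring.
by apply: ler_wpM2r; [exact: mulr_ge0|exact: ler_wpM2r].
Qed.

Lemma nrm2Z n m (r : R) (X : 'M[C]_(n, m)) :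
  nrm2 (r%:C *: X) = r ^+ 2 * nrm2 X.
Proof. have h : (r%:C : C)^*%R = r%:C := realC_conj r.
by rewrite /nrm2 (nrmCZ X h) expr2 -realCM ReM_real -expr2. Qed.

(** By cyclicity each term pairs [D] with an operator containing [Q]. In the first, the contraction
    stands outside [Q x] and is dropped; in the second it sits between [Q] and [x] and must be
    kept. *)
Lemma Re_jump_diff n (Z D x Q : 'M[C]_n) (l : R) : x^t* = x ->
  contraction (Z^t*) -> 0 < l ->
  complex.Re (\tr (Z *m (D *m x *m Q^t* - Q^t* *m D *m x))) <=
  l / 2 * (nrm2 (Q *m x) + nrm2 (Q *m (Z^t* *m x))) + l^-1 * nrm2 D.
Proof.
have arith (X1 X2 p p' q d m : R) : X1 <= (l * p + m * d) / 2 ->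
    X2 <= (l * q + m * d) / 2 -> l * p <= l * p' ->
    X1 + X2 <= l / 2 * (p' + q) + m * d by lra.
move=> hx cZ l0; rewrite (mxtrace_jump_diff _ _ _ hx) ReD.
have b1 := nrm2_amgm (Z^t* *m (Q *m x)) D l0.
have b2 := nrm2_amgm (- (Q *m (Z^t* *m x))) D l0.
have e2 : nrm2 (- (Q *m (Z^t* *m x))) = nrm2 (Q *m (Z^t* *m x)) :=
  congr1 (@complex.Re R) (nrmCN _).
rewrite e2 in b2; have b3 := nrm2_contraction (Q *m x) cZ.
have b4 : l * nrm2 (Z^t* *m (Q *m x)) <= l * nrm2 (Q *m x) by rewrite ler_pM2l.
exact: (arith _ _ _ _ _ _ _ b1 b2 b4).
Qed.

Lemma Re_jump_herm n (Y D x Q B : 'M[C]_n) (l : R) : x^t* = x ->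
  contraction Y -> 0 < l ->
  B = D *m x *m Q^t* - Q^t* *m D *m x ->
  complex.Re (\tr (Y^t* *m (B + B^t*))) <=
  l / 2 * (2 * nrm2 (Q *m x) + nrm2 (Q *m (Y *m x)) + nrm2 (Q *m (Y^t* *m x)))
  + 2 * l^-1 * nrm2 D.
Proof.
have arith (X1 X2 p q q' d m : R) : X1 <= l / 2 * (p + q) + m * d ->
    X2 <= l / 2 * (p + q') + m * d ->
    X1 + X2 <= l / 2 * (2 * p + q + q') + 2 * m * d by lra.
have rc (z : C) : complex.Re (z^*%R) = complex.Re z by case: z.
move=> hx cY l0 ->; rewrite mxtrace_herm ReD rc.
have b2 := Re_jump_diff D Q hx (contraction_adj cY) l0.
have YK : (Y^t*)^t* = Y := trmxCK Y.
have cY' : contraction ((Y^t*)^t*) by rewrite YK.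
have b1 := Re_jump_diff D Q hx cY' l0; rewrite YK in b1.
exact: (arith _ _ _ _ _ _ _ b1 b2).
Qed.

End complex_gram.

(** * Parseval, the defect and the bound on the generator *)

Section bounds.
Context {R : realType}.
Notation C := R[i].
Notation mu := (@lebesgue_measure R).
Variables (beta kappa : R).
Hypotheses (beta0 : 0 < beta) (kappa0 : 0 < kappa).
Variables (n : nat) (H A : 'M[C]_n).
Hypothesis hA : A^t* = A.
Let V := spectralmx H.
Let uV : V \is unitarymx := spectral_unitarymx H.
Let E := energies H.
Let a := to_basis V A.
Let gam := gamma_rate beta kappa.
Let mg := @measurable_gamma_rate R kappa beta.
Let g01 := gamma_rate_bound kappa beta0.
Let lin1 := @linear_on_Rintegral R.
Let lin2 := @linear_on_dbl_int R.
Let m1 : measurable_fun (@setT R) (fun _ : R => 1 : R).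
Proof. exact: measurable_cst. Qed.
Let h1 (w : R) : (0 : R) <= 1 <= (1 : R). Proof. by rewrite ler01 lexx. Qed.
Let T := tilted kappa E a (fun=> 1).
Let g := g_kernel beta.
Let aa := opnorm A ^+ 2.

Lemma dbl_integrable_jump (Z : 'M[C]_n) : dbl_integrable (fun p => g p.2 * nrm2 (T p *m Z)).
Proof.
have [d _] := mx_dbl_gram beta0 kappa0 m1 h1 E a (fun=> 1) (fun=> 1).
have [dr _] := mx_valMr lin2 Z d; have [dl _] := mx_valMl lin2 (Z^t*) dr.
have [D _] := mx_val_tr lin2 1%:M dl.
by apply: (dbl_integrable_ext _ D) => p; rewrite /wt mul1r ReM_real mul1mx /nrm2 nrmC_gram.
Qed.

Let rotated (s : R) : 'M[C]_n := to_basis V (evol H s *m A *m evol H (- s)).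

Lemma rotated_le s m (Z : 'M[C]_(n, m)) : nrm2 (rotated s *m Z) <= aa * nrm2 Z.
Proof.
suff h : nrmC (rotated s *m Z) <= aa%:C * nrmC Z.
  by have := Re_le h; rewrite ReM_real.
apply: to_basis_le => // m' Y.
have := nrmC_opnorm A (evol H (- s) *m Y).
by rewrite -(nrmC_rot _ _ _ (evol_unitary H s)) (nrmC_unitaryl Y (evol_unitary H (- s))).
Qed.

Let rotated_gram s : (rotated s)^t* *m rotated s =
  to_basis V (evol H s *m (A^t* *m A) *m evol H (- s)).
Proof.
apply: (etrans (congr1 (fun M => M *m rotated s) (esym (to_basis_adj V _)))).
apply: (etrans (esym (to_basisM uV _ _))); apply: (congr1 (to_basis V)).
apply: (etrans (unitary_gram _ _ (evol_unitary H s))).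
apply: (congr1 (fun M => M *m (A^t* *m A) *m evol H (- s))).
by rewrite evol_adj opprK.
Qed.

(** Entry by entry, the frequency integral of the Gram matrices equals the average of the Gram
    matrices of the evolved [A] over the squared time filter, a normal density of standard deviation
    [1 / (2 kappa)]. Evolution preserves the operator norm bound, and the density has mass 1. *)
Lemma bare_parseval (Z : 'M[C]_n) :
  rintegrable (fun w => nrm2 (bare kappa E a w *m Z)) /\
  \int[mu]_w nrm2 (bare kappa E a w *m Z) <= aa * nrm2 Z.
Proof.
have [d v] := mx_int1_bare_gram kappa0 m1 h1 E a.
have [dr vr] := mx_valMr lin1 Z d; have [dl vl] := mx_valMl lin1 (Z^t*) dr.
have [D I] := mx_val_tr lin1 1%:M dl.
have De : (fun w => nrm2 (bare kappa E a w *m Z)) = (fun w => complex.Re ((1 : R)%:C *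
    \tr (1%:M *m (Z^t* *m ((bare kappa E a w)^t* *m bare kappa E a w *m Z))))).
  apply/funext => w; apply: esym; apply: (etrans (Re_weighted_tr 1 _)).
  by rewrite mul1r; apply: (congr1 (@complex.Re R) (esym (nrmC_gram _ _))).
rewrite De; split; first exact: D.
apply: (le_trans (_ : _ <= complex.Re (\tr (1%:M *m (Z^t* *m
  (mx_val (fun f : R -> R => \int[mu]_w f w) (fun=> (1 : R)%:C)
    (fun w => (bare kappa E a w)^t* *m bare kappa E a w) *m Z)))))).
  by rewrite I vl vr.
pose pk := normal_pdf (0 : R) (2 * kappa)^-1.
have s0 : 0 < (2 * kappa)^-1 by rewrite invr_gt0 mulr_gt0.
have ip : rintegrable pk by exact: integrable_normal_pdf.
pose F s := (rotated s)^t* *m rotated s.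
have FE s i j : F s i j = cis ((E i - E j) * s) * (a^t* *m a) i j.
  rewrite /F rotated_gram to_basis_evol mxE; congr (_ * _).
  apply: (congr1 (fun M : 'M[C]_n => M i j)).
  apply: (etrans (to_basisM uV _ _)).
  exact: (congr1 (fun M => M *m a) (to_basis_adj V A)).
have psin i j : rintegrable (fun s => pk s * sin ((E i - E j) * s)).
  apply: (le_rintegrable _ ip).
    apply: measurable_funM; first exact: measurable_normal_pdf.
    apply: measurableT_comp; last exact: measurable_funM.
    exact: continuous_measurable_fun (@continuous_sin R).
  move=> t; rewrite normrM ger0_norm ?normal_pdf_ge0//.
  by rewrite ler_piMr ?normal_pdf_ge0// sin_max.
have psin0 i j : \int[mu]_s (pk s * sin ((E i - E j) * s)) = 0.
  apply: Rintegral_odd => // s; rewrite mulrN sinN mulrN; congr (- (_ * _)).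
  by rewrite /pk !normal_pdfE ?gt_eqF// /normal_fun !subr0 sqrrN.
have key i j : complex_dom (fun f : R -> R => rintegrable f)
    (fun s => (pk s)%:C * F s i j) /\
    complexify (fun f : R -> R => \int[mu]_s f s) (fun s => (pk s)%:C * F s i j) =
    (a^t* *m a) i j * (\int[mu]_s (pk s * cos ((E i - E j) * s)))%:C.
  have -> : (fun s => (pk s)%:C * F s i j) =
      (fun s => (a^t* *m a) i j * ((pk s)%:C * cis ((E i - E j) * s))).
    by apply/funext => s; rewrite FE; ring.
  have [dc vc] := @complexify_cis R R (fun f : R -> R => rintegrable f)
    (fun f : R -> R => \int[mu]_t f t) pk (fun s => (E i - E j) * s) _
    (integrable_normal_cos _ s0) (psin i j) erefl.
  have [dz vz] := complexifyZ lin1 ((a^t* *m a) i j) dc.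
  by split; [exact: dz|rewrite vz vc psin0].
have dF : mx_dom (fun f : R -> R => rintegrable f) (fun s => (pk s)%:C) F.
  by move=> i j; exact: (key i j).1.
have vF : mx_val (fun f : R -> R => \int[mu]_s f s) (fun s => (pk s)%:C) F =
    mx_val (fun f : R -> R => \int[mu]_w f w) (fun=> (1 : R)%:C)
    (fun w => (bare kappa E a w)^t* *m bare kappa E a w).
  apply: (etrans _ (esym v)); apply/matrixP => i j.
  rewrite [LHS]mxE (key i j).2 [RHS]mxE [(a^t* *m a) i j]mxE mulr_suml.
  apply: eq_bigr => k _; rewrite adjE; congr (_ * _%:C).
  rewrite /overlap fhat_overlap//.
  by have -> : E k - E j - (E k - E i) = E i - E j by ring.
rewrite -vF.
have [dFr vFr] := mx_valMr lin1 Z dF; have [dFl vFl] := mx_valMl lin1 (Z^t*) dFr.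
have [D' I'] := mx_val_tr lin1 1%:M dFl.
rewrite -vFr -vFl -I'.
have eqle (y z : R) : y = z -> y <= z by move=> ->.
have e s : complex.Re ((pk s)%:C * \tr (1%:M *m (Z^t* *m (F s *m Z)))) =
    pk s * nrm2 (rotated s *m Z).
  by rewrite ReM_real mul1mx /nrm2 nrmC_gram.
apply: (le_normal_average s0 D') => s; apply: (le_trans (eqle _ _ (e s))).
apply: ler_wpM2l; [exact: normal_pdf_ge0|exact: rotated_le].
Qed.

Lemma jump_rotate w t (Z : 'M[C]_n) :
  nrm2 (T (w, t) *m Z) = nrm2 (bare kappa E a w *m (to_basis V (evol H (- t)) *m Z)).
Proof.
have eT : T (w, t) = to_basis V (evol H t) *m bare kappa E a w *m
    to_basis V (evol H (- t)).
  apply: (etrans (esym (to_basis_oft_t kappa0 H A w t))).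
  apply: (etrans (to_basisM uV _ _)).
  apply: (congr1 (fun M => M *m _)); apply: (etrans (to_basisM uV _ _)).
  exact: (congr1 (fun M => _ *m M) (to_basis_oft kappa0 H A w)).
rewrite eT; apply: (congr1 (@complex.Re R)).
exact: (nrmC_rot _ _ _ (to_basis_unitary uV (evol_unitary H t))).
Qed.

(** At each time the evolution is unitary and leaves the Parseval bound unchanged; the factor [1/2]
    is the mass of [g_kernel], that is [ghat 0]. *)
Lemma dbl_int_jump (Z : 'M[C]_n) :
  dbl_int (fun p => g p.2 * nrm2 (T p *m Z)) <= aa * nrm2 Z / 2.
Proof.
have gI : \int[mu]_t g t = 2^-1.
  by rewrite -(ghat0 beta0); apply: eq_Rintegral => t _; rewrite mul0r cos0 mulr1.
have ig : rintegrable g := integrable_g_kernel beta0.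
rewrite -gI -RintegralZl//; apply: le_Rintegral => //.
- exact: (dbl_integrable_jump Z).2.
- exact: rintegrableZl.
move=> t _ /=; have [i b] := bare_parseval (to_basis V (evol H (- t)) *m Z).
have e : (fun w => nrm2 (T (w, t) *m Z)) = _ := funext (fun w => jump_rotate w t Z).
rewrite RintegralZl//; last by rewrite e.
rewrite mulrC ler_wpM2r ?g_kernel_ge0// e; apply: (le_trans b).
have -> : nrm2 (to_basis V (evol H (- t)) *m Z) = nrm2 Z :=
  congr1 (@complex.Re R)
    (nrmC_unitaryl Z (to_basis_unitary uV (evol_unitary H (- t)))).
exact: lexx.
Qed.

Section state.
Variable x : 'M[C]_n.
Hypothesis hx : x^t* = x.
Let U := tilted kappa E a (fun nu => expR (beta * nu / 2)).

(** Expanding the square gives four products of two tilted operators with constant matrices between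
    or around them, each integrable on its own. *)
Lemma dbl_integrable_defect :
  dbl_integrable (fun p => gam p.1 * g p.2 * nrm2 (T p *m x - x *m U p)).
Proof.
have [d1 _] := mx_dbl_gram beta0 kappa0 mg g01 E a (fun=> 1) (fun=> 1).
have [d1r _] := mx_valMl lin2 x d1; have [d1l _] := mx_valMr lin2 x d1r.
have [d2 _] := mx_dbl_jump_r beta0 kappa0 mg g01 E a (fun=> 1)
  (fun nu => expR (beta * nu / 2)) x.
have [d2l _] := mx_valMl lin2 x d2.
have [d3 _] := mx_dbl_jump_r beta0 kappa0 mg g01 E a
  (fun nu => expR (beta * nu / 2)) (fun=> 1) x.
have [d3r _] := mx_valMr lin2 x d3.
have [d4 _] := mx_dbl_jump_r beta0 kappa0 mg g01 E a
  (fun nu => expR (beta * nu / 2)) (fun nu => expR (beta * nu / 2)) (x *m x).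
have [d12 _] := mx_valB lin2 d1l d2l.
have [d34 _] := mx_valB lin2 d3r d4.
have [d _] := mx_valB lin2 d12 d34.
have [D _] := mx_val_tr lin2 1%:M d.
by apply: (dbl_integrable_ext _ D) => p; rewrite /wt ReM_real mul1mx /nrm2 (nrmC_defect _ _ hx).
Qed.

Let delta := beta * kappa ^+ 2 / 2.
Let boost := expR (beta ^+ 2 * kappa ^+ 2 / 16).

Lemma up_boost p : tilted kappa E a (quarter_up beta) p =
  (expR (beta * p.1 / 4) * boost)%:C *: T (p.1 + delta, p.2).
Proof.
apply/matrixP => i j; rewrite [LHS]mxE [RHS]mxE [T _ _ _]mxE /quarter_up.
by rewrite fhat_boost// mul1r realC_scale.
Qed.

(** Since [e^{beta nu / 4} = e^{beta nu / 2} e^{- beta nu / 4}], the same lowering factor comes out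
    of both terms of the defect. What is left is the difference in the [ADB] integrand, at a shifted
    frequency. *)
Lemma defect_unboost p : defect beta kappa H A x p =
  (expR (- (beta * p.1 / 4)) * boost)%:C *:
    (T (p.1 - delta, p.2) *m x - x *m U (p.1 - delta, p.2)).
Proof.
rewrite /defect; set r := _%:C.
have -> : tilted kappa E a (quarter_dn beta) p = r *: T (p.1 - delta, p.2).
  apply/matrixP => i j; rewrite [LHS]mxE [RHS]mxE [T _ _ _]mxE /quarter_dn.
  by rewrite fhat_unboost// mul1r /r realC_scale.
have -> : tilted kappa E a (quarter_up beta) p = r *: U (p.1 - delta, p.2).
  apply/matrixP => i j; rewrite [LHS]mxE [RHS]mxE [U _ _ _]mxE /quarter_up.
  rewrite /r -realC_scale; apply: (congr1 (fun z : R => z%:C * _ * _)).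
  have -> : expR (beta * (E i - E j) / 4) = expR (beta * (E i - E j) / 2) *
      expR (- (beta * (E i - E j) / 4)) by rewrite -expRD; congr expR; field.
  by rewrite -mulrA fhat_unboost//= mulrCA.
by rewrite -scalemxAl -scalemxAr scalerBr.
Qed.

Section contraction.
Variable Y : 'M[C]_n.
Hypothesis cY : contraction Y.
Hypothesis nx : nrm2 x <= 1.

Let S (Z : 'M[C]_n) p := g p.2 * nrm2 (T (p.1 + delta, p.2) *m Z).
Notation Dint := (fun p => gam p.1 * g p.2 * nrm2 (T p *m x - x *m U p)).
Let Dsh p := Dint (p.1 - delta, p.2).
Let F p := complex.Re (wt beta gam p *
  \tr (Y^t* *m (half_gen beta kappa H A x p + (half_gen beta kappa H A x p)^t*))).

Let pointwise lam p : 0 < lam -> F p <=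
  lam * boost ^+ 2 / 2 * (2 * S x p + (S (Y *m x) p + S (Y^t* *m x) p)) +
  2 * lam^-1 * boost ^+ 2 * Dsh p.
Proof.
move=> lam0; set u := expR (beta * p.1 / 4).
have u0 : 0 < u := expR_gt0 _.
have l0 : 0 < lam / u ^+ 2 by rewrite divr_gt0// exprn_gt0.
have d0 : 0 <= delta by rewrite divr_ge0// mulr_ge0 ?(ltW beta0) ?sqr_ge0.
(* The rate at [w] is replaced by the rate at [w - delta], where the defect is now evaluated. *)
have cm : gam p.1 <= gam (p.1 - delta).
  by apply: gamma_rate_mono => //; rewrite gerBl.
have b := @Re_jump_herm _ _ Y (defect beta kappa H A x p) x
  (tilted kappa E a (quarter_up beta) p) (half_gen beta kappa H A x p) _ hx cY l0 erefl.
have nQ Z : nrm2 (tilted kappa E a (quarter_up beta) p *m Z) =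
    (u * boost) ^+ 2 * nrm2 (T (p.1 + delta, p.2) *m Z).
  apply: (etrans (congr1 (fun M => nrm2 (M *m Z)) (up_boost p))).
  exact: (etrans (congr1 (fun M => nrm2 M) (esym (scalemxAl _ _ _))) (nrm2Z _ _)).
have nD : nrm2 (defect beta kappa H A x p) = (u^-1 * boost) ^+ 2 *
    nrm2 (T (p.1 - delta, p.2) *m x - x *m U (p.1 - delta, p.2)).
  apply: (etrans (congr1 (fun M => nrm2 M) (defect_unboost p))).
  by apply: (etrans (nrm2Z _ _)); rewrite expRN.
rewrite !nQ nD in b.
rewrite /F /wt ReM_real /S /Dsh /=.
exact: (pointwise_arith lam0 u0 (g_kernel_ge0 beta0 p.2) (g01 p.1) cm
  (nrm2_ge0 _) (nrm2_ge0 _) (nrm2_ge0 _) (nrm2_ge0 _) b).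
Qed.

Let integrable_S (Z : 'M[C]_n) : dbl_integrable (S Z) /\ dbl_int (S Z) <= aa * nrm2 Z / 2.
Proof.
have [d v] := dbl_int_shift delta (dbl_integrable_jump Z).
by split; [exact: d|apply: (le_trans _ (dbl_int_jump Z)); rewrite -v].
Qed.

(** The terms with [x], [Y x] and [Y' x] have total weight 4 and each integrates to at most
    [aa / 2], because these matrices have norm at most 1; translation in [w] does not change the
    integrals. *)
Lemma dbl_int_generator_le lam : 0 < lam -> dbl_integrable F ->
  dbl_int F <= lam * (boost ^+ 2 * aa) +
    lam^-1 * (2 * boost ^+ 2 * dbl_int Dint).
Proof.
have arith (i1 i2 i3 b1 b2 b3 : R) : i1 <= b1 / 2 -> i2 <= b2 / 2 -> i3 <= b3 / 2 ->
    b1 <= aa -> b2 <= aa -> b3 <= aa -> 2 * i1 + (i2 + i3) <= 2 * aa by lra.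
have total (i1 d : R) : i1 <= 2 * aa -> 0 <= lam * boost ^+ 2 / 2 ->
    lam * boost ^+ 2 / 2 * i1 + 2 * lam^-1 * boost ^+ 2 * d <=
    lam * (boost ^+ 2 * aa) + lam^-1 * (2 * boost ^+ 2 * d).
  move=> h P0; apply: lerD.
    rewrite [leRHS](_ : _ = lam * boost ^+ 2 / 2 * (2 * aa)); last by field.
    exact: ler_wpM2l.
  by rewrite [leLHS](_ : _ = lam^-1 * (2 * boost ^+ 2 * d)); [exact: lexx|ring].
move=> lam0 dF.
have P0 : 0 <= lam * boost ^+ 2 / 2.
  by apply: divr_ge0 => //; apply: mulr_ge0; [exact: ltW|exact: sqr_ge0].
have aa0 : 0 <= aa := sqr_ge0 _.
have n2 : nrm2 (Y *m x) <= 1 := le_trans (nrm2_contraction x cY) nx.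
have n3 : nrm2 (Y^t* *m x) <= 1 :=
  le_trans (nrm2_contraction x (contraction_adj cY)) nx.
have m0 := ler_piMr aa0 nx; have m2 := ler_piMr aa0 n2; have m3 := ler_piMr aa0 n3.
have [d1 v1] := integrable_S x; have [d2 v2] := integrable_S (Y *m x).
have [d3 v3] := integrable_S (Y^t* *m x).
have [d4 v4] := dbl_int_shift (- delta) dbl_integrable_defect.
have [_ linD linZ] := lin2.
have [D1 V1] := linZ 2 _ d1; have [D23 V23] := linD _ _ d2 d3.
have [D123 V123] := linD _ _ D1 D23.
have [DS VS] := linZ (lam * boost ^+ 2 / 2) _ D123.
have [DD VD] := linZ (2 * lam^-1 * boost ^+ 2) _ d4.
have [DG VG] := linD _ _ DS DD.
apply: (le_trans (le_dbl_int dF DG (fun p => pointwise p lam0))).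
have eqle (y z : R) : y = z -> y <= z by move=> ->.
apply: (le_trans (eqle _ _ (etrans VG (congr2 (fun y z : R => y + z)
  (etrans VS (congr1 (fun y : R => _ * y)
    (etrans V123 (congr2 (fun y z : R => y + z) V1 V23))))
  (etrans VD (congr1 (fun y : R => _ * y) v4)))))).
exact: (total _ _ (arith _ _ _ _ _ _ v1 v2 v3 m0 m2 m3) P0).
Qed.

End contraction.

Lemma Re_generator_bound Y : contraction Y -> nrm2 x <= 1 ->
  complex.Re (\tr (Y^t* *m (rateT beta kappa H A (x *m x)
    - ((2^-1 *: rateN beta kappa H A - shiftN beta kappa H A) *m (x *m x)
       + x *m x *m (2^-1 *: rateN beta kappa H A + shiftN beta kappa H A))))) <=
  2 * Num.sqrt 2 * boost ^+ 2 * opnorm A * Num.sqrt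
    (dbl_int (fun p => gam p.1 * g p.2 * nrm2 (T p *m x - x *m U p))).
Proof.
move=> cY nx; set D := dbl_int _.
have [dF vF] := generator_dbl beta0 kappa0 H hA hx.
have [DF VF] := mx_val_tr lin2 (Y^t*) dF.
have D0 : 0 <= D.
  have i0 := dbl_integrable_defect.
  apply: Rintegral_ge0 => t _; apply: Rintegral_ge0 => w _ /=.
  rewrite mulr_ge0 ?nrm2_ge0// mulr_ge0 ?g_kernel_ge0//.
  by have /andP[] := g01 w.
apply: (le_trans (_ : _ <= 2 * Num.sqrt (boost ^+ 2 * aa * (2 * boost ^+ 2 * D)))).
  apply: (le_trans (_ : _ <= complex.Re (\tr (Y^t* *m mx_val (@dbl_int R) (wt beta gam)
    (fun p => half_gen beta kappa H A x p + (half_gen beta kappa H A x p)^t*))))).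
    rewrite le_eqVlt; apply/orP; left; apply/eqP.
    exact: (congr1 (fun M => complex.Re (\tr (Y^t* *m M))) (esym vF)).
  apply: optimise_scale.
  - by rewrite mulr_ge0 ?sqr_ge0.
  - by rewrite mulr_ge0// mulr_ge0 ?sqr_ge0.
  move=> l l0; apply: (le_trans _ (dbl_int_generator_le cY nx l0 DF)).
  rewrite le_eqVlt; apply/orP; left; apply/eqP; exact: esym VF.
rewrite (_ : boost ^+ 2 * aa * _ = (boost ^+ 2 * opnorm A) ^+ 2 * (2 * D)); last first.
  by rewrite /aa; ring.
rewrite sqrtrM ?sqr_ge0// sqrtr_sqr ger0_norm; last first.
  by rewrite mulr_ge0 ?sqr_ge0// opnorm_ge0.
by rewrite sqrtrM// le_eqVlt; apply/orP; left; apply/eqP; ring.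
Qed.

End state.

(** The Hilbert-Schmidt norm is basis independent, and conjugation by the Gibbs state is the
    multiplier [expR (beta * nu / 2)]. *)
Lemma ADB_dbl_int sigma : let x := to_basis V (sqrtmx sigma) in
  ADB H beta kappa A sigma = dbl_int (fun p => gam p.1 * g p.2 *
    nrm2 (T p *m x - x *m tilted kappa E a (fun nu => expR (beta * nu / 2)) p)).
Proof.
move=> x; apply: eq_Rintegral => t _; apply: eq_Rintegral => w _.
apply: (etrans (_ : _ = nrm2 (T (w, t) *m x -
    x *m tilted kappa E a (fun nu => expR (beta * nu / 2)) (w, t)) *
    gamma_rate beta kappa w * g_kernel beta t)); last by rewrite /gam /g /=; ring.
apply: (congr1 (fun r : R => r * _ * _)); apply: (etrans (hsnorm_sqr _)).
apply: (congr1 (@complex.Re R)); apply: (etrans (esym (to_basis_nrmC uV _))).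
apply: (congr1 (@nrmC _ _ _)); apply: (etrans (to_basis_defect _ _ _ _ uV)).
apply: (congr2 (fun M N => M - N)).
  exact: (congr1 (fun M => M *m x) (to_basis_oft_t kappa0 H A w t)).
apply: (congr1 (fun M => x *m M)); apply: (etrans (to_basis_gibbs _ _ beta0)).
apply/matrixP => i j; rewrite [LHS]mxE (to_basis_oft_t kappa0 H A w t).
by rewrite [tilted _ _ _ _ _ _ _]mxE [RHS]mxE mul1r realC_scale.
Qed.

End bounds.

(** * The trace norm bound with an absolute constant *)

Theorem theoremC2 (R : realType) :
  exists2 c : R, 0 < c &
  forall (n : nat) (H : 'M[R[i]]_(2 ^ n)) (beta kappa : R)
         (A sigma : 'M[R[i]]_(2 ^ n)),
    H \is hermsymmx ->
    0 < beta ->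
    0 < kappa <= 1 / beta ->
    A \is hermsymmx ->
    is_state sigma ->
    trnorm (lindblad H beta kappa A sigma)
      <= c * opnorm A * Num.sqrt (ADB H beta kappa A sigma).
Proof.
have s2 : 0 < Num.sqrt 2 :> R by rewrite sqrtr_gt0.
exists (2 * Num.sqrt 2 * expR 1); first by rewrite !mulr_gt0// expR_gt0.
move=> n H beta kappa A sigma _ beta0 /andP[kappa0 kb] /hermsym_adj hA [ps ts].
have uV := spectral_unitarymx H.
set V := spectralmx H in uV; set x := to_basis V (sqrtmx sigma).
have hx : x^t* = x.
  apply: (etrans (esym (to_basis_adj V _))).
  exact: (congr1 (to_basis V) (fun_herm_adj _ _)).
have xx : x *m x = to_basis V sigma.
  apply: (etrans (esym (to_basisM uV _ _))).
  exact: (congr1 (to_basis V) (sqrtmx_sqr ps)).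
(* The squared norm of the square root of a state is its trace. *)
have nx : nrm2 x <= 1.
  rewrite /nrm2 /nrmC hx xx.
  have e : \tr (to_basis V sigma) = 1 := etrans (to_basis_tr uV sigma) ts.
  by rewrite e.
have [W cW ->] := trnorm_dual (lindblad H beta kappa A sigma).
have cY : contraction (to_basis V W) by exact: to_basis_contraction.
have e : \tr (W^t* *m lindblad H beta kappa A sigma) =
    \tr ((to_basis V W)^t* *m to_basis V (lindblad H beta kappa A sigma)).
  apply: (etrans (esym (to_basis_tr uV _))); apply: (congr1 (@mxtrace _ _)).
  apply: (etrans (to_basisM uV _ _)).
  exact: (congr1 (fun M => M *m _) (to_basis_adj V W)).
rewrite e (to_basis_lindblad beta0 kappa0 H A sigma) -xx.
apply: (le_trans (Re_generator_bound beta0 kappa0 H hA hx cY nx)).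
rewrite (ADB_dbl_int beta0 kappa0).
apply: ler_wpM2r; first exact: sqrtr_ge0.
apply: ler_wpM2r; first exact: opnorm_ge0.
apply: ler_wpM2l; first by rewrite mulr_ge0// ltW.
(* It remains to bound [boost ^+ 2], which is [expR (beta ^ 2 * kappa ^ 2 / 8)], by [expR 1]; here
   [kappa <= 1 / beta] makes the constant absolute. *)
rewrite -expRM_natl ler_expR.
have kb1 : kappa * beta <= 1 by rewrite -ler_pdivlMr.
have : (kappa * beta) ^+ 2 <= 1 by rewrite expr_le1// mulr_ge0 ?ltW.
rewrite exprMn; lra.
Qed.
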